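(* Fix $s\ge1$ and $t:\mathbb N\to\{1,\dots,s\}$. For each $N$, with $M=M(N)$, suppose that $\mathbf W_1,\dots,\mathbf W_s\in\mathcal W\left(\frac1N I_N,I_M\right)$ are independent. Let $k\ge1$ be fixed (not depending on $N$), and for $1\le j\le k$ consider the real random variables $$X_j^{(N)}=\mathrm{tr}\Big(\prod_{r=1}^j\mathbf W_{t(r)}\Big)-\mathbb E\Big(\mathrm{tr}\Big(\prod_{r=1}^j\mathbf W_{t(r)}\Big)\Big).$$ Then as $N\to\infty$ with $M/N\to\lambda\in[0,\infty)$, the sequence of $k$-dimensional random variables $\big(X_j^{(N)}\big)_{1\le j\le k}$ converges in distribution to a multivariate normal law.
   Context: For a real symmetric positive definite $N\times N$ matrix $\Sigma$ and a real $M\times M$ matrix $B$, $\mathbf W\in\mathcal W(\Sigma,B)$ means that $\mathbf W=A'\mathbf X'B\mathbf XA$, where $\mathbf X$ is an $M\times N$ matrix of i.i.d. $N(0,1)$ real random variables, $A$ is a symmetric matrix with $A'A=A^2=\Sigma$, and $'$ denotes transpose. (So $\mathcal W(\frac1N I_N,I_M)$ is the law of $\frac1N\mathbf X'\mathbf X$.) $\mathrm{tr}$ is the usual unnormalized trace; products $\prod_{r=1}^j$ of matrices are taken in increasing order of $r$. Multivariate normal laws may be degenerate. *)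

(* Defs.v *)
From HB Require Import structures.
From mathcomp Require Import all_boot all_order all_algebra.
From mathcomp Require Import all_classical all_reals all_analysis.

Set Implicit Arguments.
Unset Strict Implicit.
Unset Printing Implicit Defensive.

Import Order.TTheory GRing.Theory Num.Theory.
Import numFieldNormedType.Exports.

Local Open Scope classical_set_scope.
Local Open Scope ring_scope.

(* The space of m x n real matrices with its Borel sigma-algebra; R^k is
   represented by mxBorel R 1 k. *)
Definition mxBorel (R : realType) (m n : nat) :=
  g_sigma_algebraType (@open 'M[R]_(m, n)).

Definition mutually_independent d (T : measurableType d) (R : realType)
    (P : probability T R) (I : finType) d' (E : measurableType d')
    (X : I -> T -> E) : Prop :=
  forall (J : {set I}) (B : I -> set E),
    (forall i, measurable (B i)) ->
    P (\bigcap_(i in [set` J]) X i @^-1` B i) =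
      (\prod_(i in J) P (X i @^-1` B i))%E.

Definition std_gaussian_mx d (T : measurableType d) (R : realType)
    (P : probability T R) (m n : nat) (X : T -> 'M[R]_(m, n)) : Prop :=
  [/\ forall i j, measurable_fun setT (fun w => X w i j),
      forall i j (B : set R), measurable B ->
        P ((fun w => X w i j) @^-1` B) = normal_prob 0 1 B &
      mutually_independent P (fun (ij : 'I_m * 'I_n) w => X w ij.1 ij.2)].

Definition wishart d (T : measurableType d) (R : realType)
    (P : probability T R) (m n : nat) (Sigma : 'M[R]_n) (B : 'M[R]_m)
    (W : T -> 'M[R]_n) : Prop :=
  exists (X : T -> 'M[R]_(m, n)) (A : 'M[R]_n),
    [/\ std_gaussian_mx P X, A^T = A, A^T *m A = Sigma &
        forall w, W w = A^T *m (X w)^T *m B *m X w *m A].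

(* The case s = 0 is separate because normal_prob m 0 is a junk value (the
   uniform law on [0, 1]) instead of the degenerate normal law at m. *)
Definition normal_law (R : realType) (m s : R) (B : set R) : \bar R :=
  if s == 0 then dirac m B else normal_prob m s B.

(* Possibly degenerate multivariate normal law on R^k: every linear functional
   is normal. *)
Definition multivariate_normal (R : realType) (k : nat)
    (mu : probability (mxBorel R 1 k) R) : Prop :=
  forall a : 'cV[R]_k, exists (m s : R), 0 <= s /\
    forall B : set R, measurable B ->
      mu [set x : 'rV[R]_k | B ((x *m a) 0 0)] = normal_law m s B.

(* Weak convergence; the random vectors may live on different spaces. *)
Definition cvg_in_distribution (R : realType) (k : nat)
    (d : nat -> measure_display) (T : forall N, measurableType (d N))
    (P : forall N, probability (T N) R) (Y : forall N, T N -> 'rV[R]_k)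
    (mu : probability (mxBorel R 1 k) R) : Prop :=
  forall f : 'rV[R]_k -> R, continuous f ->
    (exists C : R, forall x, `|f x| <= C) ->
    (fun N => 'E_(P N)[f \o Y N]%E) @ \oo --> 'E_mu[f]%E.

Definition tr_prod (R : realType) (s N : nat) (t : nat -> 'I_s)
    (T : Type) (W : 'I_s -> T -> 'M[R]_N) (j : nat) (w : T) : R :=
  \tr (\prod_(1 <= r < j.+1) W (t r) w).

(* The expectations are finite for Wishart matrices, so fine is harmless
   there. Coordinate j : 'I_k is the variable of index j.+1 in 1..k. *)
Definition centered_traces d (T : measurableType d) (R : realType)
    (P : probability T R) (s N k : nat) (t : nat -> 'I_s)
    (W : 'I_s -> T -> 'M[R]_N) (w : T) : 'rV[R]_k :=
  \row_(j < k) (tr_prod t W j.+1 w - fine 'E_P[tr_prod t W j.+1]).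

(* Main.v *)
Require Import Defs.
From HB Require Import structures.
From mathcomp Require Import all_boot all_order all_algebra.
From mathcomp Require Import all_classical all_reals all_analysis.
From mathcomp Require Import measurable_realfun.
From mathcomp Require Import ring lra zify.
From mathcomp Require Import -(notations) mpoly.

Import Order.TTheory GRing.Theory Num.Theory.
Import numFieldNormedType.Exports.

Set Implicit Arguments.
Unset Strict Implicit.
Unset Printing Implicit Defensive.

Local Open Scope classical_set_scope.
Local Open Scope ring_scope.

(** The centred traces converge in law because all their joint moments converge
    to those of a Gaussian family, and moments of a Gaussian family control the
    law.

    Loop equations. Write W_i = Y_i^T Y_i with Y_i = X_i A_i.  As A_i^T A_i is
    nu I with nu = 1/N, Gaussian integration by parts reads
    E(Y_ab f) = nu E(d_ab f) for the entries of Y_i.  Splitting the first factor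
    Y off the trace of a word and differentiating everything else turns the
    expectation of a product of traces into expectations of traces of other
    words.  For m(w) = E(tr w) / N and k(L), the expectation of the product of
    tr w - E(tr w) over the words w of L, these equations close up
    ([phi_ntr_rec], [phi_cprod_rec]): the words on the right have smaller total
    length and the coefficients involve only M/N and 1/N.  That no positive
    power of N survives is the cancellation that makes unnormalized traces
    fluctuate at order one.  By induction on the total length all m(w) and k(L)
    converge.  In the limit the terms in 1/N are gone, and what remains is a
    recursion whose solution obeys Wick's rule, that is, k(w :: L) is the sum
    over w' in L of k(w, w') k(L minus w') ([wick]).  Hence every linear
    combination of centred traces has limiting moments sg^n E(g^n), with g
    standard normal ([mom_gaussian]).

    The hypothesis gives independence of the W_i, and not of the Gaussian
    matrices behind them.  The loop equations are therefore derived for a formal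
    Gaussian expectation [gauss] on polynomials in the entries of all matrices.
    They hold for the W_i because both expectations of a monomial in the entries
    of the W_i factor over i, and each factor involves one Gaussian matrix only
    ([mean_monomial_wishart]).

    From moments to laws ([cvg_of_gaussian_moments]).  The Taylor remainder of
    order 2n of a wave is at most a moment of order 2n divided by (2n)!; for
    Gaussian moments this is sg^2n / (2^n n!), which tends to 0 with n.  So the
    mean of every trigonometric polynomial converges.  A bounded continuous
    function is within e (1 + |x|^2) of a trigonometric polynomial
    ([trigpoly_approx]), and second moments stay bounded, so its mean converges
    too.

    The limit law.  The limiting covariance C is positive semidefinite, so
    C = L^T L ([psd_factor]), and a vector with the required moments is a linear
    image of entries of one of the given Gaussian matrices; if these matrices
    have no rows, all covariances vanish and the zero vector will do.  Its linear
    functionals are normal since in dimension one Gaussian moments determine the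
    law ([normal_law_of_moments]). *)

(** * Taylor polynomials of waves *)
Section TaylorTrig.
Variable R : realType.
Implicit Types (a b x z : R) (p : {poly R}).

Definition antideriv p : {poly R} :=
  \poly_(i < (size p).+1) (p`_i.-1 / i%:R).

Lemma deriv_antideriv p : (antideriv p)^`() = p.
Proof.
apply/polyP => i; rewrite coef_deriv coef_poly ltnS /=.
case: ltnP => h; last by rewrite mul0rn nth_default.
by rewrite -[LHS]mulr_natr divfK // pnatr_eq0.
Qed.

Lemma antideriv0 p : (antideriv p).[0] = 0.
Proof. by rewrite horner_coef0 coef_poly /= invr0 mulr0. Qed.

Lemma le_of_derive_ge0 (f df : R -> R) z : 0 <= z ->
  (forall x, is_derive x 1 f (df x)) ->
  (forall x, 0 <= x -> 0 <= df x) -> f 0 <= f z.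
Proof.
move=> z0 fd df0.
have [|c] := @MVT_segment R f df 0 z z0 (fun x _ => fd x).
  apply: continuous_subspaceT => x; apply: differentiable_continuous.
  by apply/derivable1_diffP; case: (fd x).
rewrite in_itv /= => /andP[c0 _] /eqP; rewrite subr0 subr_eq => /eqP->.
by rewrite lerDr mulr_ge0 // df0.
Qed.

(** The functions g + f and g - f, with g the primitive of K x^n, are
    nondecreasing and vanish at 0: a comparison that avoids integrals. *)
Lemma derive_bound_ge0 (f df : R -> R) (K : R) n z : 0 <= z ->
  (forall x, is_derive x 1 f (df x)) -> f 0 = 0 ->
  (forall x, 0 <= x -> `|df x| <= K * x ^+ n) ->
  `|f z| <= K * z ^+ n.+1 / n.+1%:R.
Proof.
move=> z0 fd f0 dfK.
pose g x := K / n.+1%:R * x ^+ n.+1.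
have gE x : K * x ^+ n.+1 / n.+1%:R = g x by rewrite /g mulrAC.
have gd x : is_derive x 1 g (K * x ^+ n).
  have -> : g = horner ((K / n.+1%:R) *: ('X ^+ n.+1)).
    by apply/funext => y; rewrite /g !hornerE.
  apply: is_derive_eq.
  by rewrite derivZ derivXn hornerZ hornerMn hornerXn -[x ^+ _ *+ _]mulr_natl mulrA divfK ?pnatr_eq0.
have g0 : g 0 = 0 by rewrite /g expr0n mulr0.
rewrite gE ler_norml; apply/andP; split.
  have := @le_of_derive_ge0 (g + f) (fun x => K * x ^+ n + df x) z z0 _ _.
  rewrite /= !fctE g0 f0 addr0 => h; rewrite -subr_ge0 opprK addrC h //.
  by move=> x x0; have := dfK x x0; rewrite ler_norml => /andP[]; lra.
have := @le_of_derive_ge0 (g - f) (fun x => K * x ^+ n - df x) z z0 _ _.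
rewrite /= !fctE g0 f0 subr0 => h; rewrite -subr_ge0 h //.
by move=> x x0; have := dfK x x0; rewrite ler_norml => /andP[]; lra.
Qed.

Lemma derive_bound (f df : R -> R) (K : R) n z :
  (forall x, is_derive x 1 f (df x)) -> f 0 = 0 ->
  (forall x, `|df x| <= K * `|x| ^+ n) ->
  `|f z| <= K * `|z| ^+ n.+1 / n.+1%:R.
Proof.
move=> fd f0 dfK.
have [z0|/ltW z0] := leP 0 z.
  rewrite (ger0_norm z0).
  apply: (derive_bound_ge0 z0 fd f0) => x x0.
  by have := dfK x; rewrite (ger0_norm x0).
have -> : f z = (f \o -%R) (- z) by rewrite /= opprK.
rewrite (ler0_norm z0).
apply: (@derive_bound_ge0 (f \o -%R) (fun x => - df (- x))).
- by rewrite oppr_ge0.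
- move=> x; apply: is_derive_eq.
  by rewrite -[LHS]/(_ * _) ?mulN1r ?mulrN1.
- by rewrite /= oppr0.
- by move=> x x0; have := dfK (- x); rewrite !normrN (ger0_norm x0).
Qed.

(** The derivative of a wave is again a wave with the same |a| + |b|.  Hence the
    estimate of order n, applied to the derivative, integrates to that of order
    n + 1, and the polynomial itself is built by the same integration. *)
Lemma taylor_cos_sin n a b : exists p, forall z,
  `|a * cos z + b * sin z - p.[z]| <= (`|a| + `|b|) * `|z| ^+ n / n`!%:R.
Proof.
elim: n a b => [|n IH] a b.
  exists 0 => z; rewrite horner0 subr0 expr0 fact0 divr1 mulr1.
  apply: le_trans (ler_normD _ _) _; rewrite !normrM lerD // ler_piMr //.
    by rewrite ler_norml cos_le1 cos_geN1.
  by rewrite ler_norml sin_le1 sin_geN1.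
have [p pP] := IH b (- a).
exists (antideriv p + a%:P) => z.
pose f z := a * cos z + b * sin z - (antideriv p + a%:P).[z].
rewrite -[X in `|X|]/(f z).
have -> : (`|a| + `|b|) * `|z| ^+ n.+1 / n.+1`!%:R =
  (`|a| + `|b|) / n`!%:R * `|z| ^+ n.+1 / n.+1%:R.
  by rewrite factS natrM invfM; ring.
apply: (@derive_bound f (fun x => b * cos x + - a * sin x - p.[x])).
- move=> x.
  have := is_deriveB (is_deriveD (is_deriveZ a (is_derive_cos x))
    (is_deriveZ b (is_derive_sin x))) (is_derive_poly (antideriv p + a%:P) x).
  rewrite derivD derivC addr0 deriv_antideriv.
  by move=> h; apply: is_derive_eq h _; rewrite -![_ *: _]/(_ * _); ring.
- by rewrite /f cos0 sin0 hornerD antideriv0 hornerC; ring.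
- by move=> x; have := pP x; rewrite normrN (addrC `|b|) mulrAC.
Qed.
End TaylorTrig.

(** * Trigonometric polynomials approximate bounded continuous functions *)
Section TrigPoly.
Variables (R : realType) (k : nat).
Implicit Types (f g : 'rV[R]_k -> R) (v w : 'cV[R]_k) (x : 'rV[R]_k).

Inductive trigpoly : ('rV[R]_k -> R) -> Prop :=
| trigpoly_wave a b v :
    trigpoly (fun x => a * cos ((x *m v) 0 0) + b * sin ((x *m v) 0 0))
| trigpolyD f g : trigpoly f -> trigpoly g -> trigpoly (fun x => f x + g x).

(** Product-to-sum formulas; this is why waves may have arbitrary frequency
    vectors v, and not only those along the axes. *)
Lemma trigpolyM f g : trigpoly f -> trigpoly g -> trigpoly (fun x => f x * g x).
Proof.
move=> tf tg; elim: tf => {f} [a b v|f1 f2 _ IH1 _ IH2]; last first.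
  have -> : (fun x => (f1 x + f2 x) * g x) = (fun x => f1 x * g x + f2 x * g x).
    by apply/funext => x; rewrite mulrDl.
  exact: trigpolyD IH1 IH2.
elim: tg => {g} [c d w|g1 g2 _ IH1 _ IH2]; last first.
  under eq_fun do rewrite mulrDr.
  exact: trigpolyD IH1 IH2.
have -> : (fun x => (a * cos ((x *m v) 0 0) + b * sin ((x *m v) 0 0)) *
    (c * cos ((x *m w) 0 0) + d * sin ((x *m w) 0 0))) =
  (fun x => ((a * c + b * d) / 2 * cos ((x *m (v - w)) 0 0) +
             (b * c - a * d) / 2 * sin ((x *m (v - w)) 0 0)) +
            ((a * c - b * d) / 2 * cos ((x *m (v + w)) 0 0) +
             (b * c + a * d) / 2 * sin ((x *m (v + w)) 0 0))).
  apply/funext => x; rewrite mulmxBr mulmxDr !mxE.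
  by rewrite cosB cosD sinB sinD; field.
exact: trigpolyD (trigpoly_wave _ _ _) (trigpoly_wave _ _ _).
Qed.

Lemma trigpoly_cst a : trigpoly (fun=> a).
Proof.
have := trigpoly_wave a 0 0; congr trigpoly.
by apply/funext => x; rewrite mulmx0 mxE cos0 mul0r addr0 mulr1.
Qed.

Lemma trigpoly_sin_coord j c : trigpoly (fun x => sin (x 0 j * c)).
Proof.
have := trigpoly_wave 0 1 (c *: delta_mx j 0); congr trigpoly.
apply/funext => x; rewrite mul0r add0r mul1r -scalemxAr mxE mulrC.
congr (sin (_ * _)); rewrite mxE (bigD1 j) //= mxE !eqxx mulr1 big1 ?addr0 //.
by move=> i ij; rewrite mxE (negbTE ij) mulr0.
Qed.
End TrigPoly.

Section Walk.
Variables (R : realType) (k : nat).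
Implicit Types (u : 'I_k -> R) (l : seq 'I_k) (al : 'I_k -> nat).
Implicit Types (h : ('I_k -> nat) -> R).

Definition step al (j : 'I_k) : 'I_k -> nat := fun i => (al i + (i == j))%N.

(** Bernstein approximation is phrased through a random walk on exponents: for
    each letter j of the list l a coin with success probability u j decides
    whether coordinate j advances.  The value [walk u l h al] is the expectation
    of h at the final position when starting from al.  It is polynomial in u,
    and the binomial mean and variance come out of a one-line induction. *)
Fixpoint walk u l h al : R :=
  if l is j :: l' then
    u j * walk u l' h (step al j) + (1 - u j) * walk u l' h al
  else h al.

Lemma walkD u l h1 h2 al :
  walk u l (fun b => h1 b + h2 b) al = walk u l h1 al + walk u l h2 al.
Proof. by elim: l al => //= j l IH al; rewrite !IH; ring. Qed.

Lemma walkZ u l c h al : walk u l (fun b => c * h b) al = c * walk u l h al.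
Proof. by elim: l al => //= j l IH al; rewrite !IH; ring. Qed.

Lemma walk_cst u l c al : walk u l (fun=> c) al = c.
Proof. by elim: l al => //= j l IH al; rewrite !IH; ring. Qed.

Lemma walk_sum u l (H : 'I_k -> ('I_k -> nat) -> R) al :
  walk u l (fun b => \sum_i H i b) al = \sum_i walk u l (H i) al.
Proof.
elim: l al => //= j l IH al.
by rewrite !IH !mulr_sumr -big_split.
Qed.

Lemma walk_le u l h1 h2 al : (forall i, 0 <= u i <= 1) ->
  (forall b, h1 b <= h2 b) -> walk u l h1 al <= walk u l h2 al.
Proof.
move=> u01 h12; elim: l al => //= j l IH al.
have /andP[u0 u1] := u01 j.
by rewrite lerD // ler_wpM2l // subr_ge0.
Qed.

Lemma walk_norm u l h al : (forall i, 0 <= u i <= 1) ->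
  `|walk u l h al| <= walk u l (fun b => `|h b|) al.
Proof.
move=> u01; elim: l al => //= j l IH al.
have /andP[u0 u1] := u01 j.
apply: le_trans (ler_normD _ _) _; rewrite !normrM.
have u1' : 0 <= 1 - u j by rewrite subr_ge0.
by rewrite (ger0_norm u0) (ger0_norm u1') lerD // ler_wpM2l.
Qed.

Lemma walk_variance u l j (c : R) al :
  walk u l (fun b => ((b j)%:R - c) ^+ 2) al =
  ((al j)%:R - c + (count_mem j l)%:R * u j) ^+ 2
  + (count_mem j l)%:R * (u j * (1 - u j)).
Proof.
elim: l al => /= [|i l IH] al; first by rewrite !mul0r !addr0.
rewrite !IH /step; have [->|ij] := eqVneq i j.
  rewrite ?eqxx !natrD mulr1n; ring.
rewrite addn0 add0n; ring.
Qed.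

(** With n coins for each coordinate, the final position divided by n is an
    average with mean u and variance u (1 - u) / n in each coordinate. *)
Definition laps n : seq 'I_k := flatten (nseq n (enum 'I_k)).

Lemma count_laps n j : count_mem j (laps n) = n.
Proof.
rewrite /laps count_flatten map_nseq sumn_nseq.
by rewrite (count_uniq_mem _ (enum_uniq _)) mem_enum mul1n.
Qed.

Lemma walk_trigpoly (U : 'rV[R]_k -> 'I_k -> R) l h al :
  (forall j, trigpoly (fun x => U x j)) -> trigpoly (fun x => walk (U x) l h al).
Proof.
move=> tU; elim: l al => [|j l IH] al /=; first exact: trigpoly_cst.
have tU' : trigpoly (fun x => 1 - U x j).
  under eq_fun do rewrite -mulN1r.
  apply: trigpolyD (trigpoly_cst _ _) _.
  exact: trigpolyM (trigpoly_cst _ _) _.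
exact: trigpolyD (trigpolyM (tU j) (IH _)) (trigpolyM tU' (IH _)).
Qed.
End Walk.

Section Approx.
Variables (R : realType) (k : nat).
Implicit Types (f : 'rV[R]_k -> R) (x y v : 'rV[R]_k).

Definition sqnorm x : R := \sum_j (x 0 j) ^+ 2.

Lemma sqnorm_ge0 x : 0 <= sqnorm x.
Proof. by apply: sumr_ge0 => j _; exact: sqr_ge0. Qed.

Lemma unit_cube_compact :
  compact [set v : 'rV[R]_k | forall i, v ord0 i \in `[0, 1]].
Proof.
have := @rV_compact R k (fun _ => `[0, 1]%classic)
  (fun _ => @segment_compact R 0 1).
by [].
Qed.

(** Near the compact cube f is uniformly continuous, which gives e; at distance
    at least r the bound 2 C on the oscillation is absorbed by
    (2 C / r^2) |x - y|^2.  A quadratic modulus is the form that can be averaged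
    against the variance of the walk. *)
Lemma cube_quadratic_modulus f (C e : R) : continuous f ->
  (forall x, `|f x| <= C) -> 0 < e ->
  exists2 K, 0 <= K & forall x y, (forall i, x ord0 i \in `[0, 1]) ->
    `|f x - f y| <= e + K * sqnorm (x - y).
Proof.
move=> cf fC e0.
pose Pr (r : R) x := forall y, ball x r y -> `|f x - f y| <= e.
have : \forall r \near (0:R)^'+,
    [set v : 'rV[R]_k | forall i, v ord0 i \in `[0, 1]] `<=` Pr r.
  apply: (proj1 (compact_near_coveringP _) unit_cube_compact) => x _.
  have e2 : 0 < e / 2 by rewrite divr_gt0.
  have : \forall t \near x, `|f x - f t| <= e / 2.
    by have /cvgrPdist_le/(_ _ e2) := cf x.
  move=> /nbhs_ballP[r /= r0 xr].
  exists (ball x (r / 2), [set s : R | s < r / 2]).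
    split => /=; first by apply: nbhsx_ballx; rewrite divr_gt0.
    by apply: nbhs_right_lt; rewrite divr_gt0.
  move=> [x' s] [/= xx' sr] y x'y.
  have xy : ball x r y.
    rewrite [r]splitr; apply: ball_triangle xx' _.
    by apply: le_ball x'y; exact: ltW.
  have xx'' : ball x r x'.
    by apply: le_ball xx'; rewrite ler_pdivrMr // ler_pMr // ler1n.
  have -> : f x' - f y = (f x - f y) - (f x - f x') by ring.
  rewrite [e]splitr; apply: le_trans (ler_normB _ _) _.
  by rewrite lerD // xr.
case=> r0 /= r00 H.
pose r : R := r0 / 2.
have rgt0 : 0 < r by rewrite divr_gt0.
have {}H : forall x, (forall i, x ord0 i \in `[0, 1]) -> Pr r x.
  apply: (H r) => //=.
  rewrite sub0r normrN gtr0_norm // /r ltr_pdivrMr // ltr_pMr //.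
  by rewrite ltr1n.
have C0 : 0 <= C by apply: le_trans (fC 0); exact: normr_ge0.
have K0 : 0 <= 2 * C / r ^+ 2.
  by apply: divr_ge0; [exact: mulr_ge0 | exact: sqr_ge0].
exists (2 * C / r ^+ 2) => // x y x01.
have [xy|xy] := pselect (ball x r y).
  by apply: le_trans (H _ x01 _ xy) _; rewrite lerDl mulr_ge0 // sqnorm_ge0.
have [j rj] : exists j, r <= `|x 0 j - y 0 j|.
  apply: contrapT => /forallNP N; apply: xy; split=> // i j; rewrite ord1.
  by rewrite /ball /= ltNge; apply/negP; exact: N.
have rs : r ^+ 2 <= sqnorm (x - y).
  rewrite /sqnorm (bigD1 j) //= -[leLHS]addr0 lerD //.
    by rewrite !mxE -[leRHS]real_normK ?num_real // lerXn2r // nnegrE ltW.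
  by apply: sumr_ge0 => i _; exact: sqr_ge0.
apply: (@le_trans _ _ (2 * C)).
  rewrite mulr2n mulrDl mul1r; apply: le_trans (ler_normB _ _) _.
  by rewrite lerD.
rewrite -[leLHS]add0r lerD ?(ltW e0) // mulrAC ler_pdivlMr ?exprn_gt0 //.
by rewrite ler_wpM2l // mulr_ge0.
Qed.

Lemma mx_continuous (T : topologicalType) m n (g : T -> 'M[R]_(m, n)) :
  (forall i j, continuous (fun t => g t i j)) -> continuous g.
Proof.
move=> cg t; apply/cvg_mx_entourageP => A entA.
apply: (@filter_forall _ _
  (fun i (N : 'M[R]_(m, n)) => forall j, (g t i j, N i j) \in A)) => i.
apply: (@filter_forall _ _
  (fun j (N : 'M[R]_(m, n)) => (g t i j, N i j) \in A)) => j.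
have h : \forall x \near t, A (g t i j, g x i j).
  by have /cvg_entourageP/(_ _ entA) := cg i j t.
suff : \forall x \near t, (g t i j, g x i j) \in A by [].
by apply: filterS h => x; rewrite inE.
Qed.

(** Clamping the argument keeps asin away from the end points of its domain and
    makes a continuous function on the whole line; the clamp is invisible on
    sin t for |t| at most 1/2, the only values where the inverse is used. *)
Definition clamped_asin (y : R) : R :=
  asin (Num.max (- sin (1 / 2)) (Num.min (sin (1 / 2)) y)).

Lemma half_in_pihalf (t : R) : `|t| <= 1 / 2 -> t \in `[- (pi / 2), pi / 2].
Proof.
have p1 := pihalf_ge1 R.
by rewrite ler_norml in_itv /= => /andP[h1 h2]; apply/andP; split; lra.
Qed.

Lemma sin_half_bounds : 0 <= sin (1 / 2 : R) < 1.
Proof.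
have p1 := pihalf_ge1 R.
apply/andP; split; first by apply/ltW/sin2_gt0; apply/andP; split; lra.
by rewrite -[ltRHS](sin_pihalf R) ltr_sin ?in_itv /=;
  (try apply/andP; try split); lra.
Qed.

Lemma clamped_asinK t : `|t| <= 1 / 2 -> clamped_asin (sin t) = t.
Proof.
move=> t1; have tI := half_in_pihalf t1.
have hI : (1 / 2 : R) \in `[- (pi / 2), pi / 2].
  by apply: half_in_pihalf; rewrite ger0_norm; lra.
have hIN : (- (1 / 2) : R) \in `[- (pi / 2), pi / 2].
  by apply: half_in_pihalf; rewrite normrN ger0_norm; lra.
move: (t1); rewrite ler_norml => /andP[t2 t3].
rewrite /clamped_asin min_r ?max_r ?sinK //.
  by rewrite -sinN leNgt ltr_sin // -leNgt.
by rewrite leNgt ltr_sin // -leNgt.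
Qed.

Lemma continuous_clamped_asin : continuous clamped_asin.
Proof.
move=> y.
have /andP[c0 c1] := sin_half_bounds.
rewrite /clamped_asin; set c := sin _ in c0 c1 *.
have h1 : {for y, continuous (fun z : R => Num.max (- c) (Num.min c z))}.
  apply: (@continuous_max R R (fun=> - c) (fun z : R => Num.min c z)).
    exact: cvg_cst.
  apply: (@continuous_min R R (fun=> c) id); first exact: cvg_cst.
  exact: cvg_id.
have h2 : {for Num.max (- c) (Num.min c y), continuous (@asin R)}.
  apply: continuous_asin; apply/andP; split.
    by rewrite lt_max ltrN2 c1.
  rewrite gt_max; apply/andP; split; first lra.
  by rewrite gt_min c1.
exact: continuous_comp h1 h2.
Qed.

(** Put u = (1 + sin (x / 2L)) / 2 in each coordinate.  On the box |x_j| <= L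
    this is injective, so f is a continuous function F of u in the unit cube, and
    the Bernstein polynomial of F is a trigonometric polynomial in x, close to f
    on the box.  Outside the box both are bounded by C, and 2 C is at most
    e |x|^2 because L was chosen large.  The form of the error lets a bound on second
    moments replace tightness. *)
Lemma trigpoly_approx f (C e : R) : continuous f -> (forall x, `|f x| <= C) ->
  0 < e -> exists2 g, trigpoly g & forall x, `|f x - g x| <= e + e * sqnorm x.
Proof.
move=> cf fC e0.
have C0 : 0 <= C by apply: le_trans (fC 0); exact: normr_ge0.
(* Large enough for 2 C <= e L^2, see LC. *)
pose L := 1 + 2 * C / e.
have L1 : 1 <= L by rewrite lerDl divr_ge0 ?mulr_ge0 // ltW.
have L0 : 0 < L by apply: lt_le_trans L1.
have LC : 2 * C <= e * L ^+ 2.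
  apply: (@le_trans _ _ (e * L)); last first.
    by rewrite ler_wpM2l ?(ltW e0) // expr2 ler_peMr // ltW.
  by rewrite /L mulrDr mulr1 [X in _ <= _ + X]mulrC divfK ?gt_eqF // lerDr ltW.
pose c := (2 * L)^-1.
pose Finv (v : 'rV[R]_k) : 'rV[R]_k := \row_j (2 * L * clamped_asin (2 * v 0 j - 1)).
pose F := f \o Finv.
have cFinv : continuous Finv.
  apply: mx_continuous => i j v.
  have -> : (fun v => Finv v i j) =
      (fun z => 2 * L * clamped_asin (2 * z - 1)) \o (fun v : 'rV[R]_k => v 0 j).
    by apply/funext => w /=; rewrite mxE.
  apply: continuous_comp; first exact: coord_continuous.
  apply: cvgM; first exact: cvg_cst.
  apply: (@continuous_comp _ _ _ (fun z : R => 2 * z - 1) clamped_asin).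
    apply: cvgB; last exact: cvg_cst.
    by apply: cvgM; [exact: cvg_cst | exact: cvg_id].
  exact: continuous_clamped_asin.
have cF : continuous F by move=> v; exact: continuous_comp (cFinv v) (cf _).
have [|K K0 FK] := cube_quadratic_modulus cF (fun v => fC _) (_ : 0 < e / 2).
  by rewrite divr_gt0.
pose U (x : 'rV[R]_k) j : R := (1 + sin (x 0 j * c)) / 2.
have U01 x j : 0 <= U x j <= 1.
  have := sin_le1 (x 0 j * c); have := sin_geN1 (x 0 j * c).
  by rewrite /U => h1 h2; apply/andP; split; lra.
have [n n0 nK] : exists2 n, (0 < n)%N & K * k%:R / n%:R <= e / 2.
  exists (Num.Def.trunc ((e / 2)^-1 * (K * k%:R))).+1 => //.
  rewrite ler_pdivrMr ?ltr0n // -ler_pdivrMl ?divr_gt0 //.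
  by apply/ltW/truncnS_gt.
have n0' : (0 : R) < n%:R by rewrite ltr0n.
pose pt (al : 'I_k -> nat) : 'rV[R]_k := \row_j ((al j)%:R / n%:R).
exists (fun x => walk (U x) (laps k n) (F \o pt) (fun=> 0%N)).
  apply: walk_trigpoly => j; rewrite /U.
  under eq_fun do rewrite mulrC.
  apply: trigpolyM (trigpoly_cst _ _) (trigpolyD (trigpoly_cst _ _) _).
  exact: trigpoly_sin_coord.
move=> x; set W := walk (U x) (laps k n).
have [xL|xL] := pselect (forall j, `|x 0 j| <= L); last first.
  have [j xj] : exists j, L < `|x 0 j|.
    apply: contrapT => /forallNP N; apply: xL => j.
    by rewrite leNgt; apply/negP; exact: N.
  have xs : L ^+ 2 <= sqnorm x.
    rewrite /sqnorm (bigD1 j) //= -[leLHS]addr0 lerD //.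
      by rewrite -[leRHS]real_normK ?num_real // lerXn2r // ?nnegrE ?(ltW L0) // ltW.
    by apply: sumr_ge0 => i _; exact: sqr_ge0.
  apply: (@le_trans _ _ (2 * C)).
    rewrite mulr2n mulrDl mul1r; apply: le_trans (ler_normB _ _) _.
    rewrite lerD //; apply: le_trans (walk_norm _ _ _ (U01 x)) _.
    rewrite -[leRHS](walk_cst (U x) (laps k n) C (fun=> 0%N)).
    by apply: walk_le => // b; exact: fC.
  apply: le_trans LC _; rewrite -[leLHS]add0r lerD ?(ltW e0) //.
  by rewrite ler_wpM2l // ltW.
pose ux : 'rV[R]_k := \row_j U x j.
have Fux : F ux = f x.
  rewrite /F /=; congr f; apply/rowP => j; rewrite !mxE /U.
  have -> : 2 * ((1 + sin (x 0 j * c)) / 2) - 1 = sin (x 0 j * c) by field.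
  rewrite clamped_asinK; first by rewrite /c mulrC divfK // gt_eqF // mulr_gt0.
  rewrite normrM /c (@gtr0_norm _ (2 * L)^-1) ?invr_gt0 ?mulr_gt0 //.
  rewrite ler_pdivrMr ?mulr_gt0 //.
  by have -> : 1 / 2 * (2 * L) = L by field.
apply: (@le_trans _ _ e); last first.
  by rewrite lerDl mulr_ge0 ?sqnorm_ge0 // ltW.
have -> : f x - W (F \o pt) (fun=> 0%N) =
    W (fun b => f x + (-1) * F (pt b)) (fun=> 0%N).
  by rewrite /W walkD walk_cst walkZ mulN1r.
apply: le_trans (walk_norm _ _ _ (U01 x)) _.
(* The quadratic modulus at the random point, one coordinate at a time; its mean
   under the walk is the variance, of order 1 / n. *)
pose Q j (b : 'I_k -> nat) : R := K / n%:R ^+ 2 * ((b j)%:R - n%:R * U x j) ^+ 2.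
apply: (@le_trans _ _ (W (fun b => e / 2 + \sum_j Q j b) (fun=> 0%N))).
  apply: walk_le => // b; rewrite mulN1r -Fux.
  apply: le_trans (FK _ _ _) _.
    by move=> i; rewrite mxE in_itv /= U01.
  rewrite lerD // /sqnorm mulr_sumr ler_sum // => j _.
  rewrite /Q !mxE -mulrA ler_wpM2l // -exprVn -exprMn sqrrB.
  by rewrite le_eqVlt; apply/orP; left; apply/eqP; field; rewrite gt_eqF.
rewrite [W _ _]walkD walk_cst walk_sum [leRHS]splitr lerD //.
apply: le_trans _ nK.
rewrite mulrAC -[X in X * k%:R]/(K / n%:R) mulr_natr -[X in _ *+ X]card_ord -sumr_const.
apply: ler_sum => j _.
rewrite walkZ walk_variance count_laps.
have /andP[u0 u1] := U01 x j.
have -> : (0%:R - n%:R * U x j + n%:R * U x j) ^+ 2 + n%:R * (U x j * (1 - U x j))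
  = n%:R * (U x j * (1 - U x j)) by ring.
rewrite -mulrA ler_wpM2l // expr2 invfM -mulrA ler_piMr ?invr_ge0 ?ltW //.
rewrite mulrA mulVf ?gt_eqF // mul1r.
nra.
Qed.
End Approx.

(** * Measurability of random matrices; means of random variables *)
Section MatrixBorel.
Variable R : realType.

Lemma continuous_mxBorel_measurable m n (f : 'M[R]_(m, n) -> R) :
  continuous f -> measurable_fun setT (f : mxBorel R m n -> R).
Proof.
move=> cf; apply: (measurability _ (measurable_realfun.RGenOpens.measurableE R)) => _ [_ [a [b ->] <-]].
rewrite setTI; apply: sub_sigma_algebra.
by apply: open_comp => //; exact: interval_open.
Qed.

(** An open set of matrices is the union of the rational boxes inside it, and
    these are countably many; the sigma-algebra generated by open sets is thus
    reached from the entries. *)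
Lemma measurable_mxBorel d (T : measurableType d) m n (Y : T -> 'M[R]_(m, n)) :
  (forall i j, measurable_fun setT (fun w => Y w i j)) ->
  measurable_fun setT (Y : T -> mxBorel R m n).
Proof.
move=> mY; apply: (@measurability _ _ T (mxBorel R m n) setT Y (@open 'M[R]_(m, n))) => // _ [U oU <-].
rewrite setTI.
pose box (p : 'M[rat]_(m, n) * nat) : set 'M[R]_(m, n) :=
  [set A | forall i j, `|A i j - ratr (p.1 i j)| < p.2.+1%:R^-1].
have mbox p : measurable (Y @^-1` box p).
  have -> : Y @^-1` box p = \bigcap_(i in [set: 'I_m]) \bigcap_(j in [set: 'I_n])
     ((fun w => `|Y w i j - ratr (p.1 i j)|) @^-1` `]-oo, p.2.+1%:R^-1[).
    apply/seteqP; split => [w h i _ j _|w h i j] /=; rewrite ?in_itv /=.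
      exact: h.
    by have := h i I j I; rewrite /= in_itv.
  apply: fin_bigcap_measurable => // i _; apply: fin_bigcap_measurable => // j _.
  have mN : measurable_fun setT (fun w => `|Y w i j - ratr (p.1 i j)|).
    by apply: measurableT_comp => //; apply: measurable_funB.
  by rewrite -[X in measurable X]setTI; exact: mN.
pose good : set ('M[rat]_(m, n) * nat) := [set p | box p `<=` U].
have -> : Y @^-1` U = \bigcup_p (Y @^-1` (if `[< good p >] then box p else set0)).
  apply/seteqP; split => [w Uw|w [p _] /=]; last by case: asboolP => // gp /gp.
  have := open_nbhs_nbhs (conj oU Uw) => /nbhs_ballP[e /= e0 eU].
  pose N := Num.Def.trunc (e^-1 * 2).
  have N0 : (0 : R) < N.+1%:R by rewrite ltr0n.
  have Ne : N.+1%:R^-1 * 2 <= e.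
    rewrite mulrC ler_pdivrMr // -ler_pdivrMl // ltW //; exact: truncnS_gt.
  have /choice[q qP] : forall ij : 'I_m * 'I_n, exists r : rat,
      `|Y w ij.1 ij.2 - ratr r| < N.+1%:R^-1.
    move=> ij; pose x := Y w ij.1 ij.2.
    have [|r] := @rat_in_itvoo R (x - N.+1%:R^-1) (x + N.+1%:R^-1).
      by rewrite ltrD2l (@lt_trans _ _ 0) ?oppr_lt0 ?invr_gt0.
    rewrite in_itv /= => /andP[h1 h2]; exists r; rewrite distrC ltr_norml.
    by rewrite ltrBlDl h2 ltrBrDl h1.
  exists (\matrix_(i, j) q (i, j), N) => //=.
  case: asboolP => [_ i j|[]]; first by rewrite /= mxE; exact: (qP (i, j)).
  move=> A hA; apply: eU; split=> // i j.
  have := hA i j; have := qP (i, j); rewrite /= mxE /ball /= => h1 h2.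
  apply: lt_le_trans Ne; rewrite mulr_natr mulr2n.
  have -> : Y w i j - A i j = (Y w i j - ratr (q (i, j))) - (A i j - ratr (q (i, j))).
    by ring.
  by apply: le_lt_trans (ler_normB _ _) _; exact: ltrD.
apply: countable_bigcupT_measurable => [|p]; first exact: countableP.
by case: asboolP => _; [exact: mbox | rewrite preimage_set0].
Qed.

End MatrixBorel.

Section Mean.
Context d (T : measurableType d) (R : realType) (P : probability T R).
Implicit Types (F G : T -> R).

Definition intg F : Prop := P.-integrable setT (EFin \o F).
(** Integrable random variables have real means; working with real numbers makes
    the usual algebra available, and [expectation_mean] brings the extended real
    expectation back. *)
Definition mean F : R := fine ('E_P[F])%E.

Lemma meanE F : mean F = \int[P]_w F w.
Proof. by rewrite /mean unlock. Qed.

Lemma expectation_mean F : intg F -> ('E_P[F])%E = (mean F)%:E.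
Proof.
move=> iF; rewrite /mean unlock fineK //; exact: integrable_fin_num.
Qed.

Lemma intg_measurable F : intg F -> measurable_fun setT F.
Proof. by move=> /measurable_int/measurable_EFinP. Qed.

Lemma intg_cst c : intg (fun=> c).
Proof. exact: finite_measure_integrable_cst. Qed.

Lemma mean_cst c : mean (fun=> c) = c.
Proof. by rewrite /mean (expectation_cst P c). Qed.

Lemma intgD F G : intg F -> intg G -> intg (fun w => F w + G w).
Proof. by move=> iF iG; exact: (integrableD _ iF iG). Qed.

Lemma intgZ c F : intg F -> intg (fun w => c * F w).
Proof. by move=> iF; exact: (integrableZl _ c iF). Qed.

Lemma meanD F G : intg F -> intg G -> mean (fun w => F w + G w) = mean F + mean G.
Proof. by move=> iF iG; rewrite !meanE RintegralD. Qed.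

Lemma meanZ c F : intg F -> mean (fun w => c * F w) = c * mean F.
Proof. by move=> iF; rewrite !meanE RintegralZl. Qed.

Lemma intg_sum (I : Type) (r : seq I) (F : I -> T -> R) :
  (forall i, intg (F i)) -> intg (fun w => \sum_(i <- r) F i w).
Proof.
move=> iF; elim: r => [|i r IH].
  by under eq_fun do rewrite big_nil; exact: intg_cst.
by under eq_fun do rewrite big_cons; exact: intgD.
Qed.

Lemma mean_sum (I : Type) (r : seq I) (F : I -> T -> R) :
  (forall i, intg (F i)) ->
  mean (fun w => \sum_(i <- r) F i w) = \sum_(i <- r) mean (F i).
Proof.
move=> iF; elim: r => [|i r IH].
  by under eq_fun do rewrite big_nil; rewrite mean_cst big_nil.
under eq_fun do rewrite big_cons.
by rewrite meanD ?big_cons ?IH //; exact: intg_sum.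
Qed.

Lemma mean_le F G : intg F -> intg G -> (forall w, F w <= G w) -> mean F <= mean G.
Proof. by move=> iF iG FG; rewrite !meanE le_Rintegral. Qed.

Lemma intg_bounded F C : measurable_fun setT F -> (forall w, `|F w| <= C) -> intg F.
Proof.
move=> mF FC; apply: (le_integrable measurableT _ _ (intg_cst C)).
  exact/measurable_EFinP.
move=> w _ /=; rewrite lee_fin; apply: le_trans (FC w) _; exact: ler_norm.
Qed.

Lemma intgB F G : intg F -> intg G -> intg (fun w => F w - G w).
Proof.
move=> iF iG; under eq_fun do rewrite -mulN1r.
by apply: intgD => //; exact: intgZ.
Qed.

Lemma meanB F G : intg F -> intg G -> mean (fun w => F w - G w) = mean F - mean G.
Proof.
move=> iF iG; under eq_fun do rewrite -mulN1r.
by rewrite meanD ?meanZ ?mulN1r //; exact: intgZ.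
Qed.

Lemma mean_dist_le F G H : intg F -> intg G -> intg H ->
  (forall w, `|F w - G w| <= H w) -> `|mean F - mean G| <= mean H.
Proof.
move=> iF iG iH FGH; rewrite -meanB // ler_norml; apply/andP; split.
  rewrite -mulN1r -meanZ //; apply: mean_le; [exact: intgZ | exact: intgB |].
  by move=> w; have := FGH w; rewrite mulN1r ler_norml => /andP[].
apply: mean_le => //; first exact: intgB.
by move=> w; have := FGH w; rewrite ler_norml => /andP[].
Qed.

End Mean.

(** * Convergence in law from convergence of moments *)
Section GaussianMoments.
Variable R : realType.

Fixpoint gauss_moment_nat (n : nat) : nat :=
  match n with
  | 0 => 1
  | 1 => 0
  | m.+2 => m.+1 * gauss_moment_nat m
  end.

(** E(g^n) for g standard normal: (n - 1)!! for even n and 0 for odd n. *)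
Definition gauss_moment n : R := (gauss_moment_nat n)%:R.

Lemma gauss_moment0 : gauss_moment 0 = 1. Proof. by []. Qed.
Lemma gauss_moment1 : gauss_moment 1 = 0. Proof. by []. Qed.
Lemma gauss_momentSS n : gauss_moment n.+2 = n.+1%:R * gauss_moment n.
Proof. by rewrite /gauss_moment -natrM. Qed.

Lemma gauss_moment_even n : (gauss_moment_nat n.*2 * (2 ^ n * n`!) = (n.*2)`!)%N.
Proof.
elim: n => // n IH; rewrite doubleS [LHS]/= [in RHS]factS [in RHS]factS -IH.
by rewrite expnS factS -!muln2; ring.
Qed.

(** By [gauss_moment_even] the terms are those of the exponential series at
    sg^2 / 2.  This is the growth condition that makes Gaussian moments
    determine the law. *)
Lemma cvg_even_moments (sg : R) :
  (fun n => sg ^+ n.*2 * gauss_moment n.*2 / (n.*2)`!%:R) @ \oo --> (0 : R).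
Proof.
have E : (fun n => sg ^+ n.*2 * gauss_moment n.*2 / (n.*2)`!%:R) = exp_coeff (sg ^+ 2 / 2).
  apply/funext => n; rewrite /exp_coeff /=.
  have g0 : gauss_moment n.*2 != 0.
    have := fact_gt0 (n.*2); rewrite -gauss_moment_even muln_gt0 => /andP[h _].
    by rewrite pnatr_eq0 -lt0n.
  have f0 : n`!%:R != 0 :> R by rewrite pnatr_eq0 -lt0n fact_gt0.
  have p0 : 2 ^+ n != 0 :> R by rewrite expf_neq0 // pnatr_eq0.
  rewrite -(gauss_moment_even n) !natrM natrX -/(gauss_moment _) expr_div_n -exprM mul2n.
  by field; rewrite g0 f0 p0.
rewrite E; exact: cvg_series_cvg_0 (@is_cvg_series_exp_coeff R _).
Qed.

End GaussianMoments.

Lemma cvg_bigsum (R : realType) (I : Type) (r : seq I) (Q : pred I)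
  (u : I -> nat -> R) (l : I -> R) : (forall i, Q i -> u i @ \oo --> l i) ->
  (fun N => \sum_(i <- r | Q i) u i N) @ \oo --> \sum_(i <- r | Q i) l i.
Proof.
move=> ul; elim: r => [|i r IH].
  by under eq_fun do rewrite big_nil; rewrite big_nil; exact: cvg_cst.
under eq_fun do rewrite big_cons; rewrite big_cons; case: ifPn => // Qi.
by apply: cvgD => //; exact: ul.
Qed.

Section CvgMoments.
Variables (R : realType) (d : nat -> measure_display).
Variables (T : forall N, measurableType (d N)) (P : forall N, probability (T N) R).
Variables (d' : measure_display) (T' : measurableType d') (P' : probability T' R).

Section OneDim.
Variables (Z : forall N, T N -> R) (V : T' -> R) (sg : R).
Arguments Z : clear implicits.
Hypothesis mZ : forall N, measurable_fun setT (Z N).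
Hypothesis mV : measurable_fun setT V.
Hypothesis iZ : forall N n, intg (P N) (fun w => Z N w ^+ n).
Hypothesis iV : forall n, intg P' (fun w => V w ^+ n).
Hypothesis cZ : forall n,
  (fun N => mean (P N) (fun w => Z N w ^+ n)) @ \oo --> sg ^+ n * gauss_moment R n.
Hypothesis eV : forall n, mean P' (fun w => V w ^+ n) = sg ^+ n * gauss_moment R n.

Lemma intg_wave e (U : measurableType e) (Q : probability U R) (F : U -> R) a b :
  measurable_fun setT F -> intg Q (fun w => a * cos (F w) + b * sin (F w)).
Proof.
move=> mF; apply: (@intg_bounded _ _ _ _ _ (`|a| + `|b|)) => [|w].
  apply: measurable_funD; apply: measurable_funM => //.
    exact: measurableT_comp (continuous_measurable_fun (@continuous_cos R)) mF.
  exact: measurableT_comp (continuous_measurable_fun (@continuous_sin R)) mF.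
apply: le_trans (ler_normD _ _) _; rewrite !normrM lerD // ler_piMr //.
  by rewrite ler_norml cos_le1 cos_geN1.
by rewrite ler_norml sin_le1 sin_geN1.
Qed.

Lemma intg_horner e (U : measurableType e) (Q : probability U R) (F : U -> R)
  (p : {poly R}) : (forall n, intg Q (fun w => F w ^+ n)) ->
  intg Q (fun w => p.[F w]) /\
  mean Q (fun w => p.[F w]) = \sum_(i < size p) p`_i * mean Q (fun w => F w ^+ i).
Proof.
move=> iF; under eq_fun do rewrite horner_coef.
have h (i : 'I_(size p)) : intg Q (fun w => p`_i * F w ^+ i) by exact: intgZ.
split; first exact: intg_sum.
by rewrite mean_sum //; apply: eq_bigr => i _; rewrite meanZ.
Qed.

Lemma wave_remainder e (U : measurableType e) (Q : probability U R) (F : U -> R)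
  a b (p : {poly R}) (K : R) n : measurable_fun setT F ->
  (forall n, intg Q (fun w => F w ^+ n)) ->
  (forall z, `|a * cos z + b * sin z - p.[z]| <= K * `|z| ^+ n.*2 / (n.*2)`!%:R) ->
  `|mean Q (fun w => a * cos (F w) + b * sin (F w)) - mean Q (fun w => p.[F w])|
    <= K / (n.*2)`!%:R * mean Q (fun w => F w ^+ n.*2).
Proof.
move=> mF iF h; rewrite -meanZ //; apply: mean_dist_le.
- exact: intg_wave.
- by have [] := intg_horner p iF.
- exact: intgZ.
move=> w; apply: le_trans (h _) _.
by rewrite mulrAC -normrX ger0_norm // -muln2 exprM sqr_ge0.
Qed.

(** The mean of the wave is compared with that of a Taylor polynomial with
    remainder of order 2n, for n so large that this remainder is small for the
    limiting moments.  With n fixed, only finitely many moments have to be close. *)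
Lemma cvg_wave a b :
  (fun N => mean (P N) (fun w => a * cos (Z N w) + b * sin (Z N w))) @ \oo -->
  mean P' (fun w => a * cos (V w) + b * sin (V w)).
Proof.
apply/cvgrPdist_le => e e0.
pose K := `|a| + `|b|.
have e4 : 0 < e / 4 by rewrite divr_gt0.
have cK : (fun n => K * (sg ^+ n.*2 * gauss_moment R n.*2 / (n.*2)`!%:R)) @ \oo --> (0 : R).
  rewrite -[X in _ --> X](mulr0 K); apply: cvgM; first exact: cvg_cst.
  exact: cvg_even_moments.
have /cvgrPdist_le/(_ _ e4)[n _ /(_ n (leqnn n))] := cK.
rewrite sub0r normrN => /(le_trans (ler_norm _)) nK.
have [p pP] := taylor_cos_sin n.*2 a b.
have cp : (fun N => mean (P N) (fun w => p.[Z N w])) @ \oo --> mean P' (fun w => p.[V w]).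
  have [_ ->] := intg_horner p iV.
  under eq_fun => N do have [_ ->] := intg_horner p (iZ N).
  under eq_bigr do rewrite eV.
  apply: cvg_bigsum => i _; apply: cvgM; [exact: cvg_cst|exact: cZ].
have cr : (fun N => K / (n.*2)`!%:R * mean (P N) (fun w => Z N w ^+ n.*2)) @ \oo -->
   K / (n.*2)`!%:R * (sg ^+ n.*2 * gauss_moment R n.*2).
  by apply: cvgM; [exact: cvg_cst|exact: cZ].
near=> N.
have h1 := wave_remainder (@mZ N) (iZ N) pP.
have h2 := wave_remainder mV iV pP.
have h3 : `|mean P' (fun w => p.[V w]) - mean (P N) (fun w => p.[Z N w])| <= e / 4.
  by near: N; move/cvgrPdist_le : cp; apply.
have h4 : `|K / (n.*2)`!%:R * (sg ^+ n.*2 * gauss_moment R n.*2) -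
    K / (n.*2)`!%:R * mean (P N) (fun w => Z N w ^+ n.*2)| <= e / 4.
  by near: N; move/cvgrPdist_le : cr; apply.
move: h1 h2 h3 h4; rewrite eV -/K.
have -> : K / (n.*2)`!%:R * (sg ^+ n.*2 * gauss_moment R n.*2) =
   K * (sg ^+ n.*2 * gauss_moment R n.*2 / (n.*2)`!%:R) by ring.
move: nK; set X := K * _; set Y := K / _ * _ => nK.
rewrite !ler_norml => /andP[? ?] /andP[? ?] /andP[? ?] /andP[? ?].
apply/andP; split; lra.
Unshelve. all: by end_near.
Qed.
End OneDim.

Variables (k : nat) (Y : forall N, T N -> 'rV[R]_k) (V : T' -> 'rV[R]_k).
Variable sg : 'cV[R]_k -> R.
Arguments Y : clear implicits.
Hypothesis mY : forall N j, measurable_fun setT (fun w => Y N w 0 j).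
Hypothesis mV : forall j, measurable_fun setT (fun w => V w 0 j).
Hypothesis iY : forall N (a : 'cV[R]_k) n, intg (P N) (fun w => (Y N w *m a) 0 0 ^+ n).
Hypothesis iV : forall (a : 'cV[R]_k) n, intg P' (fun w => (V w *m a) 0 0 ^+ n).
Hypothesis cY : forall (a : 'cV[R]_k) n,
  (fun N => mean (P N) (fun w => (Y N w *m a) 0 0 ^+ n)) @ \oo --> sg a ^+ n * gauss_moment R n.
Hypothesis eV : forall (a : 'cV[R]_k) n, mean P' (fun w => (V w *m a) 0 0 ^+ n) = sg a ^+ n * gauss_moment R n.

Lemma measurable_linear e (U : measurableType e) (F : U -> 'rV[R]_k) (a : 'cV[R]_k) :
  (forall j, measurable_fun setT (fun w => F w 0 j)) ->
  measurable_fun setT (fun w => (F w *m a) 0 0).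
Proof.
move=> mF; under eq_fun do rewrite mxE.
apply: measurable_sum => j; exact: measurable_funM.
Qed.

Lemma cvg_trigpoly (g : 'rV[R]_k -> R) : trigpoly g ->
  [/\ forall N, intg (P N) (fun w => g (Y N w)), intg P' (fun w => g (V w)) &
  (fun N => mean (P N) (fun w => g (Y N w))) @ \oo --> mean P' (fun w => g (V w))].
Proof.
elim=> {g} [a b v|f g _ [f1 f2 f3] _ [g1 g2 g3]].
  split=> [N||].
  - by apply: intg_wave; exact: measurable_linear.
  - by apply: intg_wave; exact: measurable_linear.
  - apply: (@cvg_wave (fun N w => (Y N w *m v) 0 0) (fun w => (V w *m v) 0 0) (sg v)) => //.
    + by move=> N; exact: measurable_linear.
    + exact: measurable_linear.
split=> [N||]; [exact: intgD | exact: intgD |].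
rewrite meanD //; under eq_fun => N do rewrite meanD //.
exact: cvgD.
Qed.

Lemma sqnormE (x : 'rV[R]_k) : sqnorm x = \sum_j (x *m (delta_mx j 0 : 'cV[R]_k)) 0 0 ^+ 2.
Proof.
apply: eq_bigr => j _; congr (_ ^+ 2).
rewrite mxE (bigD1 j) //= mxE !eqxx mulr1 big1 ?addr0 //.
by move=> i ij; rewrite mxE (negbTE ij) mulr0.
Qed.

(** The error e + e |x|^2 of the approximation by a trigonometric polynomial has
    small mean uniformly in N, as second moments converge. *)
Theorem cvg_of_gaussian_moments (f : 'rV[R]_k -> R) (C : R) :
  continuous f -> (forall x, `|f x| <= C) ->
  [/\ forall N, intg (P N) (fun w => f (Y N w)), intg P' (fun w => f (V w)) &
  (fun N => mean (P N) (fun w => f (Y N w))) @ \oo --> mean P' (fun w => f (V w))].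
Proof.
move=> cf fC.
have mf e (U : measurableType e) (F : U -> 'rV[R]_k) :
    (forall j, measurable_fun setT (fun w => F w 0 j)) ->
    measurable_fun setT (fun w => f (F w)).
  move=> mF; apply: (measurableT_comp (continuous_mxBorel_measurable cf)).
  by apply: measurable_mxBorel => i j; rewrite ord1.
have ifY N : intg (P N) (fun w => f (Y N w)) by apply: intg_bounded (mf _ _ _ (@mY N)) _ => w.
have ifV : intg P' (fun w => f (V w)) by apply: intg_bounded (mf _ _ _ (@mV)) _ => w.
split=> //.
have isY N : intg (P N) (fun w => sqnorm (Y N w)).
  by under eq_fun do rewrite sqnormE; apply: intg_sum.
have isV : intg P' (fun w => sqnorm (V w)).
  by under eq_fun do rewrite sqnormE; apply: intg_sum.
pose S : R := mean P' (fun w => sqnorm (V w)).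
have S0 : 0 <= S.
  rewrite -[leLHS](mean_cst P'); apply: mean_le => //; first exact: intg_cst.
  by move=> w; exact: sqnorm_ge0.
have cS : (fun N => mean (P N) (fun w => sqnorm (Y N w))) @ \oo --> S.
  have -> : S = \sum_j sg (delta_mx j 0) ^+ 2 * gauss_moment R 2.
    rewrite /S; under eq_fun do rewrite sqnormE.
    by rewrite mean_sum //; apply: eq_bigr => j _; rewrite eV.
  under eq_fun => N do (under eq_fun do rewrite sqnormE; rewrite mean_sum //).
  by apply: cvg_bigsum => j _; exact: cY.
apply/cvgrPdist_le => e e0.
(* Two approximation errors of at most e1 (1 + (S + 1)) and one convergence error
   e1 add up to at most e. *)
pose e1 := e / (4 * (1 + S) + 2).
have D0 : 0 < 4 * (1 + S) + 2 by lra.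
have e10 : 0 < e1 by rewrite divr_gt0.
have [g tg fg] := trigpoly_approx cf fC e10.
have [igY igV cg] := cvg_trigpoly tg.
have bd e2 (U : measurableType e2) (Q : probability U R) (F : U -> 'rV[R]_k) :
   intg Q (fun w => f (F w)) -> intg Q (fun w => g (F w)) ->
   intg Q (fun w => sqnorm (F w)) ->
   `|mean Q (fun w => f (F w)) - mean Q (fun w => g (F w))| <=
   e1 + e1 * mean Q (fun w => sqnorm (F w)).
  move=> i1 i2 i3; rewrite -[X in _ <= X + _](mean_cst Q) -meanZ // -meanD //; last 2 first.
    exact: intg_cst.
    exact: intgZ.
  by apply: mean_dist_le => //; apply: intgD; [exact: intg_cst|exact: intgZ].
near=> N.
have h1 := bd _ _ _ _ (ifY N) (igY N) (isY N).
have h2 := bd _ _ _ _ ifV igV isV.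
have h3 : `|mean P' (fun w => g (V w)) - mean (P N) (fun w => g (Y N w))| <= e1.
  by near: N; move/cvgrPdist_le : cg; apply.
have h4 : `|S - mean (P N) (fun w => sqnorm (Y N w))| <= 1.
  by near: N; move/cvgrPdist_le : cS; apply.
have eE : e = e1 * (4 * (1 + S) + 2) by rewrite /e1 divfK // gt_eqF.
move: h1 h2 h3 h4; rewrite -/S !ler_norml.
move=> /andP[? ?] /andP[? ?] /andP[? ?] /andP[? ?].
have h5 : e1 * mean (P N) (fun w => sqnorm (Y N w)) <= e1 * (S + 1).
  by rewrite ler_wpM2l ?(ltW e10) //; lra.
have h6 : 0 <= e1 * S by rewrite mulr_ge0 // ltW.
apply/andP; split; lra.
Unshelve. all: by end_near.
Qed.

End CvgMoments.

(** * Integration against the normal density *)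
Section WeightedIntegral.
Import HBNNSimple.
Local Open Scope ereal_scope.

Lemma nnsfun_sum_indic (R : realType) de (E : measurableType de)
  (k : {nnsfun E >-> R}) : exists r : seq R,
  forall x, k x = (\sum_(y <- r) `|y| * \1_(k @^-1` [set y]) x)%R.
Proof.
exists (finmap.enum_fset (fset_set (range k))) => x.
rewrite fimfunE fsbig_finite //=; apply: eq_big_seq => y.
rewrite in_fset_set // inE => -[z _ <-].
by rewrite ger0_norm.
Qed.

Lemma weighted_integral_nnsfun (R : realType) de (E : measurableType de)
    (k : {nnsfun E >-> R}) (r : seq R) dT (T : measurableType dT)
    (m : {measure set T -> \bar R}) (X : T -> E) (g : T -> R) :
  (forall x, k x = (\sum_(y <- r) `|y| * \1_(k @^-1` [set y]) x)%R) ->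
  measurable_fun setT X -> measurable_fun setT g -> (forall w, (0 <= g w)%R) ->
  \int[m]_w (g w * k (X w))%:E =
  \sum_(y <- r) (`|y|%:E * \int[m]_w (g w * \1_(k @^-1` [set y]) (X w))%:E).
Proof.
move=> kE mX mg g0.
have mi y : measurable_fun setT (fun w => (g w * \1_(k @^-1` [set y]) (X w))%R).
  by apply: measurable_funM => //; apply: measurableT_comp.
under eq_integral => w _.
  rewrite kE mulr_sumr -sumEFin.
  under eq_bigr => y _ do rewrite mulrCA EFinM.
  over.
rewrite ge0_integral_sum //; last 2 first.
- move=> y; apply: measurable_funeM; exact/measurable_EFinP.
- by move=> y w _; rewrite mule_ge0 // lee_fin // mulr_ge0.
apply: eq_bigr => y _; rewrite ge0_integralZl //.
- exact/measurable_EFinP.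
- by move=> w _; rewrite lee_fin mulr_ge0.
Qed.

Lemma weighted_integral_lim (R : realType) de (E : measurableType de)
    dT (T : measurableType dT) (m : {measure set T -> \bar R})
    (X : T -> E) (g : T -> R) (f : E -> R) (mf : measurable_fun setT (EFin \o f)) :
  measurable_fun setT X -> measurable_fun setT g -> (forall w, (0 <= g w)%R) ->
  (forall x, (0 <= f x)%R) ->
  \int[m]_w (g w * f (X w))%:E =
  limn (fun n => \int[m]_w (g w * nnsfun_approx measurableT mf n (X w))%:E).
Proof.
move=> mX mg g0 f0; set h := nnsfun_approx measurableT mf.
rewrite -monotone_convergence //=.
- apply: eq_integral => w _; apply/esym/cvg_lim => //.
  rewrite EFinM; under eq_fun do rewrite EFinM.
  apply: cvgeZl => //.
  by apply: cvg_nnsfun_approx => // x _; rewrite lee_fin.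
- move=> n; apply/measurable_EFinP; apply: measurable_funM => //.
  exact: measurableT_comp.
- by move=> n w _; rewrite lee_fin mulr_ge0.
- move=> w _ a b ab; rewrite lee_fin ler_wpM2l //.
  exact/lefP/nd_nnsfun_approx.
Qed.

(** The change of measure formulas and the product rule for independent variables
    used below all say that two weighted integrals of f agree; by approximation
    with simple functions it is enough to test indicators.  The pairs (X1, g1)
    and (X2, g2) are left general so that one lemma covers them all. *)
Lemma weighted_integral_ext (R : realType) de (E : measurableType de)
  d1 (T1 : measurableType d1) (m1 : {measure set T1 -> \bar R})
  d2 (T2 : measurableType d2) (m2 : {measure set T2 -> \bar R})
  (X1 : T1 -> E) (X2 : T2 -> E) (g1 : T1 -> R) (g2 : T2 -> R) :
  measurable_fun setT X1 -> measurable_fun setT X2 ->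
  measurable_fun setT g1 -> measurable_fun setT g2 ->
  (forall w, (0 <= g1 w)%R) -> (forall w, (0 <= g2 w)%R) ->
  (forall B, measurable B ->
    \int[m1]_w (g1 w * \1_B (X1 w))%:E = \int[m2]_w (g2 w * \1_B (X2 w))%:E) ->
  forall f : E -> R, measurable_fun setT f -> (forall x, (0 <= f x)%R) ->
    \int[m1]_w (g1 w * f (X1 w))%:E = \int[m2]_w (g2 w * f (X2 w))%:E.
Proof.
move=> mX1 mX2 mg1 mg2 g10 g20 H f mf f0.
have mfE : measurable_fun setT (EFin \o f) by exact/measurable_EFinP.
rewrite !(weighted_integral_lim _ mfE) //; congr (limn _).
apply/funext => n.
have [r rE] := nnsfun_sum_indic (nnsfun_approx measurableT mfE n).
rewrite !(weighted_integral_nnsfun _ rE) //.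
by apply: eq_bigr => y _; rewrite H.
Qed.

End WeightedIntegral.

Section NormalIntegral.
Variable R : realType.
Notation leb := (@lebesgue_measure R).

Lemma ge0_integral_normal (m s : R) (f : R -> R) :
  measurable_fun setT f -> (forall x, 0 <= f x) ->
  (\int[normal_prob m s]_x (f x)%:E = \int[leb]_x (f x * normal_pdf m s x)%:E)%E.
Proof.
move=> mf f0.
have := @weighted_integral_ext R _ R _ _ (normal_prob m s) _ _ leb id id (fun=> 1)
  (normal_pdf m s).
move=> /(_ _ _ _ _ _ _ _ f mf f0) h.
under eq_integral do rewrite -[f _]mul1r.
under [RHS]eq_integral do rewrite mulrC.
apply: h => //.
- exact: measurable_normal_pdf.
- exact: normal_pdf_ge0.
move=> B mB; under eq_integral do rewrite mul1r.
rewrite integral_indic // setIT /normal_prob [LHS]integral_mkcond.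
apply: eq_integral => x _ /=; rewrite patchE indicE.
by case: ifP => _; rewrite ?mulr1 ?mulr0.
Qed.

Lemma integral_normal (m s : R) (f : R -> R) : measurable_fun setT f ->
  leb.-integrable setT (fun x => (f x * normal_pdf m s x)%:E) ->
  intg (normal_prob m s) f /\
  mean (normal_prob m s) f = \int[leb]_x (f x * normal_pdf m s x).
Proof.
move=> mf /[dup] ifp /integrableP[mfp fpy].
have mabs : measurable_fun setT (fun x => `|f x|) by exact: measurableT_comp.
have fpE x : `|f x| * normal_pdf m s x = `|f x * normal_pdf m s x|.
  by rewrite normrM (ger0_norm (normal_pdf_ge0 _ _ _)).
have ifN : intg (normal_prob m s) f.
  apply/integrableP; split; first exact/measurable_EFinP.
  rewrite (@ge0_integral_normal m s (fun x => `|f x|)) //.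
  by under eq_integral do rewrite fpE.
split=> //.
have iabs : intg (normal_prob m s) (fun x => `|f x|).
  by have := integrable_norm ifN.
have iap : leb.-integrable setT (fun x => (`|f x| * normal_pdf m s x)%:E).
  by have := integrable_norm ifp; congr (integrable _ _ _); apply/funext => x /=; rewrite fpE.
have m1 : measurable_fun setT (fun x => `|f x| + f x) by exact: measurable_funD.
have h1 : mean (normal_prob m s) (fun x => `|f x|) = \int[leb]_x (`|f x| * normal_pdf m s x).
  by rewrite meanE /Rintegral ge0_integral_normal.
have h2 : mean (normal_prob m s) (fun x => `|f x| + f x) =
    \int[leb]_x ((`|f x| + f x) * normal_pdf m s x).
  rewrite meanE /Rintegral ge0_integral_normal // => x.
  by rewrite -[X in _ + X]opprK subr_ge0 -normrN ler_norm.
have : mean (normal_prob m s) (fun x => `|f x| + f x) =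
       mean (normal_prob m s) (fun x => `|f x|) + mean (normal_prob m s) f.
  by rewrite meanD.
rewrite h1 h2; under eq_Rintegral do rewrite mulrDl.
by rewrite RintegralD // => /addrI.
Qed.

End NormalIntegral.

(** * Moments of the normal law *)
Section NormalMoments.
Variables (R : realType) (s : R).
Hypothesis s0 : s != 0.
Notation leb := (@lebesgue_measure R).
Notation p := (normal_pdf 0 s).

Lemma normal_pdf_expE x : p x = normal_peak s * expR (- x ^+ 2 / (s ^+ 2 *+ 2)).
Proof. by rewrite normal_pdfE // /normal_fun subr0. Qed.

(** With y = x^2 / D, the exponential exp (- 4 y) of the density of variance s^2 is
    exp (- y) times exp (- y) times a factor at most 1; the first absorbs the power
    y^m and the second is the density of variance (2 s)^2. *)
Lemma power_normal_fun_even m : exists2 C, 0 <= C & forall x,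
  x ^+ m.*2 * normal_fun 0 s x <= C * normal_fun 0 (2 * s) x.
Proof.
pose D := (2 * s) ^+ 2 *+ 2.
have D0 : 0 < D by rewrite pmulrn_lgt0 // exprn_even_gt0 //= mulf_neq0.
exists (D ^+ m * m`!%:R); first by rewrite mulr_ge0 // exprn_ge0 // ltW.
move=> x; rewrite /normal_fun !subr0.
pose y := x ^+ 2 / D.
have y0 : 0 <= y by rewrite divr_ge0 ?sqr_ge0 // ltW.
have -> : - x ^+ 2 / (s ^+ 2 *+ 2) = (- y) + (- y) + (- (y + y)).
  by rewrite /y /D; field; rewrite s0.
have -> : - x ^+ 2 / D = - y by rewrite mulNr.
have -> : x ^+ m.*2 = D ^+ m * y ^+ m.
  by rewrite /y expr_div_n mulrC divfK ?expf_neq0 ?gt_eqF // -muln2 mulnC exprM.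
rewrite -mulrA -[leRHS]mulrA; apply: ler_wpM2l; first by rewrite exprn_ge0 // ltW.
rewrite !expRD.
have h1 : expR (- (y + y)) <= 1 by rewrite expR_le1 oppr_le0 addr_ge0.
have h2 : y ^+ m * expR (- y) <= m`!%:R.
  rewrite expRN ler_pdivrMr ?expR_gt0 // mulrC -ler_pdivrMr; last first.
    by rewrite ltr0n fact_gt0.
  case: m => [|m].
    by rewrite expr0 fact0 divr1 -expR0 ler_expR.
  by apply: le_trans (expR_ge1Dxn m y0); rewrite lerDr.
have e0 := expR_ge0 (- y).
rewrite (_ : _ * (_ * _ * _) =
  (y ^+ m * expR (- y)) * expR (- y) * expR (- (y + y))); last by ring.
have A0 : 0 <= y ^+ m * expR (- y) * expR (- y) by rewrite !mulr_ge0 // exprn_ge0.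
rewrite -[leRHS]mulr1; apply: (ler_pM A0 (expR_ge0 _) _ h1).
by rewrite ler_wpM2r.
Qed.

Lemma power_normal_fun n : exists2 C, 0 <= C & forall x,
  `|x| ^+ n * normal_fun 0 s x <= C * normal_fun 0 (2 * s) x.
Proof.
have [C1 C10 h1] := power_normal_fun_even 0.
have [C2 C20 h2] := power_normal_fun_even n.
exists (C1 + C2) => [|x]; first exact: addr_ge0.
rewrite mulrDl; apply: le_trans (lerD (h1 x) (h2 x)).
rewrite -mulrDl ler_wpM2r ?normal_fun_ge0 // expr0.
have -> : x ^+ n.*2 = (`|x| ^+ n) ^+ 2.
  by rewrite -normrX real_normK ?num_real // -exprM muln2.
have := normr_ge0 x => /(exprn_ge0 n); set t := `|x| ^+ n => t0.
nra.
Qed.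

Lemma power_normal_pdf n : exists2 C, 0 <= C & forall x,
  `|x| ^+ n * p x <= C * normal_pdf 0 (2 * s) x.
Proof.
have s20 : 2 * s != 0 by rewrite mulf_neq0.
have [C C0 h] := power_normal_fun n.
have k0 := normal_peak_gt0 s20.
exists (normal_peak s * C / normal_peak (2 * s)) => [|x].
  by rewrite divr_ge0 ?mulr_ge0 ?normal_peak_ge0.
rewrite !normal_pdfE //=.
rewrite [leRHS](_ : _ = normal_peak s * (C * normal_fun 0 (2 * s) x)); last first.
  by field; rewrite gt_eqF.
by rewrite mulrCA ler_wpM2l ?normal_peak_ge0.
Qed.

Lemma power_normal_pdf_bounded n : exists2 C, 0 <= C & forall x, `|x| ^+ n * p x <= C.
Proof.
have [C C0 h] := power_normal_pdf n.
exists (C * normal_peak (2 * s)) => [|x]; first by rewrite mulr_ge0 ?normal_peak_ge0.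
by apply: le_trans (h x) _; rewrite ler_wpM2l // normal_pdf_ub // mulf_neq0.
Qed.

Lemma measurable_power_pdf n : measurable_fun setT (fun x : R => x ^+ n * p x).
Proof.
apply: measurable_funM; last exact: measurable_normal_pdf.
exact: exprn_measurable.
Qed.

Lemma integrable_power_pdf n :
  leb.-integrable setT (fun x => (x ^+ n * p x)%:E).
Proof.
have [C C0 h] := power_normal_pdf n.
have ig := integrableZl measurableT C (integrable_normal_pdf 0 (2 * s)).
apply: le_integrable ig => //.
- apply/measurable_EFinP; exact: measurable_power_pdf.
- move=> x _; rewrite /= lee_fin normrM normrX (ger0_norm (normal_pdf_ge0 _ _ _)).
  by apply: le_trans (h x) _; exact: ler_norm.
Qed.

Lemma is_derive_normal_pdf (x : R) : is_derive x 1 p (- x / s ^+ 2 * p x).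
Proof.
pose q : {poly R} := - (s ^+ 2 *+ 2)^-1 *: 'X ^+ 2.
have qE y : q.[y] = - y ^+ 2 / (s ^+ 2 *+ 2).
  by rewrite /q hornerZ hornerXn mulNr mulrC mulNr.
have pE : p = normal_peak s \*: (@expR R \o horner q).
  by apply/funext => y; rewrite normal_pdf_expE -qE.
have := is_deriveZ (normal_peak s)
  (is_derive1_comp (is_derive_expR (q.[x])) (is_derive_poly q x)).
rewrite -pE => h; apply: is_derive_eq h _.
rewrite -![_ *: _]/(_ * _) qE /q derivZ derivXn hornerZ hornerMn hornerXn /=.
by rewrite normal_pdf_expE expr1; field; exact: s0.
Qed.

Lemma is_derive_power_pdf n (x : R) :
  is_derive x 1 (fun y : R => y ^+ n * p y) (n%:R * (x ^+ n.-1 * p x) - s ^- 2 * (x ^+ n.+1 * p x)).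
Proof.
have -> : (fun y : R => y ^+ n * p y) = horner ('X ^+ n) * p.
  by apply/funext => y; rewrite -[RHS]/(('X ^+ n).[y] * p y) hornerXn.
have h := is_deriveM (is_derive_poly ('X ^+ n) x) (is_derive_normal_pdf x).
apply: is_derive_eq h _.
rewrite -![_ *: _]/(_ * _) hornerXn derivXn hornerMn hornerXn -[_ *+ n]mulr_natl [x ^+ n.+1]exprS.
by set u := x ^+ n; set v := x ^+ n.-1; field; exact: s0.
Qed.

Definition pdf_moment n : R := \int[leb]_x (x ^+ n * p x).

Lemma continuous_of_derive (f df : R -> R) :
  (forall x : R, is_derive x (1 : R) f (df x)) -> continuous f.
Proof.
move=> fd x; apply: differentiable_continuous.
by apply/derivable1_diffP; case: (fd x).
Qed.

Lemma continuous_power_pdf n : continuous (fun y : R => y ^+ n * p y).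
Proof. exact: continuous_of_derive (is_derive_power_pdf n). Qed.

Lemma power_pdf_FTC n (a : R) : 0 < a ->
  (\int[leb]_(x in `[(- a)%R, a]) (n%:R * (x ^+ n.-1 * p x) - s ^- 2 * (x ^+ n.+1 * p x))%:E =
   (a ^+ n * p a)%:E - ((- a) ^+ n * p (- a))%:E)%E.
Proof.
move=> a0; have aa : - a < a by lra.
have cF := @continuous_power_pdf n.
rewrite (continuous_FTC2 (F := fun y : R => y ^+ n * p y)) //.
- apply: continuous_subspaceT => x.
  by apply: cvgB; apply: cvgM => //; do ?exact: cvg_cst; exact: continuous_power_pdf.
- split.
  + by move=> x _; case: (is_derive_power_pdf n x).
  + exact: cvg_at_right_filter (cF _).
  + exact: cvg_at_left_filter (cF _).
- by move=> x _; rewrite derive1E; apply: derive_val; exact: is_derive_power_pdf.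
Qed.

Lemma cvg_power_pdf n (e : R) : `|e| = 1 ->
  (fun N : nat => (e * N.+1%:R) ^+ n * p (e * N.+1%:R)) @ \oo --> (0 : R).
Proof.
move=> e1; have [C C0 h] := power_normal_pdf_bounded n.+1.
apply/norm_cvg0P.
apply: (@squeeze_cvgr _ _ _ _ (fun=> 0) (fun N : nat => C * N.+1%:R^-1)).
- apply: nearW => N; rewrite normr_ge0 /= -ler_pdivrMr ?invr_gt0 // invrK.
  rewrite normrM normrX (ger0_norm (normal_pdf_ge0 _ _ _)).
  apply: le_trans (h (e * N.+1%:R)).
  by rewrite exprSr normrM e1 mul1r [X in _ <= _ * X * _]ger0_norm // mulrAC.
- exact: cvg_cst.
- rewrite -[X in _ --> X](mulr0 C); apply: cvgM; first exact: cvg_cst.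
  exact: cvg_harmonic.
Qed.

(** The integral of the derivative of x^n p(x) over the line is the limit of its
    boundary values on [-N, N], which tend to 0. *)
Lemma pdf_moment_rec n : n%:R * pdf_moment n.-1 - s ^- 2 * pdf_moment n.+1 = 0.
Proof.
pose H x := n%:R * (x ^+ n.-1 * p x) - s ^- 2 * (x ^+ n.+1 * p x).
have iH : leb.-integrable setT (EFin \o H).
  exact: integrableB (integrableZl measurableT _ (integrable_power_pdf _))
    (integrableZl measurableT _ (integrable_power_pdf _)).
have <- : \int[leb]_x H x = n%:R * pdf_moment n.-1 - s ^- 2 * pdf_moment n.+1.
  rewrite RintegralB //; last 2 first.
    exact: (integrableZl measurableT _ (integrable_power_pdf _)).
    exact: (integrableZl measurableT _ (integrable_power_pdf _)).
  by rewrite !RintegralZl //; exact: integrable_power_pdf.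
pose I N := `[- N.+1%:R, N.+1%:R : R]%classic.
have mH : measurable_fun setT H by apply/measurable_EFinP; exact: measurable_int iH.
have cvgH : (fun N => \int[leb]_x ((EFin \o H) \_ (I N)) x)%E @ \oo -->
    (\int[leb]_x (H x)%:E)%E.
  have [] // := @dominated_convergence _ _ _ leb setT measurableT
    (fun N => (EFin \o H) \_ (I N)) (EFin \o H) (fun x => `|(EFin \o H) x|%E).
  - move=> N; apply/(measurable_restrict _ _ _) => //.
      exact: measurable_itv.
    by apply: measurable_funTS; exact/measurable_EFinP.
  - exact/measurable_EFinP.
  - apply: aeW => x _; apply: cvg_near_cst.
    exists (Num.Def.trunc `|x|) => // N /= xN; rewrite patchE ifT //.
    apply/mem_set; rewrite /I /= in_itv /= -ler_norml ltW //.
    by rewrite (lt_le_trans (truncnS_gt _)) // ler_nat ltnS.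
  - exact: integrable_abse.
  - apply: aeW => x N _; rewrite patchE; case: ifP => // _.
    by rewrite abse0 abse_ge0.
rewrite /Rintegral; have -> : (\int[leb]_x (H x)%:E = 0)%E; last by [].
pose D N := N.+1%:R ^+ n * p N.+1%:R - (- N.+1%:R) ^+ n * p (- N.+1%:R).
have D0 : (fun N => (D N)%:E) @ \oo --> 0%E.
  apply: cvg_EFin; first exact: nearW.
  rewrite -[X in _ --> X](subr0 0); apply: cvgB.
    by have := @cvg_power_pdf n _ (normr1 _); under eq_fun do rewrite mul1r.
  have e1 : `|(-1 : R)| = 1 by rewrite normrN normr1.
  by have := @cvg_power_pdf n _ e1; under eq_fun do rewrite mulN1r.
have E : (fun N => (D N)%:E) =
    (fun N => \int[leb]_x ((EFin \o H) \_ (I N)) x)%E.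
  apply/funext => N; rewrite /D EFinB -power_pdf_FTC ?ltr0n //.
  by rewrite [LHS]integral_mkcond.
rewrite E in D0; apply: cvg_unique cvgH D0; exact: ereal_hausdorff.
Qed.

(** The recursion has step two, so that n and n + 1 are treated together. *)
Lemma pdf_momentE n : pdf_moment n = s ^+ n * gauss_moment R n.
Proof.
have H : pdf_moment n = s ^+ n * gauss_moment R n /\ pdf_moment n.+1 = s ^+ n.+1 * gauss_moment R n.+1.
  elim: n => [|n [IH1 IH2]].
    split.
      rewrite /pdf_moment /Rintegral; under eq_integral do rewrite expr0 mul1r.
      by rewrite integral_normal_pdf mul1r.
    have := pdf_moment_rec 0; rewrite mul0r sub0r gauss_moment1 mulr0 => /eqP.
    by rewrite oppr_eq0 mulf_eq0 invr_eq0 expf_eq0 /= (negbTE s0) /= => /eqP.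
  split=> //; have := pdf_moment_rec n.+1; rewrite /= IH1 => /eqP; rewrite subr_eq0 => /eqP E.
  have -> : pdf_moment n.+2 = s ^+ 2 * (s ^- 2 * pdf_moment n.+2).
    by rewrite mulrA divff ?mul1r // expf_neq0.
  by rewrite -E gauss_momentSS -[n.+2]addn2 exprD; ring.
by case: H.
Qed.

Lemma normal_moments n : intg (normal_prob 0 s) (fun x => x ^+ n) /\
  mean (normal_prob 0 s) (fun x => x ^+ n) = s ^+ n * gauss_moment R n.
Proof.
have [h1 h2] := @integral_normal R 0 s (fun x => x ^+ n) (@exprn_measurable _ _ n)
  (integrable_power_pdf n).
by split=> //; rewrite h2 -pdf_momentE.
Qed.

End NormalMoments.

(** * Gaussian moments determine the law on the line *)
Section LawUniqueness.
Variable R : realType.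

Section SameContinuousMeans.
Context d1 (T1 : measurableType d1) (P1 : probability T1 R) (V1 : T1 -> R).
Context d2 (T2 : measurableType d2) (P2 : probability T2 R) (V2 : T2 -> R).
Hypotheses (mV1 : measurable_fun setT V1) (mV2 : measurable_fun setT V2).
Hypothesis same : forall (f : R -> R) C, continuous f -> (forall x, `|f x| <= C) ->
  mean P1 (f \o V1) = mean P2 (f \o V2).

(** Continuous functions increasing to the indicator of the half line below a. *)
Definition ramp (a : R) (n : nat) (x : R) : R :=
  Num.min 1 (Num.max 0 (n%:R * (a - x))).

Lemma continuous_ramp a n : continuous (ramp a n).
Proof.
move=> x; apply: (@continuous_min R R (fun=> 1)
  (fun z : R => Num.max 0 (n%:R * (a - z)))); first exact: cvg_cst.
apply: (@continuous_max R R (fun=> 0) (fun z : R => n%:R * (a - z))).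
  exact: cvg_cst.
apply: cvgM; first exact: cvg_cst.
by apply: cvgB; [exact: cvg_cst | exact: cvg_id].
Qed.

Lemma ramp_bounds a n x : 0 <= ramp a n x <= 1.
Proof. by rewrite /ramp le_min ler01 le_max lexx /= ge_min lexx. Qed.

Lemma cvg_ramp a x : (fun n => ramp a n x) @ \oo --> (\1_`]-oo, a[ x : R).
Proof.
apply: cvg_near_cst; rewrite indicE.
have [xa|xa] := ltP x a.
  have ax : 0 < a - x by rewrite subr_gt0.
  exists (Num.Def.trunc (a - x)^-1).+1 => // n /= h.
  rewrite mem_set /= ?in_itv //= /ramp min_l // le_max; apply/orP; right.
  rewrite -ler_pdivrMr // mul1r ltW // (lt_le_trans (truncnS_gt _)) //.
  by rewrite ler_nat.
exists 0%N => // n _; rewrite memNset /= ?in_itv /=; last by apply/negP; rewrite -leNgt.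
by rewrite /ramp max_l ?min_r // mulr_ge0_le0 // subr_le0.
Qed.

Lemma cvg_mean_ramp d (T : measurableType d) (P : probability T R) (V : T -> R) a :
  measurable_fun setT V ->
  (fun n => (mean P (ramp a n \o V))%:E) @ \oo --> P (V @^-1` `]-oo, a[%classic).
Proof.
move=> mV.
have mr n : measurable_fun setT (ramp a n \o V).
  exact: measurableT_comp (continuous_measurable_fun (@continuous_ramp a n)) mV.
have mB : measurable (V @^-1` `]-oo, a[%classic).
  by rewrite -[X in measurable X]setTI; apply: mV => //; exact: measurable_itv.
have [] := @dominated_convergence _ _ _ P setT measurableT
  (fun n => EFin \o (ramp a n \o V)) (EFin \o \1_(V @^-1` `]-oo, a[%classic)) (fun=> 1%E).
- by move=> n; apply/measurable_EFinP.
- by apply/measurable_EFinP.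
- apply: aeW => x _; apply: cvg_EFin; first exact: nearW.
  exact: cvg_ramp.
- exact: (intg_cst P 1).
- apply: aeW => x n _ /=; rewrite lee_fin.
  by have /andP[h1 h2] := ramp_bounds a n (V x); rewrite ger0_norm.
move=> _ _; rewrite integral_indic // setIT.
suff -> : (fun n => (mean P (ramp a n \o V))%:E) =
   (fun n => \int[P]_x (EFin \o (ramp a n \o V)) x)%E by [].
apply/funext => n; rewrite -expectation_mean ?unlock //.
apply: (@intg_bounded _ _ _ _ _ 1) => // x.
by have /andP[h1 h2] := ramp_bounds a n (V x); rewrite ger0_norm.
Qed.

(** Means of the ramps determine the masses of open half lines, which generate
    the Borel sets and are stable under intersection. *)
Lemma law_unique B : measurable B -> P1 (V1 @^-1` B) = P2 (V2 @^-1` B).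
Proof.
move=> mB.
pose W1 : {mfun T1 >-> R} := mfun_Sub (mem_set mV1).
pose W2 : {mfun T2 >-> R} := mfun_Sub (mem_set mV2).
have := @measure_unique _ R R (@measurable_realfun.RGenInftyO.G R)
  (fun n => `]-oo, n%:R[%classic) (measurable_realfun.RGenInftyO.measurableE R) _ _ _
  (pushforward P1 W1) (pushforward P2 W2) _ _ B mB.
apply.
- move=> _ _ [x ->] [y ->]; exists (Num.min x y).
  by apply/seteqP; split => z /=; rewrite !in_itv /= lt_min => /andP.
- by move=> i; exists i%:R.
- rewrite -subTset => x _; exists (Num.Def.trunc x).+1 => //=.
  by rewrite in_itv /= truncnS_gt.
- move=> _ [a ->]; rewrite /pushforward /=.
  have h1 := @cvg_mean_ramp _ _ P1 _ a mV1.
  have h2 := @cvg_mean_ramp _ _ P2 _ a mV2.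
  have E : (fun n => (mean P1 (ramp a n \o V1))%:E) = (fun n => (mean P2 (ramp a n \o V2))%:E).
    apply/funext => n; rewrite (@same _ 1) //; first exact: continuous_ramp.
    by move=> x; have /andP[? ?] := ramp_bounds a n x; rewrite ger0_norm.
  rewrite E in h1; apply: cvg_unique h1 h2; exact: ereal_hausdorff.
- move=> i; apply: le_lt_trans (probability_le1 _ _) _; last by rewrite ltry.
  by rewrite -[X in measurable X]setTI; apply: mV1 => //; exact: measurable_itv.
Qed.
End SameContinuousMeans.

(** The convergence theorem applied to a constant sequence: its means of bounded
    continuous functions are constant and converge to those of the other variable. *)
Lemma gaussian_moments_law d1 (T1 : measurableType d1) (P1 : probability T1 R)
    (V1 : T1 -> R) d2 (T2 : measurableType d2) (P2 : probability T2 R)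
    (V2 : T2 -> R) (sg : R) :
  measurable_fun setT V1 -> measurable_fun setT V2 ->
  (forall n, intg P1 (fun w => V1 w ^+ n) /\
    mean P1 (fun w => V1 w ^+ n) = sg ^+ n * gauss_moment R n) ->
  (forall n, intg P2 (fun w => V2 w ^+ n) /\
    mean P2 (fun w => V2 w ^+ n) = sg ^+ n * gauss_moment R n) ->
  forall B, measurable B -> P1 (V1 @^-1` B) = P2 (V2 @^-1` B).
Proof.
move=> mV1 mV2 H1 H2; apply: law_unique => // f C cf fC.
have E d (T : measurableType d) (V : T -> R) (a : 'cV[R]_1) n :
   (fun w => ((V w)%:M *m a) 0 0 ^+ n) = (fun w => a 0 0 ^+ n * V w ^+ n).
  by apply/funext => w; rewrite mul_scalar_mx mxE exprMn mulrC.
have Em d (T : measurableType d) (P : probability T R) (V : T -> R) :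
  (forall n, intg P (fun w => V w ^+ n) /\ mean P (fun w => V w ^+ n) = sg ^+ n * gauss_moment R n) ->
  forall (a : 'cV[R]_1) n, mean P (fun w => ((V w)%:M *m a) 0 0 ^+ n) = (sg * a 0 0) ^+ n * gauss_moment R n.
  move=> H a n; have [i e] := H n.
  by rewrite E meanZ // e exprMn; ring.
have m1 d (T : measurableType d) (V : T -> R) (j : 'I_1) : measurable_fun setT V ->
   measurable_fun setT (fun w => ((V w)%:M : 'rV[R]_1) 0 j).
  by move=> mV; under eq_fun do rewrite ord1 mxE eqxx mulr1n.
pose f' (x : 'rV[R]_1) : R := f (x 0 0).
have [_ _] : [/\ forall N : nat, intg P1 (fun w => f' (V1 w)%:M),
    intg P2 (fun w => f' (V2 w)%:M) &
    (fun N : nat => mean P1 (fun w => f' (V1 w)%:M)) @ \oo -->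
      mean P2 (fun w => f' (V2 w)%:M)].
  apply: (@cvg_of_gaussian_moments R (fun=> d1) (fun=> T1) (fun=> P1) _ T2 P2 1
    (fun _ w => (V1 w)%:M) (fun w => (V2 w)%:M) (fun a => sg * a 0 0)) => //.
  - by move=> _ j; exact: m1.
  - by move=> j; exact: m1.
  - by move=> _ a n; rewrite E; apply: intgZ; case: (H1 n).
  - by move=> a n; rewrite E; apply: intgZ; case: (H2 n).
  - by move=> a n; under eq_fun do rewrite (Em _ _ _ _ H1); exact: cvg_cst.
  - by move=> a n; rewrite (Em _ _ _ _ H2).
  - move=> x; apply: continuous_comp (cf _); exact: coord_continuous.
  - by move=> x; exact: fC.
have f'E d (T : measurableType d) (P : probability T R) (V : T -> R) :
    mean P (f \o V) = mean P (fun w => f' (V w)%:M).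
  by congr (mean P _); apply/funext => w; rewrite /f' mxE eqxx mulr1n.
move=> h; apply: etrans (f'E _ _ _ _) _; apply: etrans _ (esym (f'E _ _ _ _)).
by apply: (cvg_unique (@Rhausdorff R) _ h); exact: cvg_cst.
Qed.

(** For sg = 0 the moments are those of the point mass at 0, which accounts for
    the degenerate case of the normal law. *)
Lemma normal_law_of_moments d (T : measurableType d) (P : probability T R)
    (V : T -> R) (sg : R) : measurable_fun setT V ->
  (forall n, intg P (fun w => V w ^+ n) /\
    mean P (fun w => V w ^+ n) = sg ^+ n * gauss_moment R n) ->
  forall B, measurable B -> P (V @^-1` B) = normal_law 0 sg B.
Proof.
move=> mV H B mB; rewrite /normal_law; case: eqP => [s0|/eqP s0]; last first.
  rewrite (@gaussian_moments_law _ _ P V _ _ (normal_prob 0 sg) id sg mV _ H) //.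
  exact: normal_moments.
rewrite (@gaussian_moments_law _ _ P V _ _ (dirac (0 : R)) id sg mV _ H) //.
move=> n; have mX : measurable_fun setT (fun w : R => w ^+ n).
  exact: exprn_measurable.
split.
  apply/integrableP; split; first exact/measurable_EFinP.
  rewrite integral_dirac // ?diracT ?mul1e ?ltry //.
  by apply: measurableT_comp => //; exact/measurable_EFinP.
rewrite meanE /Rintegral integral_dirac //; last exact/measurable_EFinP.
rewrite diracT mul1e /= s0 !expr0n; case: n {mX} => [|n] /=; first by rewrite mul1r.
by rewrite mul0r.
Qed.

End LawUniqueness.

(** * Means of products of independent variables *)
Section Independence.
Context (R : realType) d (T : measurableType d) (P : probability T R).
Context (I : finType) de (E : measurableType de) (X : I -> T -> E).
Hypothesis mX : forall i, measurable_fun setT (X i).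
Hypothesis indX : mutually_independent P X.
Implicit Types (f : I -> E -> R) (r : seq I).

(** Indicators are replaced by general functions one index at a time. *)
Definition subst_at f j (h : E -> R) : I -> E -> R :=
  fun i => if i == j then h else f i.

Lemma subst_at_same f j h : subst_at f j h j = h.
Proof. by rewrite /subst_at eqxx. Qed.

Lemma prod_subst_at f j h w :
  \prod_i subst_at f j h i (X i w) = (\prod_(i | i != j) f i (X i w)) * h (X j w).
Proof.
rewrite (bigD1 j) //= subst_at_same mulrC; congr (_ * _).
by apply: eq_bigr => i ij; rewrite /subst_at (negbTE ij).
Qed.

Lemma prod_mean_subst_at f j h :
  \prod_i mean P (subst_at f j h i \o X i) =
  (\prod_(i | i != j) mean P (f i \o X i)) * mean P (h \o X j).
Proof.
rewrite (bigD1 j) //= subst_at_same mulrC; congr (_ * _).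
by apply: eq_bigr => i ij; rewrite /subst_at (negbTE ij).
Qed.

Lemma measurable_indicT (B : set E) : measurable B -> measurable_fun setT (\1_B : E -> R).
Proof. by move=> mB; exact: measurable_indic. Qed.

Lemma intg_indicX i (B : set E) : measurable B -> intg P ((\1_B : E -> R) \o X i).
Proof.
move=> mB; apply: (@intg_bounded _ _ _ _ _ 1) => [|w].
  exact: measurableT_comp (measurable_indicT mB) (@mX i).
by rewrite /= indicE; case: (_ \in _); rewrite ?normr1 ?normr0.
Qed.

Lemma mean_indicX i (B : set E) : measurable B ->
  (mean P ((\1_B : E -> R) \o X i))%:E = P (X i @^-1` B).
Proof.
move=> mB; rewrite -expectation_mean; last exact: intg_indicX.
have -> : (\1_B : E -> R) \o X i = \1_(X i @^-1` B) by [].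
rewrite expectation_indic // -[X in measurable X]setTI; exact: mX.
Qed.

Lemma integral_prod_indic (B : I -> set E) : (forall i, measurable (B i)) ->
  (\int[P]_w (\prod_i (\1_(B i) (X i w) : R))%:E =
   (\prod_i mean P ((\1_(B i) : E -> R) \o X i))%:E)%E.
Proof.
move=> mB; rewrite -prodEFin; under eq_bigr do rewrite mean_indicX //.
have := indX [set: I]%SET mB.
rewrite [X in _ = X -> _](eq_bigl xpredT) => [<-|i]; last by rewrite inE.
set C := \bigcap_(i in _) _.
have mC : measurable C.
  apply: fin_bigcap_measurable => // i _.
  by rewrite -[X in measurable X]setTI; exact: mX.
transitivity (P (C `&` setT)); last by rewrite setIT.
rewrite -(integral_indic P measurableT mC).
apply: eq_integral => w _; congr EFin; rewrite indicE.
have [wC|wC] := boolP (w \in C).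
  rewrite big1 // => i _; rewrite indicE mem_set //.
  by move: wC; rewrite inE; apply; rewrite /= inE.
apply/eqP; rewrite prodf_seq_eq0; apply/hasP.
have [i iB] : exists i, ~ B i (X i w).
  apply: contrapT => /forallNP N; move: wC; rewrite notin_setE; apply => i _.
  exact: contrapT (N i).
by exists i; rewrite ?mem_index_enum //= indicE memNset.
Qed.

(** Induction on the list r of indices where f is not yet an indicator.  The
    function at the head of r is reached from indicators by
    [weighted_integral_ext], the product of the other factors being the weight. *)
Lemma ge0_integral_prod_indep r f :
  (forall i, measurable_fun setT (f i)) -> (forall i x, 0 <= f i x) ->
  (forall i, intg P (f i \o X i)) ->
  (forall i, i \notin r -> exists2 B, measurable B & f i = \1_B) ->
  (\int[P]_w (\prod_i f i (X i w))%:E = (\prod_i mean P (f i \o X i))%:E)%E.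
Proof.
elim: r f => [|j r IH] f mf f0 fi find.
  have /choice[B BP] : forall i, exists B, measurable B /\ f i = \1_B.
    by move=> i; have [|B mB fB] := find i; [|exists B].
  have -> : f = fun i => \1_(B i) by apply/funext => i; case: (BP i).
  by apply: integral_prod_indic => i; case: (BP i).
pose G w : R := \prod_(i | i != j) f i (X i w).
pose c : R := \prod_(i | i != j) mean P (f i \o X i).
have c0 : 0 <= c.
  apply: prodr_ge0 => i _; rewrite -[leLHS](mean_cst P).
  by apply: mean_le => //; [exact: intg_cst | move=> w; exact: f0].
have mG : measurable_fun setT G.
  rewrite /G; under eq_fun do rewrite big_mkcond.
  apply: measurable_prod => i _; case: (i != j) => //.
  by apply: measurableT_comp => //; exact: mX.
have fE w : \prod_i f i (X i w) = G w * f j (X j w) by rewrite (bigD1 j) //= mulrC.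
rewrite (eq_integral (fun w => (G w * f j (X j w))%:E)); last first.
  by move=> w _; rewrite fE.
transitivity (\int[P]_w (c * f j (X j w))%:E)%E; last first.
  have := expectation_mean (intgZ c (fi j)); rewrite unlock => /= ->.
  rewrite (meanZ c (fi j : intg P (fun w => f j (X j w)))).
  by rewrite [in RHS](bigD1 j) //= [in RHS]mulrC.
apply: (@weighted_integral_ext R _ E _ T P _ T P (X j) (X j) G (fun=> c)) => //.
- by move=> w; apply: prodr_ge0 => i _; exact: f0.
- move=> B mB.
  have H : (\int[P]_w (\prod_i subst_at f j \1_B i (X i w))%:E =
      (\prod_i mean P (subst_at f j \1_B i \o X i))%:E)%E.
    apply: IH.
    + by move=> i; rewrite /subst_at; case: eqP => // _; exact: measurable_indicT.
    + by move=> i x; rewrite /subst_at; case: eqP => // _; rewrite indicE.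
    + by move=> i; rewrite /subst_at; case: eqP => [->|_] //; exact: intg_indicX.
    + move=> i ir; rewrite /subst_at; case: eqP => [_|/eqP ij]; first by exists B.
      by apply: find; rewrite inE negb_or ij.
  rewrite (eq_integral (fun w => (\prod_i subst_at f j \1_B i (X i w))%:E)); last first.
    by move=> w _; rewrite prod_subst_at.
  rewrite H prod_mean_subst_at.
  have iB := @intg_indicX j B mB; rewrite -/c -(meanZ c iB).
  by have := expectation_mean (intgZ c iB); rewrite unlock => /= ->.
Qed.

(** A function of arbitrary sign is the difference of |f| + f and |f|, and the
    product is linear in each factor; r lists the indices still to be treated. *)
Lemma intg_prod_indep_aux r f :
  (forall i, measurable_fun setT (f i)) -> (forall i, intg P (f i \o X i)) ->
  (forall i x, i \notin r -> 0 <= f i x) ->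
  intg P (fun w => \prod_i f i (X i w)) /\
  mean P (fun w => \prod_i f i (X i w)) = \prod_i mean P (f i \o X i).
Proof.
elim: r f => [|j r IH] f mf fi f0.
  have H : (\int[P]_w (\prod_i f i (X i w))%:E = (\prod_i mean P (f i \o X i))%:E)%E.
    apply: (@ge0_integral_prod_indep (index_enum I)) => // [i x|i]; first exact: f0.
    by rewrite mem_index_enum.
  split; last by rewrite meanE /Rintegral H.
  apply/integrableP; split.
    apply/measurable_EFinP; apply: measurable_prod => i _.
    by apply: measurableT_comp => //; exact: mX.
  rewrite (eq_integral (fun w => (\prod_i f i (X i w))%:E)) => [|w _].
    by rewrite H ltry.
  by rewrite gee0_abs // lee_fin; apply: prodr_ge0 => i _; exact: f0.
pose a x := `|f j x| + f j x.
pose b x := `|f j x|.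
have mb : measurable_fun setT b by exact: measurableT_comp.
have ma : measurable_fun setT a by exact: measurable_funD.
have ib : intg P (b \o X j) by have := integrable_norm (fi j).
have ia : intg P (a \o X j) by exact: (intgD ib (fi j)).
have [iA eA] : intg P (fun w => \prod_i subst_at f j a i (X i w)) /\
  mean P (fun w => \prod_i subst_at f j a i (X i w)) =
  \prod_i mean P (subst_at f j a i \o X i).
  apply: IH.
  + by move=> i; rewrite /subst_at; case: eqP.
  + by move=> i; rewrite /subst_at; case: eqP => [->|].
  + move=> i x ir; rewrite /subst_at; case: eqP => [_|/eqP ij].
      by rewrite /a -lerBlDr sub0r -normrN ler_norm.
    by apply: f0; rewrite inE negb_or ij.
have [iB eB] : intg P (fun w => \prod_i subst_at f j b i (X i w)) /\
  mean P (fun w => \prod_i subst_at f j b i (X i w)) =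
  \prod_i mean P (subst_at f j b i \o X i).
  apply: IH.
  + by move=> i; rewrite /subst_at; case: eqP.
  + by move=> i; rewrite /subst_at; case: eqP => [->|].
  + move=> i x ir; rewrite /subst_at; case: eqP => [_|/eqP ij].
      by rewrite /b normr_ge0.
    by apply: f0; rewrite inE negb_or ij.
have fE : (fun w => \prod_i f i (X i w)) =
  (fun w => \prod_i subst_at f j a i (X i w) - \prod_i subst_at f j b i (X i w)).
  apply/funext => w; rewrite !prod_subst_at -mulrBr /a /b.
  by rewrite [LHS](bigD1 j) //= [LHS]mulrC addrAC subrr add0r.
rewrite fE; split; first exact: intgB.
rewrite meanB // eA eB !prod_mean_subst_at -mulrBr -meanB // [RHS](bigD1 j) //= mulrC.
congr (mean P _ * _); apply/funext => w; rewrite /= /a /b; ring.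
Qed.

Lemma mean_prod_indep f :
  (forall i, measurable_fun setT (f i)) -> (forall i, intg P (f i \o X i)) ->
  intg P (fun w => \prod_i f i (X i w)) /\
  mean P (fun w => \prod_i f i (X i w)) = \prod_i mean P (f i \o X i).
Proof.
move=> mf fi; apply: (@intg_prod_indep_aux (index_enum I)) => // i x.
by rewrite mem_index_enum.
Qed.

End Independence.

(** * Operations on words *)
Section Words.
Variable S : eqType.
Implicit Types (i : S) (w u v : seq S).

(** One pair (u, v) for each occurrence of the letter i in w = u i v: the places
    where a derivative with respect to Y_i can act. *)
Fixpoint splits i w : seq (seq S * seq S) :=
  if w is j :: w' then
    (if i == j then [:: ([::], w')] else [::]) ++
    [seq (j :: p.1, p.2) | p <- splits i w']
  else [::].

Lemma size_splits i w p : p \in splits i w -> ((size p.1 + size p.2).+1)%N = size w.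
Proof.
elim: w p => //= j w IH p; rewrite mem_cat => /orP[|].
  by case: eqP => // _; rewrite inE => /eqP ->.
by move=> /mapP[q /IH <- ->]; rewrite addSn.
Qed.

(** The words produced when the factor Y_i split off the trace of the word i w is
    contracted with a letter i of another trace of word w2 = u i v: the two traces
    merge into one, in two ways, since W_i contains both Y_i and its transpose. *)
Definition merges i w w2 : seq (seq S) :=
  flatten [seq [:: rev w ++ i :: p.2 ++ p.1; i :: w ++ p.2 ++ p.1] | p <- splits i w2].

Lemma size_merges i w w2 g : g \in merges i w w2 -> size g = (size w + size w2)%N.
Proof.
move=> /flattenP[l /mapP[p /size_splits h ->]].
rewrite !inE => /orP[] /eqP -> /=; rewrite !size_cat ?size_rev /= ?size_cat -h.
  by rewrite addnS addnS (addnC (size p.2)).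
by rewrite (addnC (size p.2)) addnS.
Qed.

Fixpoint picks (T : Type) (L : seq T) : seq (T * seq T) :=
  if L is x :: L' then
    (x, L') :: [seq (q.1, x :: q.2) | q <- picks L']
  else [::].

(** The measure of the induction on loop equations. *)
Definition total (L : seq (seq S)) : nat := sumn (map size L).

Lemma total_picks L q : q \in picks L -> (size q.1 + total q.2)%N = total L.
Proof.
elim: L q => //= x L IH q; rewrite inE => /orP[/eqP -> //|/mapP[q' /IH h ->]].
by rewrite /total /= -!/(total _) -h addnCA.
Qed.
End Words.

(** * Loop equations *)
Section LoopEquation.
(* A model of Gaussian integration by parts: Y_i are matrices over a commutative
   algebra A, phi is the expectation, and D i a b is nu times the derivative with
   respect to the entry (a, b) of Y_i. *)
Variables (R : fieldType) (A : comAlgType R) (s M N : nat).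
Variable Y : 'I_s -> 'M[A]_(M, N).
Variable D : 'I_s -> 'I_M -> 'I_N -> A -> A.
Variable phi : A -> R.
Variable nu : R.
Hypothesis DD : forall i a b x y, D i a b (x + y) = D i a b x + D i a b y.
Hypothesis DZ : forall i a b c x, D i a b (c *: x) = c *: D i a b x.
Hypothesis DM : forall i a b x y, D i a b (x * y) = D i a b x * y + x * D i a b y.
Hypothesis DY : forall i a b j c d,
  D i a b (Y j c d) = (nu *+ [&& i == j, a == c & b == d])%:A.
Hypothesis phiD : forall x y, phi (x + y) = phi x + phi y.
Hypothesis phiZ : forall c x, phi (c *: x) = c * phi x.
Hypothesis phi1 : phi 1 = 1.
Hypothesis phi_ibp : forall i a b x, phi (Y i a b * x) = phi (D i a b x).
Hypothesis nuN : nu * N%:R = 1.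
Implicit Types (w u v : seq 'I_s) (L : seq (seq 'I_s)).

Lemma phi_sum (I : Type) (r : seq I) (F : I -> A) :
  phi (\sum_(i <- r) F i) = \sum_(i <- r) phi (F i).
Proof.
elim: r => [|x r IH]; first by rewrite !big_nil -(scale0r 0) phiZ mul0r.
by rewrite !big_cons phiD IH.
Qed.

Lemma D_sum i a b (I : Type) (r : seq I) (F : I -> A) :
  D i a b (\sum_(k <- r) F k) = \sum_(k <- r) D i a b (F k).
Proof.
elim: r => [|x r IH]; first by rewrite !big_nil -(scale0r 0) DZ !scale0r.
by rewrite !big_cons DD IH.
Qed.

Lemma D_alg i a b c : D i a b c%:A = 0.
Proof.
have D1 : D i a b 1 = 0.
  have := DM i a b 1 1; rewrite !mulr1 mul1r => h.
  by apply: (addrI (D i a b 1)); rewrite addr0 -h.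
by rewrite DZ D1 scaler0.
Qed.

Definition gram i : 'M[A]_N := (Y i)^T *m Y i.
Definition gram_word w : 'M[A]_N := foldr (fun i S => gram i *m S) 1%:M w.
Definition tr_word w : A := \tr (gram_word w).

Lemma gram_word_cat u v : gram_word (u ++ v) = gram_word u *m gram_word v.
Proof. by elim: u => [|i u IH] /=; rewrite ?mul1mx // IH mulmxA. Qed.

Lemma gram_sym i : (gram i)^T = gram i.
Proof. by rewrite trmx_mul trmxK. Qed.

Lemma gram_word_rev w : gram_word (rev w) = (gram_word w)^T.
Proof.
elim: w => [|i w IH]; first by rewrite /= trmx1.
by rewrite rev_cons -cats1 gram_word_cat /= mulmx1 trmx_mul gram_sym IH.
Qed.

Definition Dm i a b m n (U : 'M[A]_(m, n)) : 'M[A]_(m, n) := map_mx (D i a b) U.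

Lemma Dm_mul i a b m n p (U : 'M[A]_(m, n)) (V : 'M[A]_(n, p)) :
  Dm i a b (U *m V) = Dm i a b U *m V + U *m Dm i a b V.
Proof.
apply/matrixP => c d; rewrite !mxE D_sum -big_split /=.
by apply: eq_bigr => k _; rewrite DM !mxE.
Qed.

Lemma Dm_tr i a b m n (U : 'M[A]_(m, n)) : Dm i a b U^T = (Dm i a b U)^T.
Proof. by apply/matrixP => c d; rewrite !mxE. Qed.

Lemma DmY i a b j : Dm i a b (Y j) = (nu *+ (i == j))%:A *: delta_mx a b.
Proof.
apply/matrixP => c d; rewrite !mxE DY (eq_sym c) (eq_sym d).
by case: (i == j); case: (a == c); case: (b == d);
  rewrite /= ?mulr0n ?mulr1n ?scale0r ?mulr0 ?mulr1 ?mul0r.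
Qed.

Lemma Dm1 i a b : Dm i a b (1%:M : 'M[A]_N) = 0.
Proof.
apply/matrixP => c d; rewrite !mxE.
by have := D_alg i a b (1 *+ (c == d)); rewrite -scalerMnl scale1r.
Qed.

(** The derivative of Y_i^T Y_i in the direction (a, b), without the factor nu. *)
Definition dgram i a b : 'M[A]_N :=
  delta_mx b a *m Y i + (Y i)^T *m delta_mx a b.

Lemma Dm_gram i a b j : Dm i a b (gram j) = (nu *+ (i == j))%:A *: dgram i a b.
Proof.
rewrite /gram Dm_mul Dm_tr DmY linearZ /= trmx_delta -scalemxAl -scalemxAr -scalerDr.
by have [->|_] := eqVneq i j; rewrite // mulr0n scale0r !scale0r.
Qed.

Lemma Dm_gram_word i a b w : Dm i a b (gram_word w) =
  nu%:A *: \sum_(p <- splits i w) gram_word p.1 *m dgram i a b *m gram_word p.2.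
Proof.
elim: w => [|j w IH] /=; first by rewrite Dm1 big_nil scaler0.
rewrite Dm_mul Dm_gram IH big_cat big_map /= [in RHS]scalerDr; congr (_ + _).
  rewrite -scalemxAl; case: eqVneq => [->|_].
    by rewrite big_seq1 /= mul1mx mulr1n.
  by rewrite big_nil mulr0n scale0r scale0r scaler0.
rewrite -scalemxAr mulmx_sumr; congr (_ *: _).
by apply: eq_bigr => p _; rewrite !mulmxA.
Qed.

(** The next lemmas carry out the sums over the matrix index (a, b) of the
    derivative.  Within one word the elementary matrix with indices (b, a) reverses
    a piece, and the one with indices (a, b) cuts the trace into two; between two
    words both of them merge the traces. *)
Lemma sum_delta_tr (P : 'M[A]_(M, N)) (Q : 'M[A]_(M, N)) :
  \sum_a \sum_b (P *m delta_mx b a *m Q) a b = \tr (P^T *m Q).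
Proof.
rewrite exchange_big /=; apply: eq_bigr => b _; rewrite mxE.
apply: eq_bigr => a _; rewrite -mulmxA mxE (bigD1 b) //= big1 ?addr0.
  rewrite [P^T _ _]mxE; congr (_ * _).
  rewrite mxE (bigD1 a) //= mxE !eqxx mul1r.
  by rewrite big1 ?addr0 // => c ca; rewrite mxE (negbTE ca) andbF mul0r.
move=> c cb; rewrite [X in _ * X]mxE big1 ?mulr0 // => e _.
by rewrite mxE (negbTE cb) mul0r.
Qed.

Lemma mul_delta_entry (P : 'M[A]_M) (Q : 'M[A]_N) a b :
  (P *m delta_mx a b *m Q) a b = P a a * Q b b.
Proof.
rewrite -mulmxA mxE (bigD1 a) //= big1 ?addr0.
  congr (_ * _); rewrite mxE (bigD1 b) //= mxE !eqxx mul1r.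
  by rewrite big1 ?addr0 // => c ca; rewrite mxE (negbTE ca) andbF mul0r.
move=> c cb; rewrite [X in _ * X]mxE big1 ?mulr0 // => e _.
by rewrite mxE (negbTE cb) mul0r.
Qed.

Lemma sum_delta_mul (P : 'M[A]_M) (Q : 'M[A]_N) :
  \sum_a \sum_b (P *m delta_mx a b *m Q) a b = \tr P * \tr Q.
Proof.
rewrite /mxtrace mulr_suml; apply: eq_bigr => a _; rewrite mulr_sumr.
by apply: eq_bigr => b _; rewrite mul_delta_entry.
Qed.

Lemma tr_mul_delta m n (G : 'M[A]_(m, n)) a b :
  \tr (G *m (delta_mx b a : 'M[A]_(n, m))) = G a b.
Proof.
rewrite /mxtrace (bigD1 a) //= big1 ?addr0.
  rewrite mxE (bigD1 b) //= mxE !eqxx mulr1 big1 ?addr0 // => c cb.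
  by rewrite mxE (negbTE cb) mulr0.
move=> c ca; rewrite mxE big1 // => e _.
by rewrite mxE (negbTE ca) andbF mulr0.
Qed.

Lemma sum_entry_tr1 (C G : 'M[A]_(M, N)) (U : 'M[A]_N) :
  \sum_a \sum_b C a b * \tr (U *m (delta_mx b a *m G)) = \tr (C^T *m (G *m U)).
Proof.
rewrite exchange_big /=; apply: eq_bigr => b _; rewrite mxE.
apply: eq_bigr => a _; rewrite mxE; congr (_ * _).
by rewrite mulmxA mxtrace_mulC mulmxA tr_mul_delta.
Qed.

Lemma sum_entry_tr2 (C : 'M[A]_(M, N)) (H : 'M[A]_(N, M)) (V : 'M[A]_N) :
  \sum_a \sum_b C a b * \tr (H *m delta_mx a b *m V) = \tr (C *m (V *m H)).
Proof.
apply: eq_bigr => a _; rewrite mxE.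
apply: eq_bigr => b _; congr (_ * _).
by rewrite mxtrace_mulC mulmxA tr_mul_delta.
Qed.

(** The derivative acting inside the word itself: on the remaining factor Y_i
    of the first letter (the term with M), or on a later letter i, which either
    reverses a piece of the word or cuts its trace into two traces. *)
Lemma loop_dY i w :
  \sum_a \sum_b (Dm i a b (Y i *m gram_word w)) a b =
  nu%:A * (M%:R * tr_word w + \sum_(p <- splits i w)
    (tr_word (rev p.1 ++ i :: p.2) + tr_word (i :: p.1) * tr_word p.2)).
Proof.
have E a b : Dm i a b (Y i *m gram_word w) = nu%:A *: (1%:M *m delta_mx a b *m gram_word w +
   \sum_(p <- splits i w) (Y i *m gram_word p.1 *m delta_mx b a *m (Y i *m gram_word p.2) +
      (Y i *m gram_word p.1 *m (Y i)^T) *m delta_mx a b *m gram_word p.2)).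
  rewrite Dm_mul DmY eqxx mulr1n mul1mx Dm_gram_word -scalemxAl -scalemxAr -scalerDr.
  congr (_ *: (_ + _)); rewrite mulmx_sumr; apply: eq_bigr => p _.
  by rewrite /dgram mulmxDr mulmxDl mulmxDr !mulmxA.
under eq_bigr => a _ do (under eq_bigr => b _ do rewrite E mxE mxE summxE).
under eq_bigr => a _ do rewrite -mulr_sumr.
rewrite -mulr_sumr; congr (_ * _).
under eq_bigr => a _ do rewrite big_split /= exchange_big /=.
rewrite big_split /= sum_delta_mul mxtrace1; congr (_ + _).
rewrite exchange_big /=; apply: eq_bigr => p _.
under eq_bigr => a _ do (under eq_bigr => b _ do rewrite mxE).
under eq_bigr => a _ do rewrite big_split /=.
rewrite big_split /= sum_delta_tr sum_delta_mul; congr (_ + _ * _).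
  by rewrite /tr_word gram_word_cat gram_word_rev /= /gram trmx_mul !mulmxA.
by rewrite /tr_word /= /gram mxtrace_mulC mulmxA.
Qed.

(** What integration by parts of the trace of i w does to the other factors. *)
Definition grad i w (x : A) : A := \sum_a \sum_b (Y i *m gram_word w) a b * D i a b x.

(** Integration by parts with respect to the factor Y_i^T that opens the word. *)
Lemma loop i w x : phi (tr_word (i :: w) * x) =
  nu * (M%:R * phi (tr_word w * x) + \sum_(p <- splits i w)
    (phi (tr_word (rev p.1 ++ i :: p.2) * x) + phi (tr_word (i :: p.1) * tr_word p.2 * x)))
  + phi (grad i w x).
Proof.
have -> : tr_word (i :: w) * x = \sum_a \sum_b Y i a b * ((Y i *m gram_word w) a b * x).
  rewrite exchange_big mulr_suml; apply: eq_bigr => b _.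
  rewrite /= -mulmxA mxE mulr_suml; apply: eq_bigr => a _.
  by rewrite mxE mulrA.
rewrite phi_sum; under eq_bigr => a _ do rewrite phi_sum.
under eq_bigr => a _ do (under eq_bigr => b _ do rewrite phi_ibp DM phiD).
under eq_bigr => a _ do rewrite big_split /=.
rewrite big_split /=; congr (_ + _); last first.
  by rewrite /grad phi_sum; apply: eq_bigr => a _; rewrite phi_sum.
have E : \sum_a \sum_b D i a b ((Y i *m gram_word w) a b) * x =
    nu%:A * (M%:R * tr_word w + \sum_(p <- splits i w)
    (tr_word (rev p.1 ++ i :: p.2) + tr_word (i :: p.1) * tr_word p.2)) * x.
  rewrite -loop_dY mulr_suml; apply: eq_bigr => a _; rewrite mulr_suml.
  by apply: eq_bigr => b _; rewrite [in RHS]mxE.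
under eq_bigr => a _ do rewrite -phi_sum.
rewrite -phi_sum E -mulrA mulr_algl phiZ mulrDl phiD; congr (_ * (_ + _)).
  by rewrite -mulrA -scaler_nat -scalerAl mul1r phiZ.
rewrite mulr_suml phi_sum; apply: eq_bigr => p _.
by rewrite mulrDl phiD.
Qed.

Lemma grad_tr_word i w w2 : grad i w (tr_word w2) = nu%:A * \sum_(g <- merges i w w2) tr_word g.
Proof.
have E a b : D i a b (tr_word w2) = nu%:A * \sum_(p <- splits i w2)
   (\tr (gram_word p.1 *m (delta_mx b a *m (Y i *m gram_word p.2)))
    + \tr (gram_word p.1 *m (Y i)^T *m delta_mx a b *m gram_word p.2)).
  have -> : D i a b (tr_word w2) = \tr (Dm i a b (gram_word w2)).
    by rewrite /tr_word D_sum; apply: eq_bigr => k _; rewrite mxE.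
  rewrite Dm_gram_word mxtraceZ raddf_sum; congr (_ * _); apply: eq_bigr => p _.
  by rewrite /dgram mulmxDr mulmxDl raddfD /= !mulmxA.
rewrite /grad; under eq_bigr => a _ do (under eq_bigr => b _ do rewrite E mulrCA mulr_sumr).
under eq_bigr => a _ do rewrite -mulr_sumr exchange_big /=.
rewrite -mulr_sumr exchange_big /=; congr (_ * _).
rewrite /merges big_flatten big_map /=; apply: eq_bigr => p _.
under eq_bigr => a _ do (under eq_bigr => b _ do rewrite mulrDr).
under eq_bigr => a _ do rewrite big_split /=.
rewrite big_split /= sum_entry_tr1 sum_entry_tr2 !big_cons big_nil addr0; congr (_ + _).
  by rewrite /tr_word gram_word_cat /= gram_word_cat gram_word_rev /gram trmx_mul !mulmxA.
by rewrite /tr_word /= !gram_word_cat /gram !mulmxA [LHS]mxtrace_mulC !mulmxA.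
Qed.

Lemma gradM i w x y : grad i w (x * y) = grad i w x * y + x * grad i w y.
Proof.
rewrite /grad mulr_suml mulr_sumr -big_split /=; apply: eq_bigr => a _.
rewrite mulr_suml mulr_sumr -big_split /=; apply: eq_bigr => b _.
by rewrite DM; ring.
Qed.

Lemma gradD i w x y : grad i w (x + y) = grad i w x + grad i w y.
Proof.
rewrite /grad -big_split /=; apply: eq_bigr => a _.
rewrite -big_split /=; apply: eq_bigr => b _; by rewrite DD mulrDr.
Qed.

Lemma grad_alg i w c : grad i w c%:A = 0.
Proof.
by rewrite /grad big1 // => a _; rewrite big1 // => b _; rewrite D_alg mulr0.
Qed.

Definition ctr_word w : A := tr_word w - (phi (tr_word w))%:A.
Definition cprod L : A := \prod_(w <- L) ctr_word w.
(** A mean trace is of order N; nu = 1/N brings it to order one. *)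
Definition phi_ntr w : R := nu * phi (tr_word w).
(** Central moments of traces are of order one without any normalization. *)
Definition phi_cprod L : R := phi (cprod L).

Lemma grad_ctr_word i w w2 : grad i w (ctr_word w2) = nu%:A * \sum_(g <- merges i w w2) tr_word g.
Proof. by rewrite /ctr_word -scaleNr gradD grad_alg addr0 grad_tr_word. Qed.

Lemma grad_cprod i w L : grad i w (cprod L) = \sum_(q <- picks L)
  nu%:A * \sum_(g <- merges i w q.1) tr_word g * cprod q.2.
Proof.
elim: L => [|x L IH] /=.
  by rewrite /cprod big_nil -[X in grad _ _ X]scale1r grad_alg big_nil.
rewrite /cprod big_cons gradM -/(cprod L) IH big_cons /= grad_ctr_word.
rewrite -mulrA mulr_suml; congr (_ + _).
rewrite big_map mulr_sumr; apply: eq_bigr => q _.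
rewrite mulrCA mulr_sumr; congr (_ * _); apply: eq_bigr => g _.
by rewrite big_cons mulrCA.
Qed.

Lemma tr_wordE w : tr_word w = ctr_word w + (phi (tr_word w))%:A.
Proof. by rewrite /ctr_word subrK. Qed.

Lemma phi_tr_wordE w : phi (tr_word w) = N%:R * phi_ntr w.
Proof. by rewrite /phi_ntr mulrA (mulrC _ nu) nuN mul1r. Qed.

Lemma phi_cprod_cons w L : phi_cprod (w :: L) = phi (ctr_word w * cprod L).
Proof. by rewrite /phi_cprod /cprod big_cons. Qed.

Lemma phi_tr_word_mul w x : phi (tr_word w * x) = phi (ctr_word w * x) + N%:R * phi_ntr w * phi x.
Proof. by rewrite {1}tr_wordE mulrDl phiD mulr_algl phiZ phi_tr_wordE. Qed.

Lemma phi_cprod_nil : phi_cprod [::] = 1.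
Proof. by rewrite /phi_cprod /cprod big_nil. Qed.

Lemma phi_cprod1 w : phi_cprod [:: w] = 0.
Proof.
rewrite phi_cprod_cons /cprod big_nil mulr1 /ctr_word -scaleNr phiD phiZ phi1.
by rewrite mulr1 subrr.
Qed.

Lemma phi_cprod_swap w u L : phi_cprod (w :: u :: L) = phi_cprod (u :: w :: L).
Proof. by rewrite /phi_cprod /cprod !big_cons mulrCA. Qed.

Lemma tr_word_nil : tr_word [::] = N%:R.
Proof. by rewrite /tr_word mxtrace1. Qed.

Lemma phi_nat n : phi n%:R = n%:R.
Proof. by rewrite -scaler_nat phiZ phi1 mulr1. Qed.

Lemma phi_ntr_nil : phi_ntr [::] = 1.
Proof. by rewrite /phi_ntr tr_word_nil phi_nat. Qed.

Lemma phi_cprod_word_nil L : phi_cprod ([::] :: L) = 0.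
Proof.
rewrite phi_cprod_cons /ctr_word tr_word_nil phi_nat scaler_nat subrr mul0r.
by rewrite -(scale0r 0) phiZ mul0r.
Qed.

Lemma phi_tr_word2 u v L : phi (tr_word u * tr_word v * cprod L) =
  phi_cprod (u :: v :: L) + N%:R * phi_ntr u * phi_cprod (v :: L) + N%:R * phi_ntr v * phi_cprod (u :: L)
  + N%:R * phi_ntr u * (N%:R * phi_ntr v) * phi_cprod L.
Proof.
rewrite -mulrA (phi_tr_word_mul u) [ctr_word u * _]mulrCA !(phi_tr_word_mul v).
have -> : phi (ctr_word v * (ctr_word u * cprod L)) = phi_cprod (u :: v :: L).
  by rewrite phi_cprod_swap /phi_cprod /cprod !big_cons.
by rewrite -!phi_cprod_cons -/(phi_cprod L); ring.
Qed.

Lemma phi_ntr_rec i w : phi_ntr (i :: w) = nu * M%:R * phi_ntr w + \sum_(p <- splits i w)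
  (phi_ntr (i :: p.1) * phi_ntr p.2 + nu * nu * phi_cprod [:: i :: p.1; p.2]
   + nu * phi_ntr (rev p.1 ++ i :: p.2)).
Proof.
rewrite {1}/phi_ntr -[tr_word (i :: w)]mulr1 loop -[X in grad _ _ X]scale1r grad_alg.
have -> : phi 0 = 0 by rewrite -(scale0r 0) phiZ mul0r.
rewrite addr0 mulrA mulrDr; congr (_ + _); first by rewrite mulr1 /phi_ntr; ring.
rewrite mulr_sumr; apply: eq_bigr => p _.
have := phi_tr_word2 (i :: p.1) p.2 [::]; rewrite /cprod big_nil => ->.
rewrite !phi_cprod1 phi_cprod_nil !mulr1 phi_tr_wordE.
transitivity ((nu * N%:R) * (nu * N%:R) * (phi_ntr (i :: p.1) * phi_ntr p.2) +
  nu * nu * phi_cprod [:: i :: p.1; p.2] + nu * (nu * N%:R) * phi_ntr (rev p.1 ++ i :: p.2)).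
  by ring.
by rewrite nuN !mul1r mulr1.
Qed.

(** Uncentring a trace costs N phi_ntr, and nu N = 1.  The terms of order N that
    arise from cutting the word are those of N phi_ntr (i :: w), so that they
    cancel when the trace of i :: w is centred. *)
Lemma phi_cprod_rec i w L : phi_cprod ((i :: w) :: L) = nu * M%:R * phi_cprod (w :: L)
  + \sum_(p <- splits i w)
    (phi_ntr (i :: p.1) * phi_cprod (p.2 :: L) + phi_ntr p.2 * phi_cprod ((i :: p.1) :: L)
     + nu * (phi_cprod ((i :: p.1) :: p.2 :: L) - phi_cprod [:: i :: p.1; p.2] * phi_cprod L)
     + nu * phi_cprod ((rev p.1 ++ i :: p.2) :: L))
  + \sum_(q <- picks L) \sum_(g <- merges i w q.1)
     (phi_ntr g * phi_cprod q.2 + nu * phi_cprod (g :: q.2)).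
Proof.
have -> : phi_cprod ((i :: w) :: L) =
    phi (tr_word (i :: w) * cprod L) - N%:R * phi_ntr (i :: w) * phi_cprod L.
  by rewrite phi_tr_word_mul -phi_cprod_cons -/(phi_cprod L) addrK.
rewrite loop addrAC; congr (_ + _); last first.
  rewrite grad_cprod phi_sum; apply: eq_bigr => q _.
  rewrite mulr_algl phiZ phi_sum mulr_sumr; apply: eq_bigr => g _.
  rewrite phi_tr_word_mul -phi_cprod_cons -/(phi_cprod q.2).
  transitivity ((nu * N%:R) * (phi_ntr g * phi_cprod q.2) + nu * phi_cprod (g :: q.2)); first by ring.
  by rewrite nuN mul1r.
rewrite phi_ntr_rec mulrDr mulrDr mulrDl opprD addrACA; congr (_ + _).
  rewrite phi_tr_word_mul -phi_cprod_cons -/(phi_cprod L); ring.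
rewrite mulr_sumr mulr_sumr mulr_suml -sumrB; apply: eq_bigr => p _.
rewrite phi_tr_word2 phi_tr_word_mul -phi_cprod_cons -/(phi_cprod L).
transitivity ((nu * N%:R) * (phi_ntr (i :: p.1) * phi_cprod (p.2 :: L)) +
  (nu * N%:R) * (phi_ntr p.2 * phi_cprod ((i :: p.1) :: L)) +
  ((nu * N%:R) * N%:R * (phi_ntr (i :: p.1) * phi_ntr p.2 * phi_cprod L)
    - N%:R * (phi_ntr (i :: p.1) * phi_ntr p.2 * phi_cprod L)) +
  nu * (phi_cprod ((i :: p.1) :: p.2 :: L) - (nu * N%:R) * (phi_cprod [:: i :: p.1; p.2] * phi_cprod L)) +
  nu * phi_cprod ((rev p.1 ++ i :: p.2) :: L)); first by ring.
by rewrite nuN !mul1r subrr addr0.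
Qed.

End LoopEquation.

(** * Limits of the loop equations and Wick calculus *)
Section WickLimit.
Variables (R : realType) (S : eqType).
Variables (m : nat -> seq S -> R) (k : nat -> seq (seq S) -> R) (al nu : nat -> R).
Variable lambda : R.
Hypothesis al_cvg : al @ \oo --> lambda.
Hypothesis nu_cvg : nu @ \oo --> (0 : R).
Hypothesis m_nil : forall N, m N [::] = 1.
Hypothesis k_nil : forall N, k N [::] = 1.
Hypothesis k_word_nil : forall N L, k N ([::] :: L) = 0.
Hypothesis k1 : forall N w, k N [:: w] = 0.
Hypothesis k_perm : forall N L L', perm_eq L L' -> k N L = k N L'.
Hypothesis m_rec : forall N i w, m N (i :: w) = al N * m N w +
  \sum_(p <- splits i w) (m N (i :: p.1) * m N p.2
    + nu N * nu N * k N [:: i :: p.1; p.2] + nu N * m N (rev p.1 ++ i :: p.2)).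
Hypothesis k_rec : forall N i w L, k N ((i :: w) :: L) = al N * k N (w :: L)
  + \sum_(p <- splits i w)
    (m N (i :: p.1) * k N (p.2 :: L) + m N p.2 * k N ((i :: p.1) :: L)
     + nu N * (k N ((i :: p.1) :: p.2 :: L) - k N [:: i :: p.1; p.2] * k N L)
     + nu N * k N ((rev p.1 ++ i :: p.2) :: L))
  + \sum_(q <- picks L) \sum_(g <- merges i w q.1)
     (m N g * k N q.2 + nu N * k N (g :: q.2)).

Definition mlim w : R := lim (m ^~ w @ \oo).
Definition klim L : R := lim (k ^~ L @ \oo).

Lemma is_cvg_bigsum (I : eqType) (r : seq I) (u : I -> nat -> R) :
  (forall i, i \in r -> cvgn (u i)) -> cvgn (fun N => \sum_(i <- r) u i N).
Proof.
move=> ur; under eq_fun do rewrite big_seq.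
apply/cvg_ex; exists (\sum_(i <- r | i \in r) lim (u i @ \oo)).
by apply: cvg_bigsum => i /ur.
Qed.

Let is_cvg_al : cvgn al. Proof. by apply/cvg_ex; exists lambda. Qed.
Let is_cvg_nu : cvgn nu. Proof. by apply/cvg_ex; exists 0. Qed.

(** Strong induction on the length: each loop equation expresses its left side by
    sums of products of sequences of smaller total length, M/N and 1/N. *)
Lemma is_cvg_moments n : (forall w, (size w <= n)%N -> cvgn (m ^~ w)) /\
  (forall L, (total L <= n)%N -> cvgn (k ^~ L)).
Proof.
elim/ltn_ind: n => n IH.
have IHm w : (size w < n)%N -> cvgn (m ^~ w).
  by move=> wn; have [+ _] := IH _ wn; apply.
have IHk L : (total L < n)%N -> cvgn (k ^~ L).
  by move=> Ln; have [_ +] := IH _ Ln; apply.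
split=> [[|i w]|[|[|i w] L]] sn.
- by under eq_fun do rewrite m_nil; exact: is_cvg_cst.
- under eq_fun do rewrite m_rec.
  apply: is_cvgD; first by apply: is_cvgM => //; exact: IHm.
  apply: is_cvg_bigsum => -[u v] /size_splits /= ps.
  have h1 : (size (i :: u) < n)%N by move: sn; rewrite /= -ps; lia.
  have h2 : (size v < n)%N by move: sn; rewrite /= -ps; lia.
  have h3 : (size (rev u ++ i :: v) < n)%N.
    by rewrite size_cat size_rev /=; move: sn; rewrite /= -ps; lia.
  apply: is_cvgD; last by apply: is_cvgM => //; exact: IHm.
  apply: is_cvgD; first by apply: is_cvgM; exact: IHm.
  apply: is_cvgM; first exact: is_cvgM.
  by apply: IHk; rewrite /total /=; move: sn; rewrite /= -ps; lia.
- by under eq_fun do rewrite k_nil; exact: is_cvg_cst.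
- by under eq_fun do rewrite k_word_nil; exact: is_cvg_cst.
- under eq_fun do rewrite k_rec.
  have {}sn : (size w + total L < n)%N by move: sn; rewrite /total.
  apply: is_cvgD; first apply: is_cvgD.
  + by apply: is_cvgM => //; exact: IHk.
  + apply: is_cvg_bigsum => -[u v] /size_splits /= ps.
    have h1 : (size (i :: u) < n)%N by rewrite /=; move: sn; rewrite -ps; lia.
    have h2 : (size v < n)%N by move: sn; rewrite -ps; lia.
    have h3 : (total ((rev u ++ i :: v) :: L) < n)%N.
      rewrite /total /= size_cat size_rev /= -/(total L).
      by move: sn; rewrite -ps; lia.
    have h4 : (total (v :: L) < n)%N.
      by rewrite /total /= -/(total L); move: sn; rewrite -ps; lia.
    have h5 : (total ((i :: u) :: L) < n)%N.
      by rewrite /total /= -/(total L); move: sn; rewrite -ps; lia.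
    have h6 : (total ((i :: u) :: v :: L) < n)%N.
      by rewrite /total /= -/(total L); move: sn; rewrite -ps; lia.
    have h7 : (total [:: i :: u; v] < n)%N.
      by rewrite /total /=; move: sn; rewrite -ps; lia.
    have h8 : (total L < n)%N by lia.
    apply: is_cvgD; last by apply: is_cvgM => //; exact: IHk.
    apply: is_cvgD.
      by apply: is_cvgD; (apply: is_cvgM; [exact: IHm | exact: IHk]).
    apply: is_cvgM => //; apply: is_cvgB; first exact: IHk.
    by apply: is_cvgM; exact: IHk.
  + apply: is_cvg_bigsum => -[w2 L2] /total_picks /= qs.
    apply: is_cvg_bigsum => g /size_merges gs /=.
    have h1 : (size g < n)%N by rewrite gs; move: sn; rewrite -qs; lia.
    have h2 : (total L2 < n)%N by move: sn; rewrite -qs; lia.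
    have h3 : (total (g :: L2) < n)%N.
      by rewrite /total /= -/(total _) gs; move: sn; rewrite -qs; lia.
    apply: is_cvgD; first by apply: is_cvgM; [exact: IHm | exact: IHk].
    by apply: is_cvgM => //; exact: IHk.
Qed.

Lemma cvg_m w : m ^~ w @ \oo --> mlim w.
Proof. by have [h _] := is_cvg_moments (size w); apply: h. Qed.

Lemma cvg_k L : k ^~ L @ \oo --> klim L.
Proof. by have [_ h] := is_cvg_moments (total L); apply: h. Qed.

Lemma limE (u v : nat -> R) (a b : R) : u =1 v -> u @ \oo --> a -> v @ \oo --> b -> a = b.
Proof.
by move=> /funext <- ua ub; apply: cvg_unique ua ub; exact: Rhausdorff.
Qed.

Lemma klim_nil : klim [::] = 1.
Proof.
apply: (@limE (k ^~ [::]) (fun=> 1) _ _ k_nil); first exact: cvg_k.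
exact: cvg_cst.
Qed.

Lemma klim_word_nil L : klim ([::] :: L) = 0.
Proof.
apply: (@limE (k ^~ ([::] :: L)) (fun=> 0) _ _ (fun N => k_word_nil N L)).
  exact: cvg_k.
exact: cvg_cst.
Qed.

Lemma klim1 w : klim [:: w] = 0.
Proof.
apply: (@limE (k ^~ [:: w]) (fun=> 0) _ _ (fun N => k1 N w)); first exact: cvg_k.
exact: cvg_cst.
Qed.

Lemma klim_perm L L' : perm_eq L L' -> klim L = klim L'.
Proof.
move=> LL'; apply: (@limE (k ^~ L) (k ^~ L') _ _ (fun N => k_perm N LL'));
  exact: cvg_k.
Qed.

(** All corrections of order 1/N disappear; in particular the merged words now
    enter only through mlim, separately for each entry of L. *)
Lemma klim_rec i w L : klim ((i :: w) :: L) = lambda * klim (w :: L)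
  + \sum_(p <- splits i w)
    (mlim (i :: p.1) * klim (p.2 :: L) + mlim p.2 * klim ((i :: p.1) :: L))
  + \sum_(q <- picks L) \sum_(g <- merges i w q.1) mlim g * klim q.2.
Proof.
apply: (@limE (k ^~ ((i :: w) :: L)) _ _ _ (fun N => k_rec N i w L)).
  exact: cvg_k.
apply: cvgD; first apply: cvgD.
- by apply: cvgM => //; exact: cvg_k.
- apply: cvg_bigsum => p _.
  rewrite -[X in _ --> X]addr0 -[X in _ --> X + _]addr0.
  have h0 x : 0 = 0 * x :> R by rewrite mul0r.
  rewrite [X in _ --> _ + X + _](h0 (klim ((i :: p.1) :: p.2 :: L) - klim [:: i :: p.1; p.2] * klim L)).
  rewrite [X in _ --> _ + X](h0 (klim ((rev p.1 ++ i :: p.2) :: L))).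
  apply: cvgD; last by apply: cvgM => //; exact: cvg_k.
  apply: cvgD.
    by apply: cvgD; (apply: cvgM; [exact: cvg_m | exact: cvg_k]).
  apply: cvgM => //; apply: cvgB; first exact: cvg_k.
  by apply: cvgM; exact: cvg_k.
- apply: cvg_bigsum => q _; apply: cvg_bigsum => g _.
  rewrite -[X in _ --> X]addr0 -[X in _ --> _ + X](mul0r (klim (g :: q.2))).
  apply: cvgD; first by apply: cvgM; [exact: cvg_m | exact: cvg_k].
  by apply: cvgM => //; exact: cvg_k.
Qed.

(** Induction on the length of w.  For a fixed list L both sides satisfy the limit
    recursion: it is linear in the moments with a shorter first word, to which the
    induction hypothesis applies, up to merging terms, and those already have the
    form of the right side. *)
Lemma wick w L : klim (w :: L) = \sum_(q <- picks L) klim [:: w; q.1] * klim q.2.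
Proof.
elim/ltn_ind: {w}(size w) {-2}w (leqnn (size w)) L => n IH [|i w] /= wn L.
  by rewrite klim_word_nil big1 // => q _; rewrite klim_word_nil mul0r.
have IHw v : (size v < size (i :: w))%N -> forall L,
    klim (v :: L) = \sum_(q <- picks L) klim [:: v; q.1] * klim q.2.
  by move=> h L'; apply: (IH (size v)) => //; apply: leq_trans wn.
have R2 u : klim [:: i :: w; u] = lambda * klim [:: w; u] + \sum_(p <- splits i w)
    (mlim (i :: p.1) * klim [:: p.2; u] + mlim p.2 * klim [:: i :: p.1; u])
  + \sum_(g <- merges i w u) mlim g.
  rewrite klim_rec /= big_seq1 /=; congr (_ + _); apply: eq_bigr => g _.
  by rewrite klim_nil mulr1.
under [RHS]eq_bigr => q _ do rewrite R2 !mulrDl.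
rewrite klim_rec [RHS]big_split [X in _ = X + _]big_split /=; congr (_ + _ + _).
- rewrite IHw // mulr_sumr; apply: eq_bigr => q _; exact: mulrA.
- under [RHS]eq_bigr => q _ do rewrite mulr_suml.
  rewrite exchange_big /= big_seq [RHS]big_seq; apply: eq_bigr => -[u v] /size_splits /= ps.
  rewrite IHw; last by rewrite /= -ps; lia.
  rewrite IHw; last by rewrite /= -ps; lia.
  rewrite !mulr_sumr -big_split /=; apply: eq_bigr => q _; ring.
- by apply: eq_bigr => q _; rewrite mulr_suml.
Qed.

Section LinearCombination.
Variables (J : finType) (a : J -> R) (word : J -> seq S).

(** [mom K n L] expands the mean of Z^n times the centred traces of L, where Z is
    the combination of the centred traces of the words [word j] with weights a,
    in terms of the joint moments K. *)
Fixpoint mom (K : seq (seq S) -> R) n L : R :=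
  if n is n'.+1 then \sum_j a j * mom K n' (word j :: L) else K L.

Definition sigma2 : R := \sum_i \sum_j a i * a j * klim [:: word i; word j].

Lemma cvg_mom n L : (fun N => mom (k N) n L) @ \oo --> mom klim n L.
Proof.
elim: n L => [|n IH] L /=; first exact: cvg_k.
by apply: cvg_bigsum => j _; apply: cvgM; [exact: cvg_cst | exact: IH].
Qed.

Lemma mom_perm n L L' : perm_eq L L' -> mom klim n L = mom klim n L'.
Proof.
elim: n L L' => [|n IH] L L' LL' /=; first exact: klim_perm.
by apply: eq_bigr => j _; congr (_ * _); apply: IH; rewrite perm_cons.
Qed.

(** Wick's rule with n copies of Z among the remaining factors: w is paired with
    one of them or with an entry of L. *)
Lemma mom_wick n w L : mom klim n (w :: L) =
  n%:R * (\sum_j a j * klim [:: w; word j]) * mom klim n.-1 L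
  + \sum_(q <- picks L) klim [:: w; q.1] * mom klim n q.2.
Proof.
elim: n w L => [|n IH] w L; first by rewrite !mul0r add0r /= wick.
rewrite [LHS]/=.
have E j : mom klim n (word j :: w :: L) =
   n%:R * (\sum_j a j * klim [:: w; word j]) * mom klim n.-1 (word j :: L)
   + klim [:: w; word j] * mom klim n L
   + \sum_(q <- picks L) klim [:: w; q.1] * mom klim n (word j :: q.2).
  rewrite (@mom_perm _ _ [:: w, word j & L]); last first.
    exact: (permEl (perm_catCA [:: word j] [:: w] L)).
  by rewrite IH /= big_cons big_map /= addrA.
under eq_bigr => j _ do rewrite E !mulrDr.
rewrite !big_split /=; set c := \sum_j a j * klim [:: w; word j].
have -> : \sum_j a j * (n%:R * c * mom klim n.-1 (word j :: L)) =
   n%:R * c * mom klim n L.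
  case: n {IH E} => [|n]; first by rewrite big1 ?mul0r // => j _; rewrite !mul0r mulr0.
  by rewrite [in RHS]/= [RHS]mulr_sumr; apply: eq_bigr => j _; rewrite mulrCA.
have -> : \sum_j a j * (klim [:: w; word j] * mom klim n L) = c * mom klim n L.
  by rewrite /c [RHS]mulr_suml; apply: eq_bigr => j _; rewrite mulrA.
rewrite -[in RHS]natr1; congr (_ + _); first by ring.
under eq_bigr => j _ do rewrite mulr_sumr.
rewrite exchange_big /=; apply: eq_bigr => q _; rewrite mulr_sumr.
by apply: eq_bigr => j _; rewrite mulrCA.
Qed.

(** For one variable Wick's rule is the recursion of the Gaussian moments:
    E(Z^(n+2)) = (n + 1) sg^2 E(Z^n). *)
Lemma mom_gaussian sg n : sg ^+ 2 = sigma2 -> mom klim n [::] = sg ^+ n * gauss_moment R n.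
Proof.
move=> sgE.
have mSS l : mom klim l.+2 [::] = l.+1%:R * sg ^+ 2 * mom klim l [::].
  rewrite -[LHS]/(\sum_j a j * mom klim l.+1 [:: word j]).
  under eq_bigr => j _ do rewrite mom_wick big_nil addr0 /=.
  rewrite sgE /sigma2 mulr_sumr mulr_suml; apply: eq_bigr => i _.
  rewrite [in RHS](eq_bigr (fun j => a i * (a j * klim [:: word i; word j]))); last first.
    by move=> j _; rewrite mulrA.
  by rewrite -mulr_sumr; ring.
have H : mom klim n [::] = sg ^+ n * gauss_moment R n /\
         mom klim n.+1 [::] = sg ^+ n.+1 * gauss_moment R n.+1.
  elim: n => [|n [IH1 IH2]].
    split; first by rewrite /= klim_nil mulr1.
    by rewrite gauss_moment1 mulr0 /= big1 // => j _; rewrite klim1 mulr0.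
  by split=> //; rewrite mSS IH1 gauss_momentSS -[n.+2]addn2 exprD; ring.
by case: H.
Qed.

Lemma mom2 : mom klim 2 [::] = sigma2.
Proof.
rewrite /= /sigma2 exchange_big; apply: eq_bigr => i _ /=.
by rewrite mulr_sumr; apply: eq_bigr => j _; ring.
Qed.

End LinearCombination.
End WickLimit.

(** * The formal Gaussian expectation on polynomials *)
Section GaussianFunctional.
Variables (R : realType) (n : nat).
Implicit Types (p q : mpoly n R) (m : multinom n) (Q : pred 'I_n).

Definition gauss_monomial m : R := \prod_(i < n) gauss_moment R (m i).
(** The expectation of p when its variables are independent standard normal,
    defined by linearity on monomials. *)
Definition gauss p : R := \sum_(m <- msupp p) mcoeff m p * gauss_monomial m.

(** Linearity is proved on a common list of monomials, beyond the support of each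
    polynomial. *)
Lemma gauss_sup (r : seq (multinom n)) p : uniq r -> {subset msupp p <= r} ->
  \sum_(m <- r) mcoeff m p * gauss_monomial m = gauss p.
Proof.
move=> ur pr; rewrite (bigID (mem (msupp p))) /= [X in _ + X]big1 ?addr0.
  rewrite -big_filter; apply: perm_big; apply: uniq_perm.
  - exact: filter_uniq.
  - exact: msupp_uniq.
  by move=> m; rewrite mem_filter; apply/andP/idP => [[]//|mp]; rewrite mp pr.
by move=> m /memN_msupp_eq0 ->; rewrite mul0r.
Qed.

Lemma gaussD p q : gauss (p + q) = gauss p + gauss q.
Proof.
set r := undup (msupp p ++ msupp q ++ msupp (p + q)).
have ur : uniq r by exact: undup_uniq.
rewrite -!(@gauss_sup r) //.
- by rewrite -big_split /=; apply: eq_bigr => m _; rewrite mcoeffD mulrDl.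
- by move=> m mp; rewrite mem_undup !mem_cat mp !orbT.
- by move=> m mp; rewrite mem_undup !mem_cat mp.
- by move=> m mp; rewrite mem_undup !mem_cat mp !orbT.
Qed.

Lemma gaussZ c p : gauss (c *: p) = c * gauss p.
Proof.
set r := undup (msupp p ++ msupp (c *: p)).
have ur : uniq r by exact: undup_uniq.
rewrite -!(@gauss_sup r) //.
- by rewrite mulr_sumr; apply: eq_bigr => m _; rewrite mcoeffZ mulrA.
- by move=> m mp; rewrite mem_undup !mem_cat mp.
- by move=> m mp; rewrite mem_undup !mem_cat mp !orbT.
Qed.

Lemma gauss0 : gauss 0 = 0.
Proof. by rewrite -(scale0r 0) gaussZ mul0r. Qed.

Lemma gauss_sum (I : Type) (r : seq I) (F : I -> mpoly n R) :
  gauss (\sum_(i <- r) F i) = \sum_(i <- r) gauss (F i).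
Proof.
by elim: r => [|x r IH]; rewrite ?big_nil ?gauss0 // !big_cons gaussD IH.
Qed.

Lemma gaussX m : gauss (mpolyX R m) = gauss_monomial m.
Proof. by rewrite /gauss msuppX big_seq1 mcoeffX eqxx mul1r. Qed.

Lemma gauss1 : gauss 1 = 1.
Proof. by rewrite -mpolyX0 gaussX /gauss_monomial big1 // => i _; rewrite mnm0E. Qed.

(** On monomials this is the recursion of the moments of one variable,
    E(g^(l+1)) = l E(g^(l-1)). *)
Lemma gauss_ibp i p : gauss (mpolyX R (mnm1 i) * p) = gauss (mderiv i p).
Proof.
rewrite [in LHS](mpolyE p) [in RHS](mpolyE p) mulr_sumr.
rewrite [X in gauss X = _](eq_bigr (fun m => mcoeff m p *: mpolyX R (mnm_add (mnm1 i) m))); last first.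
  by move=> m _; rewrite -scalerAr mpolyXD.
rewrite raddf_sum /= !gauss_sum; apply: eq_bigr => m _.
rewrite mderivZ !gaussZ mderivX gaussZ !gaussX; congr (_ * _).
rewrite /gauss_monomial (bigD1 i) //= [in RHS](bigD1 i) //= mulrA.
rewrite [X in _ * X = _](eq_bigr (fun j => gauss_moment R (mnm_sub m (mnm1 i) j))); last first.
  move=> j ji; rewrite mnmDE mnmBE !mnm1E eq_sym (negbTE ji).
  by rewrite add0n subn0.
congr (_ * _); rewrite mnmDE mnmBE mnm1E eqxx add1n subn1.
by case: (m i) => [|l]; rewrite ?gauss_moment1 ?mul0r // gauss_momentSS.
Qed.

(** The formal counterpart of measurability with respect to some of the variables:
    polynomials in disjoint groups of variables are independent ([gauss_prod]). *)
Definition in_vars Q p := forall m, m \in msupp p -> forall i, ~~ Q i -> m i = 0%N.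

Lemma in_vars_X Q i : Q i -> in_vars Q (mpolyX R (mnm1 i)).
Proof.
move=> Qi m; rewrite msuppX inE => /eqP -> j Qj; rewrite mnm1E.
by case: eqP Qj => // <-; rewrite Qi.
Qed.

Lemma in_varsD Q p q : in_vars Q p -> in_vars Q q -> in_vars Q (p + q).
Proof.
by move=> Qp Qq m /msuppD_le; rewrite mem_cat => /orP[/Qp|/Qq].
Qed.

Lemma in_varsZ Q c p : in_vars Q p -> in_vars Q (c *: p).
Proof. by move=> Qp m /msuppZ_le /Qp. Qed.

Lemma in_varsM Q p q : in_vars Q p -> in_vars Q q -> in_vars Q (p * q).
Proof.
move=> Qp Qq m /msuppM_le /allpairsP[[m1 m2] /= [/Qp h1 /Qq h2 ->]] i Qi.
by rewrite mnmDE h1 // h2.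
Qed.

Lemma in_vars1 Q : in_vars Q 1.
Proof. by move=> m; rewrite -mpolyX0 msuppX inE => /eqP -> i _; rewrite mnm0E. Qed.

Lemma in_vars0 Q : in_vars Q 0.
Proof. by move=> m; rewrite msupp0. Qed.

Lemma in_vars_sum Q (I : Type) (r : seq I) (F : I -> mpoly n R) :
  (forall i, in_vars Q (F i)) -> in_vars Q (\sum_(i <- r) F i).
Proof.
by move=> QF; elim/big_ind: _ => // [|x y]; [exact: in_vars0 | exact: in_varsD].
Qed.

Lemma in_vars_prod Q (I : Type) (r : seq I) (P : pred I) (F : I -> mpoly n R) :
  (forall i, P i -> in_vars Q (F i)) -> in_vars Q (\prod_(i <- r | P i) F i).
Proof.
by move=> QF; elim/big_ind: _ => // [|x y]; [exact: in_vars1 | exact: in_varsM].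
Qed.

Lemma in_vars_sub Q Q' p : (forall i, Q i -> Q' i) -> in_vars Q p -> in_vars Q' p.
Proof. by move=> QQ Qp m /Qp h i Qi; apply: h; apply: contra Qi; exact: QQ. Qed.

Lemma gaussM Q Q' p q : (forall i, ~~ (Q i && Q' i)) ->
  in_vars Q p -> in_vars Q' q -> gauss (p * q) = gauss p * gauss q.
Proof.
move=> QQ Qp Qq; rewrite [in LHS](mpolyE p) [in LHS](mpolyE q) mulr_suml gauss_sum.
rewrite [gauss p]/gauss mulr_suml big_seq [RHS]big_seq; apply: eq_bigr => m1 /Qp h1.
rewrite mulr_sumr gauss_sum /gauss mulr_sumr big_seq [RHS]big_seq.
apply: eq_bigr => m2 /Qq h2.
rewrite -scalerAl -scalerAr -mpolyXD -!/(gauss _) !gaussZ gaussX mulrACA mulrA; congr (_ * _).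
rewrite /gauss_monomial -big_split /=; apply: eq_bigr => i _; rewrite mnmDE.
have := QQ i; rewrite negb_and => /orP[/h1|/h2] ->; first by rewrite add0n gauss_moment0 mul1r.
by rewrite addn0 gauss_moment0 mulr1.
Qed.

Lemma gauss_prod (I : eqType) (r : seq I) (Q : I -> pred 'I_n) (F : I -> mpoly n R) :
  uniq r -> (forall i j k, i != j -> ~~ (Q i k && Q j k)) ->
  (forall i, in_vars (Q i) (F i)) ->
  gauss (\prod_(i <- r) F i) = \prod_(i <- r) gauss (F i).
Proof.
move=> ur QQ QF; elim: r ur => [|x r IH] /=; first by rewrite !big_nil gauss1.
move=> /andP[xr ur]; rewrite !big_cons -IH //.
apply: (@gaussM (Q x) (fun k => has (fun j => Q j k) r)) => // [k|].
  apply/negP => /andP[Qx /hasP[j jr Qj]].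
  have xj : x != j by apply: contraNneq xr => ->.
  by have := QQ x j k xj; rewrite Qx Qj.
rewrite big_seq; apply: in_vars_prod => j jr; apply: in_vars_sub (QF j) => k Qk.
by apply/hasP; exists j.
Qed.

End GaussianFunctional.

Section FormalWishart.
Variables (R : realType) (s M N : nat) (B : 'I_s -> 'M[R]_N) (nu : R).
Hypothesis BB : forall i, (B i)^T *m B i = nu%:M.

Definition var_index : predArgType := ('I_s * ('I_M * 'I_N))%type.
Notation nv := #|{: var_index}|.
Notation A := (mpoly nv R).

Definition formal_X i a c : A := mpolyX R (mnm1 (enum_rank ((i, (a, c)) : var_index))).
(** The entries of Y_i = X_i B_i for formal matrices X_i, and the derivation that
    belongs to them.  When B_i^T B_i = nu I the covariance of the entries of Y_i is
    nu times the identity ([formal_DY]), so the factor B_i drops out of the loop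
    equations. *)
Definition formal_Y i : 'M[A]_(M, N) := \matrix_(a, b) \sum_c B i c b *: formal_X i a c.
Definition formal_D i a b (x : A) : A :=
  \sum_c B i c b *: mderiv (enum_rank ((i, (a, c)) : var_index)) x.

Lemma formal_DD i a b x y : formal_D i a b (x + y) = formal_D i a b x + formal_D i a b y.
Proof.
rewrite /formal_D -big_split /=; apply: eq_bigr => c _.
by rewrite mderivD scalerDr.
Qed.

Lemma formal_DZ i a b k x : formal_D i a b (k *: x) = k *: formal_D i a b x.
Proof.
rewrite /formal_D scaler_sumr; apply: eq_bigr => c _.
by rewrite mderivZ !scalerA mulrC.
Qed.

Lemma formal_DM i a b x y : formal_D i a b (x * y) = formal_D i a b x * y + x * formal_D i a b y.
Proof.
rewrite /formal_D mulr_suml mulr_sumr -big_split /=; apply: eq_bigr => c _.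
by rewrite mderivM scalerDr scalerAl scalerAr.
Qed.

Lemma mderiv_formal_X i a c j e f :
  mderiv (enum_rank ((i, (a, c)) : var_index)) (formal_X j e f) =
  ((i == j) && (a == e) && (c == f))%:R.
Proof.
rewrite /formal_X mderivX mnm1E (inj_eq enum_rank_inj) -pair_eqE /= -pair_eqE /=.
rewrite (eq_sym j) (eq_sym e) (eq_sym f) andbA.
case: andP => [[/andP[/eqP <- /eqP <-] /eqP <-]|_]; last by rewrite scale0r.
rewrite scale1r -mpolyX0; congr mpolyX; apply/mnmP => l.
by rewrite mnmBE subnn mnm0E.
Qed.

Lemma formal_DY i a b j c d :
  formal_D i a b (formal_Y j c d) = (nu *+ [&& i == j, a == c & b == d])%:A.
Proof.
have E c' : mderiv (enum_rank ((i, (a, c')) : var_index)) (formal_Y j c d) =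
    ((i == j) && (a == c))%:R *: (B j c' d)%:A.
  rewrite mxE raddf_sum /= (bigD1 c') //= big1 ?addr0.
    rewrite mderivZ mderiv_formal_X eqxx andbT; case: (_ && _).
      by rewrite scale1r mulr1n.
    by rewrite mulr0n scaler0 scale0r.
  move=> f fc; rewrite mderivZ mderiv_formal_X (eq_sym c') (negbTE fc) andbF.
  by rewrite mulr0n scaler0.
rewrite /formal_D; under eq_bigr do rewrite E.
have [ij|_] := eqVneq i j; last first.
  by rewrite /= mulr0n scale0r big1 // => e _; rewrite !scale0r scaler0.
have [ac|_] /= := eqVneq a c; last first.
  by rewrite mulr0n scale0r big1 // => e _; rewrite !scale0r scaler0.
have := congr1 (fun C : 'M[R]_N => C b d) (BB i); rewrite !mxE => <-.
rewrite scaler_suml; apply: eq_bigr => e _.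
by rewrite scale1r scalerA mxE ij.
Qed.

Lemma gauss_formal_Y i a b x : gauss (formal_Y i a b * x) = gauss (formal_D i a b x).
Proof.
rewrite mxE mulr_suml !gauss_sum; apply: eq_bigr => c _.
by rewrite -scalerAl !gaussZ gauss_ibp.
Qed.

Definition group i : pred 'I_nv := fun l => (enum_val l).1 == i.

Lemma in_vars_formal_Y i a b : in_vars (group i) (formal_Y i a b).
Proof.
rewrite mxE; apply: in_vars_sum => c; apply: in_varsZ; apply: in_vars_X.
by rewrite /group enum_rankK.
Qed.

Lemma in_vars_gram i c d : in_vars (group i) (gram formal_Y i c d).
Proof.
rewrite mxE; apply: in_vars_sum => a; rewrite [_^T _ _]mxE.
by apply: in_varsM; exact: in_vars_formal_Y.
Qed.

Lemma group_disjoint i j l : i != j -> ~~ (group i l && group j l).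
Proof.
by move=> ij; apply/negP => /andP[/eqP h1 /eqP h2]; move/eqP: ij; rewrite -h1 -h2.
Qed.

End FormalWishart.

(** * Wishart matrices and the formal expectation *)
Section Transfer.
Variable R : realType.

Lemma transfer_mean de (E : measurableType de)
    d1 (T1 : measurableType d1) (P1 : probability T1 R) (V1 : T1 -> E)
    d2 (T2 : measurableType d2) (P2 : probability T2 R) (V2 : T2 -> E) (f : E -> R) :
  measurable_fun setT V1 -> measurable_fun setT V2 -> measurable_fun setT f ->
  (forall B, measurable B -> P1 (V1 @^-1` B) = P2 (V2 @^-1` B)) ->
  intg P2 (f \o V2) ->
  intg P1 (f \o V1) /\ mean P1 (f \o V1) = mean P2 (f \o V2).
Proof.
move=> mV1 mV2 mf H i2.
have T (h : E -> R) : measurable_fun setT h -> (forall x, 0 <= h x) ->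
    (\int[P1]_w (h (V1 w))%:E = \int[P2]_w (h (V2 w))%:E)%E.
  move=> mh h0.
  have := @weighted_integral_ext R _ E _ T1 P1 _ T2 P2 V1 V2 (fun=> 1) (fun=> 1).
  move=> /(_ mV1 mV2 (measurable_cst _) (measurable_cst _) (fun=> ler01) (fun=> ler01)) W.
  have /W : forall B, measurable B -> (\int[P1]_w (1 * (\1_B (V1 w) : R))%:E =
       \int[P2]_w (1 * (\1_B (V2 w) : R))%:E)%E.
    move=> B mB; under eq_integral do rewrite mul1r.
    under [RHS]eq_integral do rewrite mul1r.
    have m1 : measurable (V1 @^-1` B) by rewrite -[X in measurable X]setTI; exact: mV1.
    have m2 : measurable (V2 @^-1` B) by rewrite -[X in measurable X]setTI; exact: mV2.
    have e1 := integral_indic P1 measurableT m1.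
    have e2 := integral_indic P2 measurableT m2.
    move: e1 e2; rewrite !setIT => e1 e2.
    exact: (etrans e1 (etrans (H B mB) (esym e2))).
  move=> /(_ h mh h0); under eq_integral do rewrite mul1r.
  by under [RHS]eq_integral do rewrite mul1r.
have mabs : measurable_fun setT (fun x => `|f x|) by exact: measurableT_comp.
have e1 := T _ mabs (fun x => normr_ge0 _).
have i1 : intg P1 (f \o V1).
  apply/integrableP; split.
    by apply/measurable_EFinP; exact: measurableT_comp.
  rewrite (eq_integral (fun w => (`|f (V1 w)|)%:E)) // e1.
  by move/integrableP : i2 => [_].
split=> //.
have ia1 : intg P1 (fun w => `|f (V1 w)|) by have := integrable_norm i1.
have ia2 : intg P2 (fun w => `|f (V2 w)|) by have := integrable_norm i2.
have h1 : mean P1 (fun w => `|f (V1 w)|) = mean P2 (fun w => `|f (V2 w)|).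
  by rewrite !meanE /Rintegral e1.
have h2 : mean P1 (fun w => `|f (V1 w)| + f (V1 w)) = mean P2 (fun w => `|f (V2 w)| + f (V2 w)).
  rewrite !meanE /Rintegral (T (fun x => `|f x| + f x)) // => [|x].
    exact: measurable_funD.
  by rewrite -lerBlDr sub0r -normrN ler_norm.
have h3 := meanD ia1 i1; have h4 := meanD ia2 i2.
by move: h3; rewrite /= h2 h4 h1 => /addrI /esym.
Qed.

Lemma std_normal_moments d (T : measurableType d) (P : probability T R) (V : T -> R) n :
  measurable_fun setT V ->
  (forall B, measurable B -> P (V @^-1` B) = normal_prob 0 1 B) ->
  intg P (fun w => V w ^+ n) /\ mean P (fun w => V w ^+ n) = gauss_moment R n.
Proof.
move=> mV H; have [i e] := @normal_moments R 1 (oner_neq0 _) n.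
have [h1 h2] := @transfer_mean _ R _ _ P V _ _ (normal_prob 0 1) id (fun x => x ^+ n)
  mV (@measurable_id _ _ _) (@exprn_measurable _ _ n) H i.
by split=> //; rewrite h2 e expr1n mul1r.
Qed.
End Transfer.

Section Link.
Context (R : realType) d (T : measurableType d) (P : probability T R).
Context (s M N : nat) (X : 'I_s -> T -> 'M[R]_(M, N)) (B : 'I_s -> 'M[R]_N).
Context (Wm : 'I_s -> T -> 'M[R]_N).
Hypothesis gX : forall i, std_gaussian_mx P (X i).
Hypothesis WE : forall i w,
  Wm i w = (B i)^T *m (X i w)^T *m 1%:M *m X i w *m B i.
Hypothesis indW : mutually_independent P (Wm : 'I_s -> T -> mxBorel R N N).

Notation nv := #|{: var_index s M N}|.
Notation A := (mpoly nv R).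

Definition eval_entries (w : T) (f : A) : R :=
  meval (fun l => let p := enum_val l : var_index s M N in X p.1 w p.2.1 p.2.2) f.

Lemma prod_var_index (H : 'I_nv -> R) : \prod_l H l =
  \prod_(j < s) \prod_(ac : 'I_M * 'I_N) H (enum_rank ((j, ac) : var_index s M N)).
Proof.
rewrite (reindex (fun p : var_index s M N => enum_rank p)); last first.
  by apply: onW_bij; exact: enum_rank_bij.
by rewrite [RHS]pair_bigA /=; apply: eq_bigr => -[].
Qed.

(** The entries of a single X_i are independent, so means of polynomials in them
    are given by the formal expectation.  Several i cannot be mixed here, since
    nothing is known of the joint law of the X_i. *)
Lemma mean_eval_group i f : in_vars (@group s M N i) f ->
  intg P (fun w => eval_entries w f) /\ mean P (fun w => eval_entries w f) = gauss f.
Proof.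
move=> fi; have [mX lX indX] := gX i.
have evE w : eval_entries w f = \sum_(m <- msupp f)
    mcoeff m f * \prod_(ac : 'I_M * 'I_N) X i w ac.1 ac.2 ^+ m (enum_rank ((i, ac) : var_index s M N)).
  rewrite /eval_entries mevalE big_seq [RHS]big_seq; apply: eq_bigr => m /fi mi; congr (_ * _).
  rewrite prod_var_index (bigD1 i) //= [X in _ * X]big1 ?mulr1.
    by apply: eq_bigr => ac _; rewrite enum_rankK.
  move=> j ji; rewrite big1 // => ac _.
  by rewrite mi ?expr0 // /group enum_rankK.
have gE m : m \in msupp f -> gauss_monomial R m =
    \prod_(ac : 'I_M * 'I_N) gauss_moment R (m (enum_rank ((i, ac) : var_index s M N))).
  move=> /fi mi; rewrite /gauss_monomial prod_var_index.
  rewrite (bigD1 i) //= [X in _ * X]big1 ?mulr1 // => j ji.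
  by rewrite big1 // => ac _; rewrite mi // /group enum_rankK.
have H (m : multinom nv) : intg P (fun w => \prod_(ac : 'I_M * 'I_N)
    X i w ac.1 ac.2 ^+ m (enum_rank ((i, ac) : var_index s M N))) /\
  mean P (fun w => \prod_(ac : 'I_M * 'I_N)
    X i w ac.1 ac.2 ^+ m (enum_rank ((i, ac) : var_index s M N))) =
  \prod_(ac : 'I_M * 'I_N) gauss_moment R (m (enum_rank ((i, ac) : var_index s M N))).
  have sn (ac : 'I_M * 'I_N) := @std_normal_moments R _ T P (fun w => X i w ac.1 ac.2)
    (m (enum_rank ((i, ac) : var_index s M N))) (mX ac.1 ac.2) (lX ac.1 ac.2).
  have [h1 h2] := @mean_prod_indep R _ T P _ _ _
    (fun (ac : 'I_M * 'I_N) w => X i w ac.1 ac.2) (fun ac => mX ac.1 ac.2) indX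
    (fun ac x => x ^+ m (enum_rank ((i, ac) : var_index s M N)))
    (fun ac => @exprn_measurable _ _ _) (fun ac => proj1 (sn ac)).
  split=> //; rewrite h2; apply: eq_bigr => ac _; exact: (proj2 (sn ac)).
have -> : (fun w => eval_entries w f) = (fun w => \sum_(m <- msupp f)
    mcoeff m f * \prod_(ac : 'I_M * 'I_N) X i w ac.1 ac.2 ^+ m (enum_rank ((i, ac) : var_index s M N))).
  by apply/funext.
have iH (m : multinom nv) := intgZ (mcoeff m f) (proj1 (H m)).
split; first exact: intg_sum.
rewrite mean_sum // /gauss big_seq [RHS]big_seq; apply: eq_bigr => m mf.
by rewrite meanZ; [rewrite (proj2 (H m)) gE | exact: (proj1 (H m))].
Qed.

Lemma eval_formal_Y i w a b : eval_entries w (formal_Y M B i a b) = (X i w *m B i) a b.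
Proof.
rewrite /eval_entries !mxE raddf_sum; apply: eq_bigr => c _.
by rewrite /= mevalZ mevalXU enum_rankK mulrC.
Qed.

Lemma eval_gram i w c e : eval_entries w (gram (formal_Y M B) i c e) = Wm i w c e.
Proof.
rewrite WE mulmx1 -!mulmxA mulmxA -trmx_mul /eval_entries [in RHS]mxE [in LHS]mxE raddf_sum.
apply: eq_bigr => a _; rewrite /= mevalM -!/(eval_entries _ _) [(_^T) _ _ in LHS]mxE.
by rewrite [(_^T) _ _ in RHS]mxE !eval_formal_Y.
Qed.

Lemma measurable_Wm i : measurable_fun setT (Wm i : T -> mxBorel R N N).
Proof.
apply: measurable_mxBorel => c e; under eq_fun do rewrite -eval_gram.
apply: (@intg_measurable _ _ _ P).
exact: (proj1 (mean_eval_group (@in_vars_gram _ _ M _ B i c e))).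
Qed.

Implicit Types (l : seq ('I_s * ('I_N * 'I_N))).

(** Grouping the factors by matrix, the mean factors by independence of the W_i
    and the formal expectation by disjointness of the variables; the groups are
    compared by [mean_eval_group]. *)
Lemma mean_monomial_wishart l :
  intg P (fun w => \prod_(q <- l) Wm q.1 w q.2.1 q.2.2) /\
  mean P (fun w => \prod_(q <- l) Wm q.1 w q.2.1 q.2.2) =
  gauss (\prod_(q <- l) gram (formal_Y M B) q.1 q.2.1 q.2.2).
Proof.
pose h i (U : mxBorel R N N) : R := \prod_(q <- l | q.1 == i) (U : 'M[R]_N) q.2.1 q.2.2.
pose F i : A := \prod_(q <- l | q.1 == i) gram (formal_Y M B) q.1 q.2.1 q.2.2.
have FG i : in_vars (@group s M N i) (F i).
  by apply: in_vars_prod => q /eqP <-; exact: in_vars_gram.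
have hF i w : (h i \o Wm i) w = eval_entries w (F i).
  rewrite /= /h /F /eval_entries rmorph_prod /=; apply: eq_bigr => q /eqP <-.
  by rewrite -/(eval_entries _ _) eval_gram.
have mh i : measurable_fun setT (h i).
  rewrite /h; under eq_fun do rewrite big_mkcond.
  apply: measurable_prod => q _; case: (q.1 == i) => //.
  by apply: continuous_mxBorel_measurable; exact: coord_continuous.
have LG i := mean_eval_group (FG i).
have ih i : intg P (h i \o Wm i).
  have -> : h i \o Wm i = (fun w => eval_entries w (F i)) by apply/funext => w; exact: hF.
  by have [] := LG i.
have [h1 h2] := mean_prod_indep measurable_Wm indW mh ih.
have E : (fun w => \prod_(q <- l) Wm q.1 w q.2.1 q.2.2) = (fun w => \prod_i h i (Wm i w)).
  apply/funext => w; rewrite (partition_big (fun q => q.1) xpredT) //=.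
  by apply: eq_bigr => i _; apply: eq_bigr => q /eqP ->.
rewrite E; split=> //; rewrite h2.
rewrite [in RHS](partition_big (fun q => q.1) xpredT) //= -/F.
rewrite (@gauss_prod _ _ _ _ (@group s M N)) //; first last.
  - by move=> i j k; exact: group_disjoint.
  - exact: index_enum_uniq.
apply: eq_bigr => i _; have [_ <-] := LG i; congr (mean P _).
by apply/funext => w; exact: hF.
Qed.

(** A random variable and a formal polynomial given by the same polynomial
    expression in the entries of the W_i.  As the X_i may be dependent, means
    agree with the formal expectation for such expressions only and not for all
    polynomials in the X_i. *)
Inductive linked : (T -> R) -> A -> Prop :=
| linked_mono l : linked (fun w => \prod_(q <- l) Wm q.1 w q.2.1 q.2.2)
    (\prod_(q <- l) gram (formal_Y M B) q.1 q.2.1 q.2.2)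
| linkedD F G f g : linked F f -> linked G g ->
    linked (fun w => F w + G w) (f + g)
| linkedZ c F f : linked F f -> linked (fun w => c * F w) (c *: f).

Lemma linked_mean F f : linked F f -> intg P F /\ mean P F = gauss f.
Proof.
elim=> {F f} [l|F G f g _ [iF eF] _ [iG eG]|c F f _ [iF eF]].
- exact: mean_monomial_wishart.
- by split; [exact: intgD | rewrite meanD // gaussD eF eG].
- by split; [exact: intgZ | rewrite meanZ // gaussZ eF].
Qed.

Lemma linkedM F G f g : linked F f -> linked G g -> linked (fun w => F w * G w) (f * g).
Proof.
move=> lF lG; elim: lF => {F f} [l|F1 F2 f1 f2 _ IH1 _ IH2|c F f _ IH].
- elim: lG => {G g} [l'|G1 G2 g1 g2 _ IH1 _ IH2|c G g _ IH].
  + rewrite -big_cat; under eq_fun do rewrite -big_cat; exact: linked_mono.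
  + by rewrite mulrDr; under eq_fun do rewrite mulrDr; exact: linkedD.
  + by rewrite -scalerAr; under eq_fun do rewrite mulrCA; exact: linkedZ.
- by rewrite mulrDl; under eq_fun do rewrite mulrDl; exact: linkedD.
- by rewrite -scalerAl; under eq_fun do rewrite -mulrA; exact: linkedZ.
Qed.

Lemma linked_cst c : linked (fun=> c) c%:A.
Proof.
have := linkedZ c (linked_mono [::]); rewrite big_nil.
by under eq_fun do rewrite big_nil mulr1.
Qed.

Lemma linked_sum (I : Type) (r : seq I) (F : I -> T -> R) (f : I -> A) :
  (forall i, linked (F i) (f i)) ->
  linked (fun w => \sum_(i <- r) F i w) (\sum_(i <- r) f i).
Proof.
move=> Ff; elim: r => [|x r IH].
  rewrite big_nil; under eq_fun do rewrite big_nil.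
  by have := linked_cst 0; rewrite scale0r.
by rewrite big_cons; under eq_fun do rewrite big_cons; exact: linkedD.
Qed.

Definition wishart_word (w : seq 'I_s) (om : T) : 'M[R]_N := \prod_(i <- w) Wm i om.
Definition tr_wishart_word (w : seq 'I_s) (om : T) : R := \tr (wishart_word w om).

Lemma linked_wishart_word w c e : linked (fun om => wishart_word w om c e) (gram_word (formal_Y M B) w c e).
Proof.
elim: w c e => [|i w IH] c e.
  rewrite /wishart_word; under eq_fun do rewrite big_nil mxE.
  have := linked_cst ((c == e)%:R); rewrite /= mxE; congr linked.
  by rewrite scaler_nat.
rewrite /wishart_word; under eq_fun do rewrite big_cons mxE.
rewrite /= mxE; apply: linked_sum => j; apply: linkedM; last exact: IH.
have := linked_mono [:: (i, (c, j))]; rewrite big_seq1.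
by under eq_fun do rewrite big_seq1.
Qed.

Lemma linked_tr_wishart_word w : linked (tr_wishart_word w) (tr_word (formal_Y M B) w).
Proof. by apply: linked_sum => j; exact: linked_wishart_word. Qed.

Definition ctr_wishart_word w om : R := tr_wishart_word w om - mean P (tr_wishart_word w).
Definition mean_ntr (nu : R) w : R := nu * mean P (tr_wishart_word w).
Definition mean_cprod (L : seq (seq 'I_s)) : R := mean P (fun om => \prod_(w <- L) ctr_wishart_word w om).

Lemma linked_ctr_wishart_word w : linked (ctr_wishart_word w) (ctr_word (formal_Y M B) (@gauss R nv) w).
Proof.
have [_ e] := linked_mean (linked_tr_wishart_word w).
rewrite /ctr_word -e -scaleNr; apply: linkedD; first exact: linked_tr_wishart_word.
exact: linked_cst.
Qed.

Lemma linked_cprod L : linked (fun om => \prod_(w <- L) ctr_wishart_word w om)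
  (cprod (formal_Y M B) (@gauss R nv) L).
Proof.
elim: L => [|w L IH]; rewrite /cprod.
  by rewrite big_nil; under eq_fun do rewrite big_nil; have := linked_cst 1; rewrite scale1r.
rewrite big_cons; under eq_fun do rewrite big_cons.
by apply: linkedM => //; exact: linked_ctr_wishart_word.
Qed.

Lemma mean_ntrE nu w : mean_ntr nu w = phi_ntr (formal_Y M B) (@gauss R nv) nu w.
Proof. by rewrite /mean_ntr /phi_ntr; have [_ ->] := linked_mean (linked_tr_wishart_word w). Qed.

Lemma mean_cprodE L : mean_cprod L = phi_cprod (formal_Y M B) (@gauss R nv) L.
Proof. by rewrite /mean_cprod /phi_cprod; have [_ ->] := linked_mean (linked_cprod L). Qed.

Section LinearForm.
Variables (J : finType) (a : J -> R) (word : J -> seq 'I_s).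
Let Z om : R := \sum_j a j * ctr_wishart_word (word j) om.

Lemma linked_Z : exists f, linked Z f.
Proof.
eexists; apply: linked_sum => j; apply: linkedZ; exact: linked_ctr_wishart_word.
Qed.

Lemma intg_Z_cprod n L : intg P (fun om => Z om ^+ n * \prod_(w <- L) ctr_wishart_word w om).
Proof.
have [z lZ] := linked_Z.
have lP : linked (fun om => Z om ^+ n * \prod_(w <- L) ctr_wishart_word w om)
    (z ^+ n * cprod (formal_Y M B) (@gauss R nv) L).
  apply: linkedM; last exact: linked_cprod.
  elim: n => [|n IH].
    by under eq_fun do rewrite expr0; have := linked_cst 1; rewrite expr0 scale1r.
  by rewrite exprS; under eq_fun do rewrite exprS; exact: linkedM.
by have [] := linked_mean lP.
Qed.

(** One factor Z at a time is expanded into centred traces, which is the recursion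
    that defines [mom]. *)
Lemma mean_Z_cprod n L :
  mean P (fun om => Z om ^+ n * \prod_(w <- L) ctr_wishart_word w om) = mom a word mean_cprod n L.
Proof.
elim: n L => [|n IH] L.
  by under eq_fun do rewrite expr0 mul1r.
rewrite /= -(eq_bigr _ (fun j _ => congr1 ( *%R (a j)) (IH (word j :: L)))).
rewrite -(eq_bigr _ (fun j _ => meanZ (a j) (intg_Z_cprod n (word j :: L)))).
rewrite -mean_sum; last by move=> j; apply: intgZ; exact: intg_Z_cprod.
congr (mean P _); apply/funext => om.
rewrite exprSr -mulrA {2}/Z mulr_suml mulr_sumr; apply: eq_bigr => j _.
by rewrite big_cons; ring.
Qed.
End LinearForm.

End Link.

(** * Realizing the limit covariance *)
Section Cholesky.
Variable R : realType.

Definition quad n (C : 'M[R]_n) (x : 'cV[R]_n) : R := (x^T *m C *m x) 0 0.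

Lemma quad_block n (c : 'M[R]_1) (v : 'rV[R]_n) (D : 'M[R]_n) (x : 'M[R]_1) (y : 'cV[R]_n) :
  quad (block_mx c v v^T D : 'M[R]_(1 + n)) (col_mx x y) =
  c 0 0 * x 0 0 ^+ 2 + 2 * x 0 0 * (v *m y) 0 0 + quad D y.
Proof.
rewrite /quad tr_col_mx mul_row_block mul_row_col !mulmxDl.
have e1 (p q : 'M[R]_1) : (p *m q) 0 0 = p 0 0 * q 0 0 by rewrite mxE big_ord1.
have e2 : (y^T *m v^T *m x) 0 0 = (v *m y) 0 0 * x 0 0.
  by rewrite -trmx_mul e1 mxE.
have e3 : (x^T *m v *m y) 0 0 = x 0 0 * (v *m y) 0 0.
  by rewrite -mulmxA e1 mxE.
have e0 (p q : 'M[R]_1) : (p + q) 0 0 = p 0 0 + q 0 0 by rewrite mxE.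
rewrite !e0 e2 e3 !e1 [x^T 0 0]mxE; ring.
Qed.

(** Cholesky factorization.  If the corner entry c vanishes, so does its row, since
    otherwise the form would be negative at some vector of the plane; if c is
    positive, completing the square leaves the Schur complement, which is again
    positive semidefinite. *)
Lemma psd_factor n (C : 'M[R]_n) : C^T = C -> (forall x, 0 <= quad C x) ->
  exists L : 'M[R]_n, C = L^T *m L.
Proof.
elim: n C => [|n IH] C symC psdC.
  by exists 0; apply/matrixP => -[].
pose C' : 'M[R]_(1 + n) := C.
pose c := ulsubmx C'; pose v := ursubmx C'; pose D := drsubmx C'.
have CE : C' = block_mx c v v^T D.
  have -> : v^T = dlsubmx C' by rewrite /v trmx_ursub [C'^T]symC.
  by rewrite submxK.
have symD : D^T = D by rewrite /D trmx_drsub [C'^T]symC.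
have q x y : 0 <= c 0 0 * x ^+ 2 + 2 * x * (v *m y) 0 0 + quad D y.
  have := psdC (col_mx x%:M y); rewrite -[C]/C' CE quad_block.
  by rewrite [x%:M 0 0]mxE eqxx mulr1n.
have q0 : quad D 0 = 0 by rewrite /quad mulmx0 mxE.
have c0 : 0 <= c 0 0.
  have z0 : (v *m (0 : 'cV[R]_n)) 0 0 = 0 by rewrite mulmx0 mxE.
  by have := q 1 0; rewrite q0 z0 mulr0 !addr0 expr1n mulr1.
have c11 : c = (c 0 0)%:M by rewrite [LHS]mx11_scalar.
suff [L LE] : exists L : 'M[R]_(1 + n), C' = L^T *m L by exists L.
have [cz|cnz] := eqVneq (c 0 0) 0.
  have v0 : v = 0.
    apply/rowP => j; rewrite [RHS]mxE.
    pose e : 'cV[R]_n := delta_mx j 0.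
    have ve : (v *m e) 0 0 = v 0 j by rewrite -colE mxE.
    have h x : 0 <= 2 * x * v 0 j + quad D e.
      by have := q x e; rewrite cz mul0r add0r ve.
    apply/eqP; apply/negP => vj; have vj' : v 0 j != 0 by apply/negP.
    (* The linear function h of x has nonzero slope; it takes the value -1 here. *)
    have := h (- (quad D e + 1) / (2 * v 0 j)).
    have -> : 2 * (- (quad D e + 1) / (2 * v 0 j)) * v 0 j + quad D e = -1.
      by field; rewrite vj'.
    by rewrite ler0N1.
  have [y|L LE] := IH D symD.
    by have := q 0 y; rewrite expr0n /= !mulr0 mul0r !add0r.
  exists (block_mx (0 : 'M[R]_1) (0 : 'M[R]_(1, n)) (0 : 'M[R]_(n, 1)) L : 'M[R]_(1 + n)).
  rewrite CE v0 tr_block_mx mulmx_block !trmx0 !mul0mx !mulmx0 !addr0 add0r -LE.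
  by congr block_mx; rewrite c11 cz raddf0.
have cp : 0 < c 0 0 by rewrite lt_neqAle eq_sym cnz.
pose r := Num.sqrt (c 0 0).
have r2 : r * r = c 0 0 by rewrite -expr2 sqr_sqrtr.
have r0 : r != 0 by rewrite gt_eqF // sqrtr_gt0.
have [||L LE] := IH (D - (c 0 0)^-1 *: (v^T *m v)).
- by rewrite linearB linearZ /= trmx_mul trmxK symD.
- move=> y.
  (* The minimum of the form over x is the value of the Schur complement at y. *)
  have := q (- (v *m y) 0 0 / c 0 0) y.
  have -> : quad (D - (c 0 0)^-1 *: (v^T *m v)) y =
      quad D y - (c 0 0)^-1 * (v *m y) 0 0 ^+ 2.
    have sB (p1 p2 : 'M[R]_1) : (p1 - p2) 0 0 = p1 0 0 - p2 0 0 by rewrite !mxE.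
    have sZ k (p1 : 'M[R]_1) : (k *: p1) 0 0 = k * p1 0 0 by rewrite mxE.
    have sM (p1 : 'M[R]_1) : (p1^T *m p1) 0 0 = p1 0 0 ^+ 2.
      by rewrite mxE big_ord1 mxE expr2.
    have hv : (y^T *m (v^T *m v) *m y) 0 0 = (v *m y) 0 0 ^+ 2.
      by rewrite mulmxA -trmx_mul -mulmxA sM.
    by rewrite /quad mulmxBr mulmxBl sB -scalemxAr -scalemxAl sZ hv.
  congr (_ <= _); field; exact: cnz.
exists (block_mx (r%:M : 'M[R]_1) (r^-1 *: v) (0 : 'M[R]_(n, 1)) L : 'M[R]_(1 + n)).
rewrite CE tr_block_mx mulmx_block !trmx0 !mul0mx !addr0 -LE.
rewrite tr_scalar_mx -scalar_mxM r2 -c11 mul_scalar_mx scalerA divff // scale1r.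
rewrite linearZ /= mul_mx_scalar scalerA divff // scale1r.
rewrite -scalemxAl -scalemxAr scalerA -invfM r2 mulmx0 addr0.
by congr block_mx; rewrite addrC subrK.
Qed.
End Cholesky.

Section GaussianVector.
Context (R : realType) d (T : measurableType d) (P : probability T R).
Context (M N : nat) (X : T -> 'M[R]_(M, N)).
Hypothesis gX : std_gaussian_mx P X.

(** Formal integration by parts applied to powers of a linear form f gives
    E(f^(n+2)) = (n + 1) sg^2 E(f^n), the same recursion as for the limiting
    moments of traces. *)
Lemma gaussian_linear_moments (J : finType) (pos : J -> 'I_M * 'I_N) (b : J -> R) n sg :
  injective pos -> sg ^+ 2 = \sum_j b j ^+ 2 ->
  intg P (fun w => (\sum_j b j * X w (pos j).1 (pos j).2) ^+ n) /\
  mean P (fun w => (\sum_j b j * X w (pos j).1 (pos j).2) ^+ n) = sg ^+ n * gauss_moment R n.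
Proof.
move=> pinj sgE.
pose xv (j : J) : mpoly #|{: var_index 1 M N}| R := formal_X R (0 : 'I_1) (pos j).1 (pos j).2.
pose f := \sum_j b j *: xv j.
have fG : in_vars (@group 1 M N 0) f.
  apply: in_vars_sum => j; apply: in_varsZ; apply: in_vars_X.
  by rewrite /group enum_rankK.
have fnG m : in_vars (@group 1 M N 0) (f ^+ m).
  elim: m => [|m IH]; first by rewrite expr0; exact: in_vars1.
  by rewrite exprS; exact: in_varsM.
have [h1 h2] := @mean_eval_group R _ T P 1 M N (fun _ => X) (fun=> gX) 0 (f ^+ n) (fnG n).
have evE : (fun w => eval_entries (fun=> X) w (f ^+ n)) =
   (fun w => (\sum_j b j * X w (pos j).1 (pos j).2) ^+ n).
  apply/funext => w; rewrite /eval_entries rmorphXn /=; congr (_ ^+ _).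
  rewrite /f raddf_sum; apply: eq_bigr => j _.
  by rewrite /= mevalZ mevalXU enum_rankK.
rewrite -evE; split=> //; rewrite {}h2 {h1 evE}.
have df j : mderiv (enum_rank ((0, pos j) : var_index 1 M N)) f = (b j)%:A.
  rewrite /f raddf_sum (bigD1 j) //= big1 ?addr0.
    by rewrite mderivZ [pos j]surjective_pairing mderiv_formal_X !eqxx.
  move=> i ij; rewrite mderivZ [pos j]surjective_pairing mderiv_formal_X eqxx /=.
  case: andP => [[/eqP h1 /eqP h2]|_]; last by rewrite mulr0n scaler0.
  have /pinj pij : pos i = pos j.
    by rewrite [LHS]surjective_pairing [RHS]surjective_pairing h1 h2.
  by rewrite pij eqxx in ij.
have dfn j m : mderiv (enum_rank ((0, pos j) : var_index 1 M N)) (f ^+ m) =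
    (m%:R * b j) *: f ^+ m.-1.
  elim: m => [|m IH].
    by rewrite expr0 mul0r scale0r -mpolyC1 mderivC.
  rewrite exprS mderivM df IH mulr_algl -scalerAr.
  case: m {IH} => [|m]; first by rewrite expr0 mul0r scale0r addr0 mul1r.
  by rewrite -exprS -scalerDl /= -[m.+2%:R]natr1 mulrDl mul1r addrC.
have gSS m : gauss (f ^+ m.+2) = m.+1%:R * sg ^+ 2 * gauss (f ^+ m).
  rewrite exprS {1}/f mulr_suml gauss_sum sgE mulr_sumr mulr_suml.
  apply: eq_bigr => j _; rewrite -scalerAl gaussZ /xv /formal_X -surjective_pairing.
  by rewrite gauss_ibp dfn gaussZ /=; ring.
have g1 : gauss f = 0.
  rewrite /f gauss_sum big1 // => j _; rewrite gaussZ /xv /formal_X -[mpolyX _ _]mulr1.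
  by rewrite gauss_ibp -mpolyC1 mderivC gauss0 mulr0.
have H : gauss (f ^+ n) = sg ^+ n * gauss_moment R n /\ gauss (f ^+ n.+1) = sg ^+ n.+1 * gauss_moment R n.+1.
  elim: n => [|m [IH1 IH2]].
    by rewrite expr0 gauss1 expr1 g1 gauss_moment1 mulr0 mulr1.
  by split=> //; rewrite gSS IH1 gauss_momentSS -[m.+2]addn2 exprD; ring.
by case: H.
Qed.

(** The first k entries of a row of X, multiplied by L, have covariance L^T L. *)
Lemma gaussian_image_moments k (L : 'M[R]_k) (M0 : (0 < M)%N) (kN : (k <= N)%N) :
  exists V : T -> 'rV[R]_k, (forall j, measurable_fun setT (fun w => V w 0 j)) /\
  forall (a : 'cV[R]_k) n sg, sg ^+ 2 = quad (L^T *m L) a ->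
    intg P (fun w => (V w *m a) 0 0 ^+ n) /\
    mean P (fun w => (V w *m a) 0 0 ^+ n) = sg ^+ n * gauss_moment R n.
Proof.
pose pos (j : 'I_k) := (Ordinal M0, widen_ord kN j).
have pos_inj : injective pos by move=> i j [ij]; apply/val_inj.
pose V0 w : 'rV[R]_k := \row_j X w (pos j).1 (pos j).2.
have mV0 j : measurable_fun setT (fun w => V0 w 0 j).
  by under eq_fun do rewrite mxE; case: gX => mX _ _; exact: mX.
exists (fun w => V0 w *m L); split=> [j|a n sg sgE].
  have -> : (fun w => (V0 w *m L) 0 j) = (fun w => \sum_i V0 w 0 i * L i j).
    by apply/funext => w; rewrite mxE.
  apply: measurable_sum => i; exact: measurable_funM.
pose b (j : 'I_k) := (L *m a) j 0.
have bE : sg ^+ 2 = \sum_j b j ^+ 2.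
  rewrite sgE /quad mulmxA -trmx_mul -mulmxA mxE; apply: eq_bigr => j _.
  by rewrite mxE expr2.
have -> : (fun w => (V0 w *m L *m a) 0 0 ^+ n) =
    (fun w => (\sum_j b j * X w (pos j).1 (pos j).2) ^+ n).
  apply/funext => w; congr (_ ^+ _); rewrite -mulmxA mxE.
  by apply: eq_bigr => j _; rewrite mulrC [V0 w 0 j]mxE.
exact: (gaussian_linear_moments n pos_inj bE).
Qed.
End GaussianVector.

(** * The loop equations for Wishart matrices *)
Section WishartFacts.
Context (R : realType) d (T : measurableType d) (P : probability T R).
Context (s M N : nat) (Wm : 'I_s -> T -> 'M[R]_N).
Hypothesis N0 : (0 < N)%N.
Hypothesis hW : forall i : 'I_s,
  wishart P ((N%:R^-1)%:M : 'M[R]_N) (1%:M : 'M[R]_M) (Wm i).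
Hypothesis hind : mutually_independent P (Wm : 'I_s -> T -> mxBorel R N N).
Let nu : R := N%:R^-1.

(** The matrices behind the W_i are chosen for all i at once. *)
Lemma wishart_data : exists (X : 'I_s -> T -> 'M[R]_(M, N)) (B : 'I_s -> 'M[R]_N),
  [/\ forall i, std_gaussian_mx P (X i), forall i, (B i)^T *m B i = nu%:M &
      forall i w, Wm i w = (B i)^T *m (X i w)^T *m 1%:M *m X i w *m B i].
Proof.
have /choice[XB H] : forall i, exists XB : (T -> 'M[R]_(M, N)) * 'M[R]_N,
    [/\ std_gaussian_mx P XB.1, XB.2^T *m XB.2 = nu%:M &
     forall w, Wm i w = XB.2^T *m (XB.1 w)^T *m 1%:M *m XB.1 w *m XB.2].
  by move=> i; have [X [A [gX _ AA WE]]] := hW i; exists (X, A).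
by exists (fun i => (XB i).1), (fun i => (XB i).2); split=> i; case: (H i).
Qed.

Lemma nuN1 : nu * N%:R = 1.
Proof. by rewrite /nu mulVf // pnatr_eq0 -lt0n. Qed.

Lemma mean_ntr_nil : mean_ntr P Wm nu [::] = 1.
Proof.
have [X [B [gX BB WE]]] := wishart_data.
by rewrite (mean_ntrE gX WE hind) phi_ntr_nil //; [exact: gaussZ|exact: gauss1|exact: nuN1].
Qed.

Lemma mean_cprod_nil : mean_cprod P Wm [::] = 1.
Proof.
have [X [B [gX BB WE]]] := wishart_data.
by rewrite (mean_cprodE gX WE hind) phi_cprod_nil // gauss1.
Qed.

Lemma mean_cprod_word_nil L : mean_cprod P Wm ([::] :: L) = 0.
Proof.
have [X [B [gX BB WE]]] := wishart_data.
by rewrite (mean_cprodE gX WE hind) phi_cprod_word_nil //; [exact: gaussZ|exact: gauss1].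
Qed.

Lemma mean_cprod1 w : mean_cprod P Wm [:: w] = 0.
Proof.
have [X [B [gX BB WE]]] := wishart_data.
by rewrite (mean_cprodE gX WE hind) phi_cprod1 //; [exact: gaussD|exact: gaussZ|exact: gauss1].
Qed.

Lemma mean_cprod_perm L L' : perm_eq L L' -> mean_cprod P Wm L = mean_cprod P Wm L'.
Proof.
move=> LL'; rewrite /mean_cprod; congr (mean P _); apply/funext => om.
exact: perm_big.
Qed.

Lemma mean_ntr_rec i w : mean_ntr P Wm nu (i :: w) = nu * M%:R * mean_ntr P Wm nu w +
  \sum_(p <- splits i w) (mean_ntr P Wm nu (i :: p.1) * mean_ntr P Wm nu p.2
    + nu * nu * mean_cprod P Wm [:: i :: p.1; p.2] + nu * mean_ntr P Wm nu (rev p.1 ++ i :: p.2)).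
Proof.
have [X [B [gX BB WE]]] := wishart_data.
have E := mean_ntrE gX WE hind nu; have K := mean_cprodE gX WE hind.
rewrite !E (phi_ntr_rec (@formal_DD R s M N B) (@formal_DZ R s M N B) (@formal_DM R s M N B) (formal_DY BB)
  (@gaussD R _) (@gaussZ R _) (@gauss1 R _) (@gauss_formal_Y R s M N B) nuN1).
by congr (_ + _); apply: eq_bigr => p _; rewrite !E K.
Qed.

Lemma mean_cprod_rec i w L : mean_cprod P Wm ((i :: w) :: L) = nu * M%:R * mean_cprod P Wm (w :: L)
  + \sum_(p <- splits i w)
    (mean_ntr P Wm nu (i :: p.1) * mean_cprod P Wm (p.2 :: L)
     + mean_ntr P Wm nu p.2 * mean_cprod P Wm ((i :: p.1) :: L)
     + nu * (mean_cprod P Wm ((i :: p.1) :: p.2 :: L)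
             - mean_cprod P Wm [:: i :: p.1; p.2] * mean_cprod P Wm L)
     + nu * mean_cprod P Wm ((rev p.1 ++ i :: p.2) :: L))
  + \sum_(q <- picks L) \sum_(g <- merges i w q.1)
     (mean_ntr P Wm nu g * mean_cprod P Wm q.2 + nu * mean_cprod P Wm (g :: q.2)).
Proof.
have [X [B [gX BB WE]]] := wishart_data.
have E := mean_ntrE gX WE hind nu; have K := mean_cprodE gX WE hind.
rewrite !K (phi_cprod_rec (@formal_DD R s M N B) (@formal_DZ R s M N B) (@formal_DM R s M N B) (formal_DY BB)
  (@gaussD R _) (@gaussZ R _) (@gauss1 R _) (@gauss_formal_Y R s M N B) nuN1).
congr (_ + _ + _); first by apply: eq_bigr => p _; rewrite !E !K.
by apply: eq_bigr => q _; apply: eq_bigr => g _; rewrite !E !K.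
Qed.

Lemma ctr_wishart_word_linear_moments (J : finType) (a : J -> R) (word : J -> seq 'I_s) n :
  intg P (fun om => (\sum_j a j * ctr_wishart_word P Wm (word j) om) ^+ n) /\
  mean P (fun om => (\sum_j a j * ctr_wishart_word P Wm (word j) om) ^+ n)
    = mom a word (mean_cprod P Wm) n [::].
Proof.
have [X [B [gX BB WE]]] := wishart_data.
rewrite -(mean_Z_cprod gX WE hind); have := intg_Z_cprod gX WE hind a word n [::].
by under eq_fun do rewrite big_nil mulr1; split=> //; congr (mean P _);
   apply/funext => om; rewrite big_nil mulr1.
Qed.

Lemma mean_cprod_no_rows w L : M = 0%N -> mean_cprod P Wm (w :: L) = 0.
Proof.
move=> M0; have [X [B [gX BB WE]]] := wishart_data.
have W0 i om : Wm i om = 0.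
  have X0 : X i om = 0 by apply/matrixP => -[a aM]; exfalso; rewrite M0 in aM.
  by rewrite WE X0 mulmx0 mul0mx.
have rtrE om om' : tr_wishart_word Wm w om = tr_wishart_word Wm w om'.
  by rewrite /tr_wishart_word /wishart_word; congr (\tr _); apply: eq_bigr => i _; rewrite !W0.
have crtr0 om : ctr_wishart_word P Wm w om = 0.
  rewrite /ctr_wishart_word; have -> : tr_wishart_word Wm w = (fun=> tr_wishart_word Wm w om).
    by apply/funext => om'; exact: rtrE.
  by rewrite mean_cst subrr.
rewrite /mean_cprod; under eq_fun do rewrite big_cons crtr0 mul0r.
exact: mean_cst.
Qed.

Lemma measurable_ctr_wishart_word w : measurable_fun setT (ctr_wishart_word P Wm w).
Proof.
have [X [B [gX BB WE]]] := wishart_data.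
apply: (@intg_measurable _ _ _ P).
exact: (proj1 (linked_mean gX WE hind (linked_ctr_wishart_word gX WE hind w))).
Qed.

End WishartFacts.

(** * Convergence of centred traces *)
Section GaussianLaw.
Context (R : realType) d (T : measurableType d) (P : probability T R) (k : nat).
Context (V : T -> 'rV[R]_k) (sg : 'cV[R]_k -> R).
Hypothesis mV : forall j, measurable_fun setT (fun w => V w 0 j).
Hypothesis HV : forall (a : 'cV[R]_k) n,
  intg P (fun w => (V w *m a) 0 0 ^+ n) /\
  mean P (fun w => (V w *m a) 0 0 ^+ n) = sg a ^+ n * gauss_moment R n.
Hypothesis sg0 : forall a, 0 <= sg a.

(** The law of V is a multivariate normal law: each linear functional has Gaussian
    moments, which determine its law. *)
Lemma gaussian_law : exists mu : probability (mxBorel R 1 k) R,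
  multivariate_normal mu /\
  forall (f : 'rV[R]_k -> R), continuous f -> intg P (f \o V) ->
    ('E_mu[f] = (mean P (f \o V))%:E)%E.
Proof.
have mVB : measurable_fun setT (V : T -> mxBorel R 1 k).
  by apply: measurable_mxBorel => i j; rewrite ord1.
pose Vm : {mfun T >-> mxBorel R 1 k} := mfun_Sub (mem_set mVB).
exists (distribution P Vm : probability (mxBorel R 1 k) R); split.
  move=> a; exists 0, (sg a); split=> // B mB.
  have mVa := measurable_linear a mV.
  have := @normal_law_of_moments R _ T P (fun w => (V w *m a) 0 0) (sg a) mVa (HV a) B mB.
  by [].
move=> f cf fi; rewrite -expectation_mean // !unlock.
rewrite integral_distribution //.
by apply/measurable_EFinP; exact: continuous_mxBorel_measurable.
Qed.
End GaussianLaw.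

Theorem corollary1p9 (R : realType) (s : nat) (hs : (1 <= s)%N)
  (t : nat -> 'I_s) (k : nat) (hk : (1 <= k)%N)
  (d : nat -> measure_display) (T : forall N, measurableType (d N))
  (P : forall N, probability (T N) R)
  (M : nat -> nat) (lambda : R) (hlambda : 0 <= lambda)
  (hM : (fun N => (M N)%:R / N%:R : R) @ \oo --> lambda)
  (W : forall N, 'I_s -> T N -> 'M[R]_N)
  (hW : forall N, (0 < N)%N -> forall i : 'I_s,
    wishart (P N) ((N%:R^-1)%:M : 'M[R]_N) (1%:M : 'M[R]_(M N)) (W N i))
  (hind : forall N, (0 < N)%N ->
    mutually_independent (P N) (W N : 'I_s -> T N -> mxBorel R N N)) :
  exists mu : probability (mxBorel R 1 k) R,
    multivariate_normal mu /\
    cvg_in_distribution P (fun N => centered_traces (P N) k t (W N)) mu.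
Proof.
(* The hypotheses concern N > 0, so the sequences are indexed by N.+1. *)
pose nu N : R := N.+1%:R^-1.
pose m N := mean_ntr (P N.+1) (W N.+1) (nu N).
pose K N := mean_cprod (P N.+1) (W N.+1).
pose al N : R := nu N * (M N.+1)%:R.
have al_cvg : al @ \oo --> lambda.
  have -> : al = (fun N => (M N.+1)%:R / N.+1%:R).
    by apply/funext => N; rewrite /al /nu mulrC.
  by move: hM; rewrite -cvg_shiftS.
have nu_cvg : nu @ \oo --> (0 : R) by exact: cvg_harmonic.
have m_nil N : m N [::] = 1 by exact: (mean_ntr_nil (ltn0Sn N) (hW N.+1 (ltn0Sn N)) (hind N.+1 (ltn0Sn N))).
have K_nil N : K N [::] = 1 by exact: (mean_cprod_nil (hW N.+1 (ltn0Sn N)) (hind N.+1 (ltn0Sn N))).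
have K_word_nil N L : K N ([::] :: L) = 0.
  exact: (mean_cprod_word_nil (hW N.+1 (ltn0Sn N)) (hind N.+1 (ltn0Sn N))).
have K1 N w : K N [:: w] = 0 by exact: (mean_cprod1 (hW N.+1 (ltn0Sn N)) (hind N.+1 (ltn0Sn N))).
have K_perm N L L' : perm_eq L L' -> K N L = K N L' by exact: mean_cprod_perm.
have m_rec N i w := mean_ntr_rec (ltn0Sn N) (hW N.+1 (ltn0Sn N)) (hind N.+1 (ltn0Sn N)) i w.
have K_rec N i w L := mean_cprod_rec (ltn0Sn N) (hW N.+1 (ltn0Sn N)) (hind N.+1 (ltn0Sn N)) i w L.
pose word (j : 'I_k) : seq 'I_s := [seq t r | r <- index_iota 1 j.+2].
pose S2 (a : 'cV[R]_k) := sigma2 K (fun j => a j 0) word.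
pose sg (a : 'cV[R]_k) : R := Num.sqrt (S2 a).
have Zmom N (a : 'cV[R]_k) n := ctr_wishart_word_linear_moments (hW N.+1 (ltn0Sn N)) (hind N.+1 (ltn0Sn N))
  (fun j => a j 0) word n.
have cmom := cvg_mom al_cvg nu_cvg m_nil K_nil K_word_nil m_rec K_rec.
have momM (a : 'cV[R]_k) n : (fun N => mean (P N.+1) (fun om =>
    (\sum_j a j 0 * ctr_wishart_word (P N.+1) (W N.+1) (word j) om) ^+ n)) @ \oo -->
    mom (fun j => a j 0) word (klim K) n [::].
  by under eq_fun => N do rewrite (Zmom N a n).2; exact: cmom.
(* A limit of means of squares. *)
have S2_ge0 a : 0 <= S2 a.
  rewrite /S2 -mom2.
  have h := momM a 2; rewrite -(cvg_lim _ h) //.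
  apply: limr_ge; first by apply/cvg_ex; eexists; exact: h.
  near=> N; rewrite -[leLHS](mean_cst (P N.+1)); apply: mean_le.
  - exact: intg_cst.
  - by have [] := Zmom N a 2.
  - by move=> w; exact: sqr_ge0.
have sg2 a : sg a ^+ 2 = S2 a by rewrite sqr_sqrtr.
have momG (a : 'cV[R]_k) n : mom (fun j => a j 0) word (klim K) n [::] = sg a ^+ n * gauss_moment R n.
  by apply: (mom_gaussian al_cvg nu_cvg m_nil K_nil K_word_nil K1 K_perm m_rec K_rec); exact: sg2.
pose C : 'M[R]_k := \matrix_(i, j) klim K [:: word i; word j].
have CE a : quad C a = S2 a.
  rewrite /quad /S2 /sigma2 mxE exchange_big /=; apply: eq_bigr => j _.
  rewrite mxE mulr_suml; apply: eq_bigr => i _; rewrite !mxE; ring.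
have [||L LE] := @psd_factor R k C.
- apply/matrixP => i j; rewrite !mxE.
  apply: (klim_perm al_cvg nu_cvg m_nil K_nil K_word_nil K_perm m_rec K_rec).
  exact: (permEl (perm_catC [:: word j] [:: word i])).
- by move=> a; rewrite CE.
have [N0 [V [mV momV]]] : exists N (V : T N -> 'rV[R]_k),
    (forall j, measurable_fun setT (fun w => V w 0 j)) /\
    forall (a : 'cV[R]_k) n, intg (P N) (fun w => (V w *m a) 0 0 ^+ n) /\
      mean (P N) (fun w => (V w *m a) 0 0 ^+ n) = sg a ^+ n * gauss_moment R n.
  have [[N [kN M0]]|noM] := pselect (exists N, (k <= N.+1)%N /\ (0 < M N.+1)%N).
    (* A single matrix is used, so any of them will do. *)
    have [X [_ [gX _ _]]] := wishart_data (hW N.+1 (ltn0Sn N)).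
    have [V [mV momV]] := gaussian_image_moments (gX (t 0%N)) L M0 kN.
    exists N.+1, V; split=> // a n; apply: momV.
    by rewrite -LE CE sg2.
  (* No matrix of size at least k has a row to take Gaussian entries from; the
     covariances then vanish for all large N. *)
  have M0 N : (k <= N.+1)%N -> M N.+1 = 0%N.
    by move=> kN; apply/eqP; rewrite -leqn0 leqNgt; apply/negP => h; apply: noM; exists N.
  have C0 i j : klim K [:: word i; word j] = 0.
    have h : (K ^~ [:: word i; word j]) @ \oo --> klim K [:: word i; word j].
      exact: (cvg_k al_cvg nu_cvg m_nil K_nil K_word_nil m_rec K_rec).
    apply/esym; apply: (cvg_unique (@Rhausdorff R) _ h); apply: cvg_near_cst.
    near=> N; apply: mean_cprod_no_rows (hW N.+1 (ltn0Sn N)) _ _ (M0 _ _).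
    by rewrite leqW //; near: N; exists k.
  have sg0 a : sg a = 0.
    by rewrite /sg /S2 /sigma2 !big1 ?sqrtr0 // => i _; rewrite big1 // => j _; rewrite C0 mulr0.
  exists 0%N, (fun=> 0); split=> [j|a n]; first exact: measurable_cst.
  rewrite mul0mx mxE sg0; split; first exact: intg_cst.
  rewrite mean_cst; case: n => [|n]; first by rewrite !expr0 mul1r.
  by rewrite exprS !mul0r.
have [mu [mu_normal muE]] := gaussian_law mV momV (fun a => sqrtr_ge0 (S2 a)).
exists mu; split=> // f cf [c fc].
pose Y N := centered_traces (P N.+1) k t (W N.+1).
have YE N w j : Y N w 0 j = ctr_wishart_word (P N.+1) (W N.+1) (word j) w.
  have wordE w' : tr_wishart_word (W N.+1) (word j) w' = tr_prod t (W N.+1) j.+1 w'.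
    by rewrite /tr_wishart_word /wishart_word big_map.
  rewrite mxE /ctr_wishart_word wordE /mean; congr (_ - fine _).
  by congr ('E_(P N.+1)[_])%E; apply/funext => w'; rewrite wordE.
have YaE N (a : 'cV[R]_k) w : (Y N w *m a) 0 0 =
    \sum_j a j 0 * ctr_wishart_word (P N.+1) (W N.+1) (word j) w.
  by rewrite mxE; apply: eq_bigr => j _; rewrite YE mulrC.
have mY N j : measurable_fun setT (fun w => Y N w 0 j).
  under eq_fun do rewrite YE.
  exact: (measurable_ctr_wishart_word (hW N.+1 (ltn0Sn N)) (hind N.+1 (ltn0Sn N))).
have iY N (a : 'cV[R]_k) n : intg (P N.+1) (fun w => (Y N w *m a) 0 0 ^+ n).
  by under eq_fun do rewrite YaE; exact: (Zmom N a n).1.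
have cY (a : 'cV[R]_k) n : (fun N => mean (P N.+1) (fun w => (Y N w *m a) 0 0 ^+ n)) @ \oo -->
    sg a ^+ n * gauss_moment R n.
  by under eq_fun => N' do under eq_fun do rewrite YaE; rewrite -momG; exact: momM.
have [ifY ifV fYV] := @cvg_of_gaussian_moments R (fun N => d N.+1) (fun N => T N.+1)
  (fun N => P N.+1) _ (T N0) (P N0) k Y V sg mY mV iY (fun a n => (momV a n).1) cY
  (fun a n => (momV a n).2) f c cf fc.
rewrite (muE f cf ifV) -cvg_shiftS.
under eq_fun => N' do rewrite (expectation_mean (ifY N')).
by apply: cvg_EFin; [exact: nearW | exact: fYV].
Unshelve. all: by end_near.
Qed.
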